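(* Let $F$ be a non-Archimedean local field (of arbitrary characteristic), and let $d,D\ge 1$ be integers. Let $X\subseteq\mathbb{A}_F^{n+m}$ be a smooth $n$-dimensional $F$-subvariety defined by $g_1=\cdots=g_m=0$ for polynomials $g_1,\ldots,g_m\in F[x_1,\ldots,x_{n+m}]$ of degree $\le D$. Let $\varphi_1,\ldots,\varphi_r\in F[x_1,\ldots,x_{n+m}]$ be polynomials of degree $\le d$ such that for every irreducible component $X'$ of $X$, the restrictions $\varphi_1|_{X'},\ldots,\varphi_r|_{X'}$ are not all identically zero. Let $J:=\langle\varphi_{1,F},\ldots,\varphi_{r,F}\rangle$ be the ideal of $F$-analytic functions on $X(F)$ generated by the analytic maps $\varphi_{i,F}:X(F)\to F$ induced from $\varphi_i$. Then for every $x_0\in X(F)$, $$\mathrm{lct}_F(J;x_0)\ge\frac{1}{d\cdot D^m}.$$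
   Context: $F$ is a non-Archimedean local field with ring of integers $\mathcal{O}_F$, residue cardinality $q_F$, and absolute value $|\cdot|_F$, normalized so that a uniformizer $\varpi_F$ satisfies $|\varpi_F|_F=q_F^{-1}$. Fix the Haar measure $\mu_{F^n}$ on $F^n$ such that $\mathcal{O}_F^n$ has volume $1$. For a smooth $F$-variety $X$, the set $X(F)$ is regarded as an $F$-analytic manifold. For an $F$-analytic manifold $Y$ of dimension $n$ with atlas $(U_\alpha,\psi_\alpha:U_\alpha\to F^n)_\alpha$, a smooth measure on $Y$ is a measure $\mu$ such that each $(\psi_\alpha)_*(\mu|_{U_\alpha})$ has a locally constant density with respect to the Haar measure on $F^n$; $\mathcal{M}_c^\infty(Y)$ denotes the space of compactly supported smooth measures on $Y$. Analytic log-canonical threshold: let $J$ be an ideal in the ring of $F$-analytic functions on $Y$ whose germ $J_{x_0}$ at $x_0\in Y$ is non-zero and is generated by the germs of $F$-analytic functions $f_1,\ldots,f_r:V\to F$ defined on an open neighborhood $V$ of $x_0$. Then $\mathrm{lct}_F(J;x_0)\in[0,\infty]$ is the supremum of all $s\ge 0$ for which there exists an open neighborhood $U\subset V$ of $x_0$ such that for every $\mu\in\mathcal{M}_c^\infty(U)$, $$\int_U \min_{1\le i\le r}|f_i(x)|_F^{-s}\,d\mu(x)<\infty$$ (where $0^{-s}=+\infty$ for $s>0$). This does not depend on the choice of generators of $J_{x_0}$. *)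

(* Defs.v *)
From HB Require Import structures.
From mathcomp Require Import all_boot all_order all_algebra.
From mathcomp Require Import all_classical all_reals all_analysis.
(* mpoly's notations clash with those of mathcomp-analysis, hence its
   notation-free import: [mpoly n F] is the ring F[x_1, ..., x_n]. *)
From mathcomp Require Export -(notations) mpoly.

Set Implicit Arguments.
Unset Strict Implicit.
Unset Printing Implicit Defensive.

Import Order.TTheory GRing.Theory Num.Theory.

Local Open Scope classical_set_scope.
Local Open Scope ring_scope.

(* A field, complete for a discrete non-Archimedean absolute value with finite
   residue field.  The absolute value is the normalized one: [resq] is the
   cardinality of the residue field, with a system of representatives indexed
   by ['I_resq] in [resfield], and a uniformizer has absolute value 1 / resq.
   The characteristic is arbitrary. *)
HB.mixin Record isNonArchLocalField (R : realType) F of GRing.Field F := {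
  absv : F -> R;
  resq : nat;
  absv_ge0 : forall x, 0 <= absv x;
  absv_eq0 : forall x, absv x = 0 <-> x = 0;
  absvM : forall x y, absv (x * y) = absv x * absv y;
  absvD : forall x y, absv (x + y) <= Num.max (absv x) (absv y);
  resfield : exists rep : 'I_resq -> F,
    (forall i, absv (rep i) <= 1) /\
    (forall x, absv x <= 1 -> exists! i, absv (x - rep i) < 1);
  uniformizer : exists pi : F, absv pi = (resq%:R)^-1;
  absv_discrete : forall x, x <> 0 -> exists k : int, absv x = (resq%:R : R) ^ k;
  absv_complete : forall u : nat -> F,
    (forall e : R, 0 < e ->
       exists N, forall i j, (N <= i)%N -> (N <= j)%N -> absv (u i - u j) < e) ->
    exists l, forall e : R, 0 < e ->
      exists N, forall i, (N <= i)%N -> absv (u i - l) < e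
}.

#[short(type="nonArchLocalFieldType")]
HB.structure Definition NonArchLocalField (R : realType) :=
  {F of GRing.Field F & isNonArchLocalField R F}.

Section distance.
Context {R : realType} {F : nonArchLocalFieldType R}.

Definition dist (x y : F) : R := absv (x - y).

Lemma distxx x : dist x x = 0.
Proof. by apply/absv_eq0; rewrite subrr. Qed.

Lemma dist_positivity x y : dist x y = 0 -> x = y.
Proof. by move=> /absv_eq0/eqP; rewrite subr_eq0 => /eqP. Qed.

Lemma absvN (x : F) : absv (- x) = absv x.
Proof.
have absv1 : absv (1 : F) = 1.
  have : absv (1 : F) != 0 by apply/eqP => /absv_eq0/eqP; rewrite oner_eq0.
  by move=> /mulfI; apply; rewrite -absvM !mulr1.
rewrite -mulN1r absvM; suff -> : absv (-1 : F) = 1 by rewrite mul1r.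
have /eqP : absv (-1 : F) ^+ 2 = 1 by rewrite expr2 -absvM mulrNN mulr1.
rewrite sqrf_eq1 => /orP[/eqP//|/eqP abs1].
by have := absv_ge0 (-1 : F); rewrite abs1 ler0N1.
Qed.

Lemma dist_sym x y : dist x y = dist y x.
Proof. by rewrite /dist -absvN opprB. Qed.

Lemma dist_triangle y x z : dist x z <= dist x y + dist y z.
Proof.
rewrite /dist -[x in x - z](subrK y) -addrA (le_trans (absvD _ _))//.
by rewrite ge_max lerDl lerDr !absv_ge0.
Qed.

End distance.

(* The library then gives 'rV[F]_n the product topology. *)
#[non_forgetful_inheritance]
HB.instance Definition _ (R : realType) (F : nonArchLocalFieldType R) :=
  isMetric.Build R (NonArchLocalField.sort F) (@distxx R F) (@dist_positivity R F)
    (@dist_sym R F) (@dist_triangle R F).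

(* The points of Spec A, for A commutative, are its prime ideals: in the
   library, [prime_idealr A] is the type of the proper prime ideals of A. *)

Definition zero_locus (A : comNzRingType) (S : set A) : set (prime_idealr A) :=
  [set P | forall f, S f -> f \in P].

Definition zariski_closed (A : comNzRingType) (Z : set (prime_idealr A)) :=
  exists S : set A, Z = zero_locus S.

Definition irreducible (A : comNzRingType) (Z : set (prime_idealr A)) :=
  Z !=set0 /\
  forall Z1 Z2, zariski_closed Z1 -> zariski_closed Z2 ->
    Z `<=` Z1 `|` Z2 -> Z `<=` Z1 \/ Z `<=` Z2.

Definition irreducible_component (A : comNzRingType)
    (X Z : set (prime_idealr A)) :=
  [/\ Z `<=` X, irreducible Z &
      forall W, W `<=` X -> irreducible W -> Z `<=` W -> W `<=` Z].

(* The functions vanishing identically on Z: f has value 0 in the residue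
   field of A at P if and only if f belongs to P. *)
Definition vanishing_ideal (A : comNzRingType) (Z : set (prime_idealr A)) :
    set A :=
  [set f | forall P, Z P -> f \in P].

(* The reduced closed subvariety X of the affine (n + m)-space is smooth over F
   of dimension n at its point P: near P, its ideal is generated by m functions
   whose differentials are linearly independent over the residue field of P
   (i.e. modulo P). *)
Definition smooth_at (F : fieldType) (n m : nat)
    (X : set (prime_idealr (mpoly (n + m) F)))
    (P : prime_idealr (mpoly (n + m) F)) :=
  exists h : 'I_m -> mpoly (n + m) F,
    [/\ forall i, vanishing_ideal X (h i),
        forall f, vanishing_ideal X f ->
          exists (u : mpoly (n + m) F) (c : 'I_m -> mpoly (n + m) F),
            u \notin P /\ u * f = \sum_i c i * h i &
        forall c : 'I_m -> mpoly (n + m) F,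
          (forall j, \sum_i c i * mderiv j (h i) \in P) -> forall i, c i \in P].

Definition smooth_of_dim (F : fieldType) (n m : nat)
    (X : set (prime_idealr (mpoly (n + m) F))) :=
  forall P, X P -> smooth_at X P.

(* X(F), for X the zero locus of the g_j in the affine N-space. *)
Definition eval_at (F : fieldType) (N : nat) (x : 'rV[F]_N) (p : mpoly N F) : F :=
  meval (fun i => x 0 i) p.

Definition rational_points (F : fieldType) (N m : nat) (g : 'I_m -> mpoly N F) :
    set 'rV[F]_N :=
  [set x | forall j, eval_at x (g j) = 0].

(* A chart, with domain [cdom]; [cmap] is only relevant on [cdom]. *)
Record chart (F Y : Type) (n : nat) := Chart {
  cdom : set Y;
  cmap : Y -> 'rV[F]_n
}.

(* On D and near y, the function f is the sum of a power series, centered at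
   u y, in the n coordinates of u.  The bound on the coefficients makes the
   series absolutely convergent on the polydisc of radius rho, so that its
   summation by increasing total degree is harmless. *)
Definition power_series_at (R : realType) (F : nonArchLocalFieldType R)
    (Y : Type) (n : nat) (D : set Y) (u : Y -> 'rV[F]_n) (f : Y -> F) (y : Y) :=
  exists (c : multinom n -> F) (rho B : R),
    [/\ 0 < rho,
        forall a, absv (c a) * rho ^+ mdeg a <= B &
        forall z, D z -> ball (u y) rho (u z) ->
          (fun k => \sum_(a : bmultinom n k)
             c (bmnm a) * \prod_i (u z 0 i - u y 0 i) ^+ (bmnm a : multinom n) i)
          @ \oo --> f z].

(* In the following, an n-dimensional F-analytic manifold is a topological
   space Y with an atlas. *)

Definition analytic_at (R : realType) (F : nonArchLocalFieldType R)
    (Y : topologicalType) (n : nat) (atlas : set (chart F Y n))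
    (f : Y -> F) (y : Y) :=
  forall psi, atlas psi -> cdom psi y -> power_series_at (cdom psi) (cmap psi) f y.

(* The manifold structure of a submanifold X of F^N: all the charts psi that,
   as well as their inverses, are analytic with respect to the coordinates of
   F^N (in particular they are homeomorphisms between open sets, and any two of
   them are compatible). *)
Definition submanifold_atlas (R : realType) (F : nonArchLocalFieldType R)
    (N n : nat) (X : set 'rV[F]_N) : set (chart F X n) :=
  [set psi : chart F X n |
    [/\ open (cdom psi), set_inj (cdom psi) (cmap psi),
        open (cmap psi @` cdom psi),
        forall x, cdom psi x -> forall j,
          power_series_at (cdom psi) (@set_val _ X) (fun z => cmap psi z 0 j) x &
        forall x, cdom psi x -> forall i,
          power_series_at (cdom psi) (cmap psi) (fun z => set_val z 0 i) x]].

Definition analytic_ideal (R : realType) (F : nonArchLocalFieldType R)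
    (Y : topologicalType) (n : nat) (atlas : set (chart F Y n))
    (r : nat) (phi : 'I_r -> Y -> F) : set (Y -> F) :=
  [set f | exists a : 'I_r -> Y -> F,
    (forall i y, analytic_at atlas (a i) y) /\
    (forall y, f y = \sum_i a i y * phi i y)].

(* The functions whose germ at x0 is in the ideal, of the ring of germs at x0
   of analytic functions, that is generated by the germs of the elements of J.
   For J an ideal of analytic functions, this is J_{x0}. *)
Definition germ_ideal (R : realType) (F : nonArchLocalFieldType R)
    (Y : topologicalType) (n : nat) (atlas : set (chart F Y n))
    (J : set (Y -> F)) (x0 : Y) : set (Y -> F) :=
  [set f | exists k (a h : 'I_k -> Y -> F),
    [/\ forall i, \forall y \near x0, analytic_at atlas (a i) y,
        forall i, J (h i) &
        \forall y \near x0, f y = \sum_i a i y * h i y]].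

(* The Borel sigma-algebra.  The base point only serves to make the type
   pointed, as required of the measurable types of the library. *)
Definition pointed_at (T : Type) (t : T) : Type := T.

HB.instance Definition _ (T : topologicalType) (t : T) :=
  Topological.on (pointed_at t).
HB.instance Definition _ (T : topologicalType) (t : T) :=
  isPointed.Build (pointed_at t) t.

Definition borel (T : topologicalType) (t : T) :=
  g_sigma_algebraType (@open (pointed_at t)).

(* The Haar measure of F^n giving volume 1 to the unit ball O_F^n. *)
Definition normalized_haar (R : realType) (F : nonArchLocalFieldType R)
    (n : nat) (mu : {measure set (borel (0 : 'rV[F]_n)) -> \bar R}) :=
  (forall (a : 'rV[F]_n) (E : set (borel (0 : 'rV[F]_n))), measurable E ->
     mu [set x + a | x in (E : set 'rV[F]_n)] = mu E) /\
  mu [set x : 'rV[F]_n | forall i, absv (x 0 i) <= 1] = 1%E.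

(* In each chart psi, with domain U, the direct image psi_*(mu|_U) has on the
   open set psi(U) a locally constant density [dens] with respect to haar. *)
Definition smooth_measure (R : realType) (F : nonArchLocalFieldType R) (n : nat)
    (haar : {measure set (borel (0 : 'rV[F]_n)) -> \bar R})
    (Y : topologicalType) (atlas : set (chart F Y n)) (x0 : Y)
    (mu : {measure set (borel x0) -> \bar R}) :=
  forall psi, atlas psi ->
    exists dens : 'rV[F]_n -> R,
      [/\ forall x, 0 <= dens x,
          forall x, (cmap psi @` cdom psi) x -> \forall y \near x, dens y = dens x &
          forall E : set (borel (0 : 'rV[F]_n)), measurable E ->
            mu (cdom psi `&` cmap psi @^-1` E) =
            (\int[haar]_(x in cmap psi @` cdom psi `&` E) (dens x)%:E)%E].

(* An element of M_c^oo(U), for U open in Y, is seen as a smooth measure on Y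
   whose support is a compact subset of U. *)
Definition compactly_supported_in (R : realType) (Y : topologicalType) (x0 : Y)
    (U : set Y) (mu : {measure set (borel x0) -> \bar R}) :=
  exists K : set Y, [/\ compact K, K `<=` U & mu.-negligible (~` K)].

(* t^(-s) for s, t >= 0; the library's 0 `^ (- s) is 0 for s > 0. *)
Definition neg_power (R : realType) (t s : R) : \bar R :=
  if (t == 0) && (0 < s) then +oo%E else (t `^ (- s))%:E.

(* The germs at x0 of f_1, ..., f_r, analytic on the open neighborhood V of x0,
   generate J_{x0}. *)
Definition generators_at (R : realType) (F : nonArchLocalFieldType R)
    (Y : topologicalType) (n : nat) (atlas : set (chart F Y n))
    (J : set (Y -> F)) (x0 : Y) (r : nat) (V : set Y) (f : 'I_r -> Y -> F) :=
  [/\ open V, V x0, forall i y, V y -> analytic_at atlas (f i) y &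
      germ_ideal atlas J x0 = germ_ideal atlas (range f) x0].

Definition lct_of_generators (R : realType) (F : nonArchLocalFieldType R)
    (n : nat) (haar : {measure set (borel (0 : 'rV[F]_n)) -> \bar R})
    (Y : topologicalType) (atlas : set (chart F Y n)) (x0 : Y)
    (r : nat) (V : set Y) (f : 'I_r -> Y -> F) : \bar R :=
  ereal_sup [set s%:E | s in [set s : R | 0 <= s /\
    exists U : set Y, [/\ open U, U x0, U `<=` V &
      forall mu : {measure set (borel x0) -> \bar R},
        smooth_measure haar atlas mu -> compactly_supported_in U mu ->
        (\int[mu]_(x in U)
           \big[Order.min/+oo]_(i < r) neg_power (absv (f i x)) s < +oo)%E]]].

(* [lct_of_generators] takes the same value at all the systems of generators of
   J_{x0}: the infimum over all of them is this common value. *)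
Definition lct (R : realType) (F : nonArchLocalFieldType R)
    (n : nat) (haar : {measure set (borel (0 : 'rV[F]_n)) -> \bar R})
    (Y : topologicalType) (atlas : set (chart F Y n))
    (J : set (Y -> F)) (x0 : Y) : \bar R :=
  ereal_inf [set l | exists r (V : set Y) (f : 'I_r -> Y -> F),
    generators_at atlas J x0 V f /\ l = lct_of_generators haar atlas x0 V f].

(* Main.v *)
(* Near a point of X(F), the implicit function theorem presents X as the graph of
   convergent power series over the unit polydisc O_F^n.  Some phi = phi_i has a
   non-zero germ there, since the germs vanishing at the point cut out an
   irreducible component of X; let k be the order at the origin of the power series
   f(y) that phi induces on the polydisc.

   Bound on k.  On a line y = t v where the leading form of f does not vanish, phi has
   order exactly k in t, and g_1, ..., g_m restricted to the fibres over t is a system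
   of parameters.  Hence the products g^s phi^i t^j with j < k are linearly independent
   over F, and counting the polynomials of degree <= T in m + 1 variables gives, as T
   tends to infinity, k <= d D^m.

   Sublevel sets.  If |f| <= C q^(-kl) at k + 1 points of a line of direction v that
   are q^(-l)-separated, divided differences contradict the size of the coefficient of
   degree k of f on this line.  So the translates of E = {|f| <= C q^(-kl)} along q^l
   such points of a line cover each point at most k times, and E has measure at most
   k q^(-l).  Summing over l, the integral of |f|^(-s) converges as soon as k s < 1.
   Finally |phi| is bounded near the point by a multiple of the maximum of the |f_j|,
   whatever the generators f_j. *)

From HB Require Import structures.
Require Import Defs.
From mathcomp Require Import all_boot all_order all_algebra.
From mathcomp Require Import all_classical all_reals all_analysis.
From mathcomp Require Import measurable_realfun zify lra.

Set Implicit Arguments.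
Unset Strict Implicit.
Unset Printing Implicit Defensive.

Import Order.TTheory GRing.Theory Num.Theory.

Local Open Scope classical_set_scope.
Local Open Scope ring_scope.

(** * Orders of vanishing and substitution *)

(** Power series are handled as limits of polynomials in Gauss norm, and local algebra is done with
    polynomials modulo an ideal plus all terms of order at least J, for every J. The g_j may cut out
    X with multiplicities, so their restrictions to a fibre need not generate the ideal of the
    point. But local equations of X vanish on X, so their powers lie in the ideal of the g_j; as
    they generate the ideal of the point of the fibre, the g_j form a system of parameters there.
    Such a system satisfies no relation all of whose coefficients are units. Units come from the
    orders k i + j of the products phi^i t^j with j < k along the line: they are distinct, so for
    small t one term dominates in any linear combination. For the choice of phi_i, the condition on
    components is global whereas the germ is local. A polynomial with zero germ lies in every adic
    neighbourhood of the ideal of the local equations, and Krull's theorem converts this into an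
    algebraic statement about a multiple of it. *)

Section OrderOfVanishing.
Context (F : fieldType) (n : nat).
Implicit Types (p q : mpoly n F) (a b : multinom n) (J K : nat).

(** Membership in the J-th power of the ideal of the origin. *)
Definition ordge J p := forall a, (mdeg a < J)%N -> mcoeff a p = 0.

Lemma ordge0 p : ordge 0 p. Proof. by []. Qed.

Lemma ordge_zero J : ordge J 0. Proof. by move=> a _; rewrite mcoeff0. Qed.

Lemma ordgeW J K p : (J <= K)%N -> ordge K p -> ordge J p.
Proof. by move=> JK pK a aJ; rewrite pK// (leq_trans aJ). Qed.

Lemma ordgeD J p q : ordge J p -> ordge J q -> ordge J (p + q).
Proof. by move=> pJ qJ a aJ; rewrite mcoeffD pJ// qJ// addr0. Qed.

Lemma ordgeZ J c p : ordge J p -> ordge J (c *: p).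
Proof. by move=> pJ a aJ; rewrite mcoeffZ pJ// mulr0. Qed.

Lemma ordge_sum J (I : Type) (r : seq I) (P : pred I) (p : I -> mpoly n F) :
  (forall i, P i -> ordge J (p i)) -> ordge J (\sum_(i <- r | P i) p i).
Proof.
by move=> pJ; apply: big_ind => //; [exact: ordge_zero|exact: ordgeD].
Qed.

Lemma ordgeM J K p q : ordge J p -> ordge K q -> ordge (J + K) (p * q).
Proof.
move=> pJ qK a aJK; rewrite mcoeffM big1// => -[k1 k2] /= /eqP a12.
have := mdegD (bmnm k1) (bmnm k2); rewrite -a12 => a12'; rewrite a12' in aJK.
have [k1J|k1J] := ltnP (mdeg (bmnm k1)) J; first by rewrite pJ// mul0r.
rewrite qK ?mulr0//= -(ltn_add2l (mdeg k1)) (leq_trans aJK)//.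
by rewrite leq_add2r.
Qed.

Lemma ordgeMl J p q : ordge J q -> ordge J (p * q).
Proof. by move=> qJ; rewrite -[J]add0n; apply: ordgeM. Qed.

Lemma ordgeMr J p q : ordge J p -> ordge J (p * q).
Proof. by move=> pJ; rewrite mulrC; apply: ordgeMl. Qed.

Lemma ordge_exp J p k : ordge J p -> ordge (J * k) (p ^+ k).
Proof.
move=> pJ; elim: k => [|k IHk]; first by rewrite muln0.
by rewrite mulnS exprS; apply: ordgeM.
Qed.

Lemma ordgeX a : ordge (mdeg a) (mpolyX F a).
Proof.
by move=> b ba; rewrite mcoeffX; case: eqP => // ab; rewrite ab ltnn in ba.
Qed.

Lemma ordge1P p : mcoeff mnm0 p = 0 -> ordge 1 p.
Proof. by move=> p0 a; rewrite ltnS leqn0 mdeg_eq0 => /eqP ->. Qed.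

End OrderOfVanishing.

Lemma ordge_mmap1 (F : fieldType) n k (f : 'I_n -> mpoly k F) (s : multinom n) :
  (forall i, ordge 1 (f i)) -> ordge (mdeg s) (mmap1 f s).
Proof.
move=> f1; rewrite mdegE /mmap1.
apply: (big_ind2 (fun J p => ordge J p)) => [|J p K q|i _].
- exact: ordge0.
- exact: ordgeM.
- by have := ordge_exp (k := s i) (f1 i); rewrite mul1n.
Qed.

Lemma mmap1D (n : nat) (S : comNzRingType) (h : 'I_n -> S) a b :
  mmap1 h (mnm_add a b) = mmap1 h a * mmap1 h b.
Proof. by apply: commr_mmap1_M => i x; apply: mulrC. Qed.

Definition psub (F : fieldType) (n k : nat) (q : 'I_n -> mpoly k F)
  (p : mpoly n F) : mpoly k F := mmap (@mpolyC k F) q p.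

HB.instance Definition _ (F : fieldType) n k (q : 'I_n -> mpoly k F) :=
  GRing.RMorphism.copy (psub q) (mmap (@mpolyC k F) q).

Section Substitution.
Context (F : fieldType) (n k : nat) (q : 'I_n -> mpoly k F).

Lemma psub_sum (I : Type) (r : seq I) (P : pred I) (p : I -> mpoly n F) :
  psub q (\sum_(i <- r | P i) p i) = \sum_(i <- r | P i) psub q (p i).
Proof. exact: (raddf_sum (psub q)). Qed.

Lemma psubD p p' : psub q (p + p') = psub q p + psub q p'.
Proof. exact: (rmorphD (psub q)). Qed.

Lemma psubB p p' : psub q (p - p') = psub q p - psub q p'.
Proof. exact: (rmorphB (psub q)). Qed.

Lemma psubM p p' : psub q (p * p') = psub q p * psub q p'.
Proof. exact: (rmorphM (psub q)). Qed.

Lemma psub_exp p l : psub q (p ^+ l) = psub q p ^+ l.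
Proof. exact: (rmorphXn (psub q)). Qed.

Lemma psub_prod (I : Type) (r : seq I) (P : pred I) (p : I -> mpoly n F) :
  psub q (\prod_(i <- r | P i) p i) = \prod_(i <- r | P i) psub q (p i).
Proof. exact: (rmorph_prod (psub q)). Qed.

Lemma psubC c : psub q (mpolyC n c) = mpolyC k c.
Proof. exact: mmapC. Qed.

Lemma psubX a : psub q (mpolyX F a) = mmap1 q a.
Proof. exact: mmapX. Qed.

Lemma psubXU i : psub q (mpolyX F (mnm1 i)) = q i.
Proof. by rewrite psubX mmap1U. Qed.

Lemma psubZ c p : psub q (c *: p) = c *: psub q p.
Proof. by rewrite -mul_mpolyC rmorphM/= psubC mul_mpolyC. Qed.

Lemma psubE p : psub q p = \sum_(a <- msupp p) mcoeff a p *: mmap1 q a.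
Proof. by apply: eq_bigr => a _; rewrite mul_mpolyC. Qed.

Lemma meval_psub (v : 'I_k -> F) p :
  meval v (psub q p) = meval (fun i => meval v (q i)) p.
Proof.
rewrite psubE raddf_sum/= mevalE; apply: eq_bigr => a _.
rewrite mevalZ /mmap1 rmorph_prod/=; congr (_ * _).
by apply: eq_bigr => i _; rewrite rmorphXn.
Qed.

Lemma ordge_psub J p : (forall i, ordge 1 (q i)) -> ordge J p ->
  ordge J (psub q p).
Proof.
move=> q1 pJ; rewrite psubE; apply: ordge_sum => a _.
have [aJ|aJ] := ltnP (mdeg a) J; first by rewrite pJ// scale0r; apply: ordge_zero.
by apply/ordgeZ/(ordgeW aJ)/ordge_mmap1.
Qed.

Lemma msize_psub p : (forall i, (mmeasure mdeg (q i) <= 2)%N) ->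
  (mmeasure mdeg (psub q p) <= mmeasure mdeg p)%N.
Proof.
move=> q2; have X2 a : (mmeasure mdeg (mmap1 q a) <= (mdeg a).+1)%N.
  rewrite /mmap1 mdegE; elim/big_rec2: _ => [|i b c _ IH]; first by rewrite msize1.
  have XM (u v : mpoly k F) x y : (mmeasure mdeg u <= x.+1)%N ->
      (mmeasure mdeg v <= y.+1)%N -> (mmeasure mdeg (u * v) <= (x + y).+1)%N.
    have [->|u0] := eqVneq u 0; first by rewrite mul0r mmeasure0.
    have [->|v0] := eqVneq v 0; first by rewrite mulr0 mmeasure0.
    move=> ux vy; rewrite msizeM//.
    apply: (@leq_trans (x.+1 + y.+1).-1); last by rewrite addSn addnS.
    by rewrite -!subn1 leq_sub2r// leq_add.
  apply: (XM) => //; elim: (a i) => [|j IHj]; first by rewrite expr0 msize1.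
  by rewrite exprS; apply: (XM _ _ 1%N j).
rewrite psubE big_seq; apply: (leq_trans (msize_sum _ _ _)).
apply/bigmax_leqP_seq => a _ ap.
apply: (leq_trans (msizeZ_le _ _)); apply: (leq_trans (X2 a)).
exact: msize_mdeg_lt.
Qed.

End Substitution.

Lemma psub_comp (F : fieldType) n k l (q : 'I_n -> mpoly k F)
    (r : 'I_k -> mpoly l F) p :
  psub r (psub q p) = psub (fun i => psub r (q i)) p.
Proof.
rewrite (psubE q) raddf_sum/= [RHS]psubE; apply: eq_bigr => a _.
rewrite psubZ /mmap1 rmorph_prod/=; congr (_ *: _).
by apply: eq_bigr => i _; rewrite rmorphXn.
Qed.

Lemma eq_psub (F : fieldType) n k (q q' : 'I_n -> mpoly k F) :
  q =1 q' -> psub q =1 psub q'.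
Proof.
move=> qq' p; rewrite !psubE; apply: eq_bigr => a _; congr (_ *: _).
exact: mmap1_eq.
Qed.

Lemma psub_id (F : fieldType) n (p : mpoly n F) :
  psub (fun i => mpolyX F (mnm1 i)) p = p.
Proof. by rewrite psubE [RHS]mpolyE; apply: eq_bigr => a _; rewrite mmap1_id. Qed.

(** The identity matrix indexed by [K] factors through the space of functions on [I], and its rank
    is bounded accordingly. *)
Lemma card_le_of_delta (F : fieldType) (I K : finType) (A : K -> I -> F)
    (B : I -> K -> F) :
  (forall k k', \sum_i A k i * B i k' = (k == k')%:R) -> (#|K| <= #|I|)%N.
Proof.
move=> AB.
pose MA := \matrix_(k < #|K|, i < #|I|) A (enum_val k) (enum_val i).
pose MB := \matrix_(i < #|I|, k < #|K|) B (enum_val i) (enum_val k).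
apply: (@mulmx1_min _ _ _ MA MB); apply/matrixP => k k'; rewrite !mxE.
rewrite -(inj_eq enum_val_inj) -AB.
rewrite [RHS](reindex (enum_val : 'I_#|I| -> I))/=; last exact/onW_bij/enum_val_bij.
by apply: eq_bigr => i _; rewrite !mxE.
Qed.

Lemma seq_rel_min (T : eqType) (r : rel T) (s : seq T) :
  total r -> transitive r -> s != [::] ->
  exists2 x, x \in s & forall y, y \in s -> r x y.
Proof.
move=> rt rr; elim: s => // x s IH _.
have [->|/IH[y ys yP]] := eqVneq s [::].
  exists x; first by rewrite inE.
  by move=> y; rewrite inE => /eqP ->; have := rt x x; rewrite orbb.
have /orP[rxy|ryx] := rt x y.
  exists x; first by rewrite inE eqxx.
  move=> z; rewrite inE => /predU1P[->|/yP]; last exact: rr.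
  by have := rt x x; rewrite orbb.
exists y; first by rewrite inE ys orbT.
by move=> z; rewrite inE => /predU1P[->//|/yP].
Qed.

Section CardMultinom.
Context (n : nat).

(** A cube of side j fits in the simplex of degree n j. *)
Lemma card_multinom_ge j : (j ^ n <= #|{: bmultinom n (n * j).+1}|)%N.
Proof.
have deg (u : {ffun 'I_n -> 'I_j}) :
    (mdeg (Multinom [tuple (u i : nat) | i < n]) < (n * j).+1)%N.
  rewrite ltnS mdegE -[X in (X * _)%N]card_ord -sum_nat_const; apply: leq_sum.
  by move=> i _; rewrite multinomE tnth_mktuple ltnW.
pose f u := BMultinom (deg u).
have finj : injective f.
  move=> u v /(congr1 val)/mnmP uv; apply/ffunP => i.
  by have := uv i; rewrite !multinomE !tnth_mktuple => /val_inj.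
by have := leq_card f finj; rewrite card_ffun !card_ord.
Qed.

Lemma card_multinom_le J : (#|{: bmultinom n J}| <= J ^ n)%N.
Proof.
have lt (a : bmultinom n J) i : (bmnm a i < J)%N.
  apply: leq_ltn_trans (bmdeg a).
  by rewrite mdegE (bigD1 i)//= leq_addr.
pose f a : {ffun 'I_n -> 'I_J} := [ffun i => Ordinal (lt a i)].
have finj : injective f.
  move=> a b /ffunP ab; apply/val_inj/mnmP => i.
  by have := ab i; rewrite !ffunE => /(congr1 val).
by have := leq_card f finj; rewrite card_ffun !card_ord.
Qed.

(** A multi-index not above [s] has some coordinate i smaller than [s i], the n - 1 others being
    free. The growth is one power of J short of that of all monomials, which is the source of the
    contradiction below. *)
Lemma card_not_above (s : multinom n) J :
  (#|[pred r : bmultinom n J | ~~ mpoly.lem s (bmnm r)]| <= mdeg s * J ^ n.-1)%N.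
Proof.
have lt (a : bmultinom n J) i : (bmnm a i < J)%N.
  apply: leq_ltn_trans (bmdeg a).
  by rewrite mdegE (bigD1 i)//= leq_addr.
pose f a : {ffun 'I_n -> 'I_J} := [ffun i => Ordinal (lt a i)].
have finj : injective f.
  move=> a b /ffunP ab; apply/val_inj/mnmP => i.
  by have := ab i; rewrite !ffunE => /(congr1 val).
pose fam i := [pred u : {ffun 'I_n -> 'I_J} | (u i < s i)%N].
have cfam i : (#|fam i| <= s i * J ^ n.-1)%N.
  pose G l : pred 'I_J := [pred x : 'I_J | (l == i) ==> (x < s i)%N].
  have -> : #|fam i| = #|family G|.
    apply: eq_card => u; rewrite !inE; apply/idP/familyP => [ui l|/(_ i)].
      by rewrite inE; apply/implyP => /eqP ->.
    by rewrite inE eqxx.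
  rewrite card_family foldrE big_map big_enum/= (bigD1 i)//=; apply: leq_mul.
    have -> : #|G i| = #|[pred x : 'I_J | (x < s i)%N]|.
      by apply: eq_card => x; rewrite !inE eqxx.
    rewrite -sum1_card -(big_mkord (fun x => x < s i)%N (fun=> 1%N)).
    rewrite -big_filter sum1_size.
    have : {subset [seq x <- index_iota 0 J | (x < s i)%N] <= iota 0 (s i)}.
      by move=> x; rewrite mem_filter mem_iota add0n /= => /andP[].
    move=> /(uniq_leq_size (filter_uniq _ (iota_uniq _ _))).
    by rewrite size_iota.
  rewrite (eq_bigr (fun=> J)) => [|l li]; last first.
    rewrite -[RHS]card_ord; apply: eq_card => x; rewrite !inE.
    by rewrite (negPf li).
  rewrite prod_nat_const; have -> // : #|(fun j : 'I_n => j != i)| = n.-1.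
  by have := cardC1 i; rewrite card_ord => <-; apply: eq_card.
rewrite -(fintype.card_image finj).
apply: (@leq_trans (\sum_i #|fam i|)); last first.
  by rewrite mdegE big_distrl/=; apply: leq_sum => i _.
apply: (@leq_trans #|[pred u | [exists i, fam i u]]|).
  apply: subset_leq_card; apply/fintype.subsetP => u /mapP[a]; rewrite mem_enum.
  rewrite !inE => asa ->; apply/existsP.
  have [i si] : exists i, ~~ (s i <= bmnm a i)%N.
    apply/existsP; rewrite -negb_forall; by apply: contra asa => /forallP sa;
      apply/mnm_lepP.
  by exists i; rewrite inE/= ffunE/= ltnNge.
rewrite -sum1_card.
under [leqRHS]eq_bigr do rewrite -sum1_card.
under [leqRHS]eq_bigr do rewrite big_mkcond.
rewrite exchange_big/= [leqLHS]big_mkcond/=; apply: leq_sum => u _.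
rewrite inE; case: ifP => // /existsP[i ui].
by rewrite (bigD1 i)//= inE in ui *; rewrite ui.
Qed.

End CardMultinom.

(** * Analytic independence of a system of parameters *)

Section SystemOfParameters.
Context (F : fieldType) (m : nat) (f : 'I_m -> mpoly m F) (e : nat).
Hypothesis f1 : forall i, ordge 1 (f i).
Hypothesis fe : forall J p, ordge e p ->
  exists a : 'I_m -> mpoly m F, ordge J (p - \sum_i a i * f i).
Context (S : seq (multinom m)) (w : multinom m -> mpoly m F).
Hypothesis S_uniq : uniq S.
Hypothesis w0 : forall s, s \in S -> mcoeff mnm0 (w s) != 0.
Hypothesis wS : \sum_(s <- S) w s * mmap1 f s = 0.
Context (t : multinom m).
Hypothesis tS : t \in S.
(** Within the least degree, [t] is the largest for the monomial order: rewriting f^t by the other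
    terms of that degree then descends in a well-order. *)
Hypothesis t_min : forall s, s \in S ->
  (mdeg t < mdeg s)%N || ((mdeg t == mdeg s) && (s <= t)%O).

Section Truncation.
Context (J : nat).

(** The span, up to order J, of the x^a f^s with a of degree below e and s not above t. It will turn
    out to contain every polynomial, although it has few generators. *)
Let W (p : mpoly m F) := exists c : bmultinom m e * bmultinom m J -> F,
  ordge J (p - \sum_(x | ~~ mpoly.lem t (bmnm x.2))
                 c x *: (mpolyX F (bmnm x.1) * mmap1 f (bmnm x.2))).

Let W_ordge p : ordge J p -> W p.
Proof.
move=> pJ; exists (fun=> 0); rewrite big1 ?subr0// => x _.
by rewrite scale0r.
Qed.

Let WD p q : W p -> W q -> W (p + q).
Proof.
move=> [c pc] [c' qc]; exists (fun x => c x + c' x).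
under eq_bigr do rewrite scalerDl.
by rewrite big_split/= opprD addrACA; apply: ordgeD.
Qed.

Let WZ k p : W p -> W (k *: p).
Proof.
move=> [c pc]; exists (fun x => k * c x).
under eq_bigr do rewrite -scalerA.
by rewrite -scaler_sumr -scalerBr; apply: ordgeZ.
Qed.

Let W_sum (I : eqType) (r : seq I) (P : pred I) (p : I -> mpoly m F) :
  (forall i, i \in r -> P i -> W (p i)) -> W (\sum_(i <- r | P i) p i).
Proof.
move=> pW; rewrite big_seq_cond; apply: big_ind => //.
- exact/W_ordge/ordge_zero.
- by move=> i /andP[]; apply: pW.
Qed.

Let W_mul p s :
  (forall a, a \in msupp p -> W (mpolyX F a * mmap1 f s)) ->
  W (p * mmap1 f s).
Proof.
move=> pW; rewrite [p]mpolyE mulr_suml; apply: W_sum => a ap _.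
by rewrite -scalerAl; apply/WZ/pW.
Qed.

(** Multiply the relation by f^r and solve for f^(t + r), splitting w_t into its invertible constant
    term and the rest. *)
Let t_reduction r :
  mmap1 f (mnm_add t r) = - (mcoeff mnm0 (w t))^-1 *:
    ((w t - mpolyC m (mcoeff mnm0 (w t))) * mmap1 f (mnm_add t r) +
     \sum_(s <- S | s != t) w s * mmap1 f (mnm_add s r)).
Proof.
have := wS; rewrite (bigD1_seq t)//= => /(congr1 (fun z => z * mmap1 f r)).
rewrite mul0r mulrDl -mulrA -mmap1D mulr_suml.
rewrite [X in _ + X = 0 -> _](eq_bigr (fun s => w s * mmap1 f (mnm_add s r))); last first.
  by move=> s _; rewrite -mulrA -mmap1D.
move=> /eqP; rewrite addr_eq0 => /eqP wt.
rewrite mulrBl wt mul_mpolyC addrAC addNr add0r scalerN scaleNr opprK.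
by rewrite scalerA mulVf ?scale1r// w0.
Qed.

(** Three nested inductions: on the degree of s and then on that of a, both increasing towards J,
    and finally on s, decreasing for the monomial order at fixed degrees. A factor x^a of degree at
    least e is traded for the f_i, and f^s with s above t is rewritten by the relation. *)
Let W_monomial a s : W (mpolyX F a * mmap1 f s).
Proof.
have [u] := ubnP (J - mdeg s); elim: u a s => // u IHs a s.
rewrite ltnS => us.
have W_higher p s' : (mdeg s < mdeg s')%N -> W (p * mmap1 f s').
  move=> ss'; have [s'J|Js'] := ltnP (mdeg s') J; last first.
    exact/W_ordge/ordgeMl/(ordgeW Js')/ordge_mmap1.
  apply: W_mul => b _; apply: IHs; apply: leq_trans us.
  by rewrite ltn_sub2l// (ltn_trans ss').
have [v] := ubnP (J - mdeg a); elim: v a s {us} W_higher => // v IHa a s W_higher.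
rewrite ltnS => va.
have W_deeper p s' : mdeg s' = mdeg s -> ordge (mdeg a).+1 p -> W (p * mmap1 f s').
  move=> ss' pa; apply: W_mul => b bp.
  have ab : (mdeg a < mdeg b)%N.
    by rewrite ltnNge -ltnS; apply: contraL bp => /pa; rewrite mcoeff_msupp => ->;
      rewrite eqxx.
  have [bJ|Jb] := ltnP (mdeg b) J; last exact/W_ordge/ordgeMr/(ordgeW Jb)/ordgeX.
  apply: IHa; first by move=> p' s''; rewrite ss'; apply: W_higher.
  by apply: leq_trans va; rewrite ltn_sub2l// (ltn_trans ab).
have [sJ|Js] := ltnP (mdeg s) J; last exact/W_ordge/ordgeMl/(ordgeW Js)/ordge_mmap1.
have [ae|ea] := ltnP (mdeg a) e; last first.
  have [c cP] := fe J (ordgeW ea (@ordgeX F m a)).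
  rewrite -[mpolyX F a](subrK (\sum_i c i * f i)) mulrDl; apply: WD.
    exact/W_ordge/ordgeMr.
  rewrite mulr_suml; apply: W_sum => i _ _.
  rewrite -mulrA -[f i](mmap1U f) -mmap1D; apply: W_higher.
  by rewrite mdegD mdeg1 add1n.
elim: s / (@ltom_wf m s) => s _ IHo in W_higher W_deeper sJ *.
have [ts|ts] := boolP (mpoly.lem t s); last first.
  exists (fun x => ((bmnm x.1 == a) && (bmnm x.2 == s))%:R).
  rewrite (bigD1 (BMultinom ae, BMultinom sJ))//= !eqxx scale1r.
  rewrite big1 ?addr0 ?subrr; first exact: ordge_zero.
  move=> [[b be] [r rJ]] /= /andP[_ neq].
  case: eqP => [ba|_]; last by rewrite scale0r.
  case: eqP => [rs|_]; last by rewrite scale0r.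
  case/eqP: neq; congr pair; exact: val_inj.
pose r := mpoly.mnm_sub s t; have sE : s = mnm_add t r by rewrite addmC submK.
rewrite sE t_reduction -sE -scalerAr mulrC; apply: WZ.
rewrite mulrDl; apply: WD.
  rewrite mulrAC; apply: W_deeper => //.
  rewrite mulrC -addn1.
  apply: ordgeM; first exact: ordgeX.
  by apply: ordge1P; rewrite mcoeffB mcoeffC eqxx mulr1 subrr.
(* If s' has larger degree than t, the degree of s grows. If the degrees agree, the non-constant
   part of w_s' increases the degree of a, and its constant term leaves a smaller multi-index. *)
rewrite mulr_suml; apply: W_sum => s' s'S s't.
rewrite mulrAC; have /orP[ts'|/andP[/eqP ts' s't']] := t_min s'S.
  by apply: W_higher; rewrite sE !mdegD ltn_add2r.
have ss' : mdeg (mnm_add s' r) = mdeg s by rewrite sE !mdegD ts'.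
rewrite -[w s'](subrK (mpolyC m (mcoeff mnm0 (w s')))) mulrDl mulrDl.
apply: WD.
  apply: W_deeper => //; rewrite mulrC -addn1.
  apply: ordgeM; first exact: ordgeX.
  by apply: ordge1P; rewrite mcoeffB mcoeffC eqxx mulr1 subrr.
rewrite mul_mpolyC -scalerAl; apply: WZ; apply: IHo.
- by rewrite sE ltmc_add2l lt_neqAle s't s't'.
- by move=> p s''; rewrite ss'; apply: W_higher.
- by move=> p s''; rewrite ss'; apply: W_deeper.
- by rewrite ss'.
Qed.

(** [W_monomial] at s = 0 writes each monomial of degree below J in the span; reading off
    coefficients gives the relations of [card_le_of_delta]. *)
Lemma card_truncation_le :
  (#|{: bmultinom m J}| <=
   #|{: bmultinom m e}| * #|[pred r : bmultinom m J | ~~ mpoly.lem t (bmnm r)]|)%N.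
Proof.
have := fun a : bmultinom m J => W_monomial (bmnm a) mnm0.
move=> /choice[c cP].
pose I := {x : bmultinom m e * bmultinom m J | ~~ mpoly.lem t (bmnm x.2)}.
have -> : (#|{: bmultinom m e}| *
    #|[pred r : bmultinom m J | ~~ mpoly.lem t (bmnm r)]|)%N = #|{: I}|.
  rewrite card_sig -cardX; apply: eq_card => -[x y].
  by rewrite !inE/=.
apply: (@card_le_of_delta F _ _ (fun a (x : I) => c a (val x))
  (fun (x : I) (b : bmultinom m J) => mcoeff (bmnm b)
     (mpolyX F (bmnm (val x).1) * mmap1 f (bmnm (val x).2)))) => a b.
have := cP a _ (bmdeg b); rewrite mmap11 mulr1 mcoeffB => /eqP.
rewrite subr_eq0 mcoeffX => /eqP; rewrite -bmeqP => ->.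
rewrite raddf_sum/= [RHS](reindex_omap (val : I -> _) insub)/=; last first.
  by move=> x tx; rewrite insubT.
rewrite [RHS](eq_bigl xpredT) => [|[x tx]]; last by rewrite /= insubT tx eqxx.
by apply: eq_bigr => x _; rewrite mcoeffZ.
Qed.

End Truncation.

Lemma sop_contradiction : False.
Proof.
have H j : (j ^ m <= #|{: bmultinom m e}| * (mdeg t * ((m * j).+1) ^ m.-1))%N.
  apply: (leq_trans (card_multinom_ge m j)).
  apply: (leq_trans (card_truncation_le _)).
  by rewrite leq_mul2l card_not_above orbT.
(* In 0 variables t has degree 0, and j = 0 already gives 1 <= 0. Otherwise j^m is compared with a
   constant times j^(m - 1), and the chosen j exceeds this constant. *)
move: H; set E := #|_|; case: m t => [t'|m' t'] H.
  have := H 0%N; rewrite expn0 /mdeg.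
  have -> : (\sum_(i <- t') i = 0)%N by rewrite -/(mdeg t') mdegE big_ord0.
  by rewrite mul0n muln0.
pose j := (E * (mdeg t' * m'.+2 ^ m')).+1.
have := H j; rewrite leqNgt => /negP; apply.
apply: (@leq_ltn_trans ((E * (mdeg t' * m'.+2 ^ m')) * j ^ m')%N); last first.
  by rewrite expnS ltn_mul2r expn_gt0 /= ltnSn.
rewrite -!mulnA -expnMn !leq_mul2l; apply/orP; right; apply/orP; right.
have le : ((m'.+1 * j).+1 <= m'.+2 * j)%N by rewrite [leqRHS]mulSn -add1n leq_add2r.
by case: (m') le => // k; rewrite leq_exp2r.
Qed.

End SystemOfParameters.

Lemma sop_analytic_independence (F : fieldType) (m : nat)
    (f : 'I_m -> mpoly m F) (e : nat)
    (S : seq (multinom m)) (w : multinom m -> mpoly m F) :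
  (forall i, ordge 1 (f i)) ->
  (forall J p, ordge e p ->
    exists a : 'I_m -> mpoly m F, ordge J (p - \sum_i a i * f i)) ->
  uniq S -> (forall s, s \in S -> mcoeff mnm0 (w s) != 0) ->
  \sum_(s <- S) w s * mmap1 f s = 0 -> S = [::].
Proof.
move=> f1 fe S_uniq w0 wS; apply/eqP; apply: contrapT => /negP S0.
pose r (s t : multinom m) :=
  (mdeg s < mdeg t)%N || ((mdeg s == mdeg t) && (t <= s)%O).
have [||//|t tS tmin] := @seq_rel_min _ r S.
- move=> s t; rewrite /r; case: ltngtP => //= _; exact: le_total.
- move=> s t u; rewrite /r => /orP[st|/andP[/eqP st ts]] /orP[tu|/andP[/eqP tu ut]].
  + by rewrite (ltn_trans st).
  + by rewrite -tu st.
  + by rewrite st tu.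
  + by rewrite st tu eqxx (le_trans ut ts) orbT.
exact: (sop_contradiction f1 fe S_uniq w0 wS tS tmin).
Qed.

(** * Non-Archimedean estimates *)

Section NonArchimedean.
Context {R : realType} {F : nonArchLocalFieldType R}.
Implicit Types (x y : F) (r B : R).

Lemma absv0 : absv (0 : F) = 0.
Proof. exact/absv_eq0. Qed.

Lemma absv_gt0 x : (0 < absv x) = (x != 0).
Proof.
rewrite lt_def absv_ge0 andbT; congr (~~ _).
by apply/eqP/eqP => [/absv_eq0//|->]; exact: absv0.
Qed.

Lemma absv1 : absv (1 : F) = 1.
Proof.
have : absv (1 : F) != 0 by apply/eqP => /absv_eq0/eqP; rewrite oner_eq0.
by move=> /mulfI; apply; rewrite -absvM !mulr1.
Qed.

Lemma absvX x k : absv (x ^+ k) = absv x ^+ k.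
Proof. by elim: k => [|k IHk]; rewrite ?absv1// !exprS absvM IHk. Qed.

Lemma absvV x : absv x^-1 = (absv x)^-1.
Proof.
have [->|x0] := eqVneq x 0; first by rewrite invr0 absv0 invr0.
have ax0 : absv x != 0 by rewrite gt_eqF// absv_gt0.
by apply: (mulfI ax0); rewrite -absvM !mulfV// absv1.
Qed.

Lemma absvD_le B x y : absv x <= B -> absv y <= B -> absv (x + y) <= B.
Proof. by move=> xB yB; rewrite (le_trans (absvD _ _))// ge_max xB. Qed.

Lemma absvB_le B x y : absv x <= B -> absv y <= B -> absv (x - y) <= B.
Proof. by move=> xB yB; apply: absvD_le; rewrite ?absvN. Qed.

Lemma absvB_sym x y : absv (x - y) = absv (y - x).
Proof. by rewrite -absvN opprB. Qed.

Lemma absv_sum_le B (I : Type) (s : seq I) (P : pred I) (f : I -> F) :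
  0 <= B -> (forall i, P i -> absv (f i) <= B) ->
  absv (\sum_(i <- s | P i) f i) <= B.
Proof.
move=> B0 fB; apply: (big_ind (fun x => absv x <= B)) => //.
- by rewrite absv0.
- by move=> x y; apply: absvD_le.
Qed.

Lemma absv_prod (I : Type) (s : seq I) (P : pred I) (f : I -> F) :
  absv (\prod_(i <- s | P i) f i) = \prod_(i <- s | P i) absv (f i).
Proof. by apply: (big_morph (@absv R F)); [exact: absvM|exact: absv1]. Qed.

Lemma absvDl x y : absv y < absv x -> absv (x + y) = absv x.
Proof.
move=> yx; apply/eqP; rewrite eq_le; apply/andP; split.
  by apply: absvD_le => //; exact: ltW.
rewrite leNgt; apply/negP => xy.
have : absv (x + y - y) < absv x.
  by rewrite (le_lt_trans (absvD _ _))// gt_max xy absvN.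
by rewrite addrK ltxx.
Qed.

Local Notation q := ((@resq R F)%:R : R).

Lemma resq_gt1 : (1 < @resq R F)%N.
Proof.
have [rep [_ repP]] := @resfield R F.
have [i [i0 _]] := repP 0 (ltac:(by rewrite absv0 ler01)).
have [j [j1 _]] := repP 1 (ltac:(by rewrite absv1)).
have ij : i != j.
  apply/eqP => ij; move: j1; rewrite -ij => i1.
  have : absv (1 - rep i - (0 - rep i)) < 1.
    by rewrite (le_lt_trans (absvD _ _))// gt_max i1 absvN.
  by rewrite opprB addrA subrK subr0 absv1 ltxx.
rewrite ltnNge; apply/negP => q1; case/negP: ij.
have lt1 (l : 'I_(@resq R F)) : val l = 0%N.
  by apply/eqP; rewrite -leqn0 -ltnS (leq_trans (ltn_ord l)).
by apply/eqP/val_inj; rewrite !lt1.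
Qed.

Lemma q_gt1 : 1 < q. Proof. by rewrite ltr1n resq_gt1. Qed.
Lemma q_gt0 : 0 < q. Proof. exact: lt_trans ltr01 q_gt1. Qed.
Lemma qV_gt0 : 0 < q^-1. Proof. by rewrite invr_gt0 q_gt0. Qed.
Lemma qV_lt1 : q^-1 < 1. Proof. by rewrite invf_lt1 ?q_gt0 ?q_gt1. Qed.

Definition unif : F := sval (cid (@uniformizer R F)).

Lemma absv_unif : absv unif = q^-1.
Proof. by rewrite /unif; case: cid. Qed.

Lemma absv_unifX k : absv (unif ^+ k) = q^-1 ^+ k.
Proof. by rewrite absvX absv_unif. Qed.

Lemma unif_neq0 : unif != 0.
Proof. by rewrite -absv_gt0 absv_unif qV_gt0. Qed.

Lemma qVX_small r : 0 < r -> exists j, forall k, (j <= k)%N -> q^-1 ^+ k < r.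
Proof.
move=> r0; have := @cvg_expr R q^-1.
rewrite ger0_norm ?(ltW qV_gt0)// => /(_ qV_lt1) /cvgr0Pnorm_lt /(_ _ r0) [j _ jP].
exists j => k jk; have := jP k jk.
by rewrite /= ger0_norm// exprn_ge0// ltW// qV_gt0.
Qed.

Lemma exists_small r : 0 < r -> exists2 x : F, x != 0 & absv x < r.
Proof.
move=> /qVX_small[j /(_ j (leqnn j)) jr]; exists (unif ^+ j).
  by rewrite expf_neq0// unif_neq0.
by rewrite absv_unifX.
Qed.

(** The term of least index with a non-zero coefficient dominates, as the later ones carry at least
    one more factor t. *)
Lemma sum_neq0_of_dominant L (a : 'I_L -> F) (A : nat -> R) :
  (forall i, 0 < A i) -> (exists i, a i != 0) ->
  exists2 r, 0 < r & forall (u : 'I_L -> F) (t : R), 0 < t <= r ->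
    (forall i, absv (u i) = A i * t ^+ i) -> \sum_i a i * u i != 0.
Proof.
move=> A0 [i1 ai1].
have [i0 ai0 i0min] := @arg_minnP _ i1 (fun i => a i != 0) (fun i => val i) ai1.
pose M := \sum_i absv (a i) * A i.
have M_ge i : absv (a i) * A i <= M.
  rewrite /M (bigD1 i)//= lerDl; apply: sumr_ge0 => j _.
  by rewrite mulr_ge0 ?absv_ge0// ltW.
have m0 : 0 < absv (a i0) * A i0 by rewrite mulr_gt0// absv_gt0.
have M0 : 0 < M by apply: lt_le_trans (M_ge i0).
(* The denominator M + M, rather than M, makes the domination strict. *)
exists (Num.min 1 (absv (a i0) * A i0 / (M + M))).
  by rewrite lt_min ltr01 divr_gt0// addr_gt0.
move=> u t /andP[t0]; rewrite le_min => /andP[t1 tM] uA.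
rewrite (bigD1 i0)//= -absv_gt0 absvDl.
  by rewrite absvM uA mulrA mulr_gt0// exprn_gt0.
apply: (@le_lt_trans _ _ (M * t ^+ (val i0).+1)).
  apply: absv_sum_le => [|i ii0]; first by rewrite mulr_ge0 ?exprn_ge0 ?ltW.
  rewrite absvM uA mulrA.
  have [->|ai] := eqVneq (a i) 0.
    by rewrite absv0 !mul0r mulr_ge0 ?exprn_ge0 ?ltW.
  apply: ler_pM => //.
  - by rewrite mulr_ge0 ?absv_ge0// ltW.
  - by rewrite exprn_ge0// ltW.
  apply: ler_wiXn2l => //; first exact: ltW.
  by rewrite ltn_neqAle i0min// andbT; apply: contra_neq ii0 => /val_inj.
rewrite absvM uA mulrA exprS mulrA ltr_pM2r ?exprn_gt0//.
apply: (@le_lt_trans _ _ (M * (absv (a i0) * A i0 / (M + M)))).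
  by rewrite ler_pM2l.
rewrite mulrCA -[ltRHS]mulr1 ltr_pM2l// ltr_pdivrMr ?addr_gt0// mul1r.
by rewrite ltrDl.
Qed.

End NonArchimedean.

(** * The Bezout bound *)

Lemma linear_dependence (F : fieldType) n T (I : finType) (p : I -> mpoly n F) :
  (forall i, (mmeasure mdeg (p i) <= T)%N) ->
  (#|{: bmultinom n T}| < #|I|)%N ->
  exists2 c : I -> F, exists i, c i != 0 & \sum_i c i *: p i = 0.
Proof.
move=> pT cardI.
pose A := \matrix_(i < #|I|, a < #|{: bmultinom n T}|)
  mcoeff (bmnm (enum_val a)) (p (enum_val i)).
have : kermx A != 0.
  rewrite -mxrank_eq0 mxrank_ker -lt0n subn_gt0.
  exact: leq_ltn_trans (rank_leq_col _) cardI.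
move=> /rowV0Pn[v /sub_kermxP vA v0].
exists (fun i => v 0 (enum_rank i)).
  move: v0; apply: contraPP => /forallNP v0; apply/negP; rewrite negbK.
  apply/eqP/matrixP => i j; rewrite ord1 mxE.
  by have /negP := v0 (enum_val j); rewrite negbK enum_valK => /eqP.
apply/mpolyP => a; rewrite mcoeff0 raddf_sum/=.
under eq_bigr do rewrite mcoeffZ.
have [aT|Ta] := ltnP (mdeg a) T; last first.
  rewrite big1// => i _; rewrite memN_msupp_eq0 ?mulr0//.
  by rewrite msize_mdeg_ge// (leq_trans (pT i)).
have /matrixP/(_ 0 (enum_rank (BMultinom aT))) := vA.
rewrite !mxE; apply: etrans.
rewrite (reindex (enum_val : 'I_#|I| -> I))/=; last exact/onW_bij/enum_val_bij.
by apply: eq_bigr => i _; rewrite !mxE enum_valK enum_rankK.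
Qed.

Lemma msizeM_leS (F : fieldType) n (u v : mpoly n F) x y :
  (mmeasure mdeg u <= x.+1)%N -> (mmeasure mdeg v <= y.+1)%N ->
  (mmeasure mdeg (u * v) <= (x + y).+1)%N.
Proof.
have [->|u0] := eqVneq u 0; first by rewrite mul0r mmeasure0.
have [->|v0] := eqVneq v 0; first by rewrite mulr0 mmeasure0.
move=> ux vy; rewrite msizeM//.
apply: (@leq_trans (x.+1 + y.+1).-1); last by rewrite addSn addnS.
by rewrite -!subn1 leq_sub2r// leq_add.
Qed.

Lemma msize_exp_leS (F : fieldType) n (u : mpoly n F) x k :
  (mmeasure mdeg u <= x.+1)%N -> (mmeasure mdeg (u ^+ k) <= (x * k).+1)%N.
Proof.
move=> ux; elim: k => [|k IHk]; first by rewrite expr0 msize1.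
by rewrite exprS mulnS; apply: msizeM_leS.
Qed.

Lemma msize_mmap1_leS (F : fieldType) n k (h : 'I_n -> mpoly k F) x a :
  (forall i, (mmeasure mdeg (h i) <= x.+1)%N) ->
  (mmeasure mdeg (mmap1 h a) <= (x * mdeg a).+1)%N.
Proof.
move=> hx; rewrite /mmap1 mdegE big_distrr/=.
elim/big_rec2: _ => [|i b c _ IH]; first by rewrite msize1.
by apply: msizeM_leS => //; apply: msize_exp_leS.
Qed.

(** Iteration gives c(l k) >= (1 + 1/E)^l c(0). As (1 + 1/E)^E >= 2, c at least doubles, relative to
    c(0), along steps of E k. *)
Lemma exp_beats_poly (E k N : nat) (c : nat -> nat) :
  (forall T, (c T <= T.+1 ^ N)%N) -> (0 < c 0%N)%N -> (0 < E)%N ->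
  (forall T, (E.+1 * c T <= E * c (T + k))%N) -> False.
Proof.
move=> cT c0 E0 step.
have iter l : (E.+1 ^ l * c 0%N <= E ^ l * c (l * k)%N)%N.
  elim: l => [|l IHl]; first by rewrite !expn0 !mul1n.
  rewrite !expnS -mulnA (leq_trans (leq_mul (leqnn _) IHl))//.
  rewrite mulnCA -mulnA [X in (_ <= X)%N]mulnCA leq_mul2l.
  by rewrite [(l.+1 * k)%N]mulSn [(k + _)%N]addnC step orbT.
have dbl l : (2 ^ l <= (l * (E * k)).+1 ^ N)%N.
  have := iter (E * l)%N.
  have bin : (2 * E ^ E <= E.+1 ^ E)%N.
    rewrite -[E.+1]addn1 expnDn big_ord_recl/= bin0 exp1n muln1 mul1n subn0.
    case: (E) E0 => // E' _; rewrite big_ord_recl/= /bump/= addn0 bin1 exp1n muln1.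
    by rewrite subSS subn0 -expnS mulSn mul1n leq_add2l leq_addr.
  rewrite !expnM => it.
  have E0l : (0 < (E ^ E) ^ l)%N by rewrite !expn_gt0 E0.
  rewrite -(leq_pmul2r E0l) -expnMn.
  have le : ((2 * E ^ E) ^ l <= (E.+1 ^ E) ^ l)%N.
    by case: (l) => // l'; rewrite leq_exp2r.
  rewrite (leq_trans le)// (leq_trans _ (leq_trans it _))//.
    by rewrite leq_pmulr.
  by rewrite mulnC leq_mul2r; apply/orP; right; rewrite (leq_trans (cT _))// mulnCA mulnA.
(* With l = 2^p the polynomial bound becomes 2^p <= N (p + b), which fails at a p that is large
   enough for p^2 <= 2^p and p > 2 N, p >= b. *)
pose b := (E * k).+1.
have dblp p : (2 ^ p <= N * (p + b))%N.
  rewrite -(@leq_exp2l 2)// (leq_trans (dbl _))// [(N * _)%N]mulnC expnM.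
  have le : ((2 ^ p * (E * k)).+1 <= 2 ^ (p + b))%N.
    rewrite expnD; apply: (@leq_trans (2 ^ p * b)).
      by rewrite /b mulnS -add1n leq_add2r expn_gt0.
    by rewrite leq_mul2l ltnW ?orbT// ltn_expl.
  by case: (N) => [|N']; rewrite ?expn0// leq_exp2r.
have := dblp (N + N + N + N + b + b + 4)%N; set x := (N + N + N + N + b + b + 4)%N.
have sq z : (4 <= z -> z ^ 2 <= 2 ^ z)%N.
  elim: z => // z IHz; rewrite leq_eqVlt => /predU1P[<-//|].
  rewrite ltnS => z4; rewrite [(2 ^ _)%N]expnS mul2n -addnn -addn1 sqrnD.
  have := IHz z4; rewrite -!mulnn; nia.
have x4 : (4 <= x)%N by rewrite leq_addl.
move=> /(leq_trans (sq x x4)); rewrite leqNgt => /negP; apply.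
rewrite -mulnn; apply: (@leq_ltn_trans (N * (x + x))).
  by rewrite leq_mul2l leq_add2l /x; apply/orP; right; lia.
rewrite addnn -mul2n mulnA ltn_mul2r; apply/andP; split; rewrite /x; lia.
Qed.

Section BezoutBound.
Context {R : realType} {F : nonArchLocalFieldType R} (m d D k : nat).
Hypotheses (d_gt0 : (0 < d)%N) (D_gt0 : (0 < D)%N).
Context (g : 'I_m -> mpoly m.+1 F) (phi : mpoly m.+1 F).
Hypothesis g_deg : forall i, (mmeasure mdeg (g i) <= D.+1)%N.
Hypothesis phi_deg : (mmeasure mdeg phi <= d.+1)%N.
(* [E t] is the restriction to the fibre over t of the last coordinate, recentered
   at a point of this fibre. *)
Context (E : F -> 'I_m.+1 -> mpoly m F) (e : nat) (C r0 : R).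
Hypotheses (C0 : 0 < C) (r00 : 0 < r0).
Hypothesis E0 : forall t, E t ord0 = mpolyC m t.
Hypothesis Ephi : forall t, t != 0 -> absv t <= r0 ->
  absv (mcoeff mnm0 (psub (E t) phi)) = C * absv t ^+ k.
Hypothesis Eg1 : forall t i, t != 0 -> absv t <= r0 -> ordge 1 (psub (E t) (g i)).
Hypothesis Ege : forall t J p, t != 0 -> absv t <= r0 -> ordge e p ->
  exists a : 'I_m -> mpoly m F, ordge J (p - \sum_i a i * psub (E t) (g i)).

(** The single index i encodes the exponents i / k of phi and i mod k of t. At the point of the
    fibre over t, the last factor has absolute value C^(i / k) |t|^i, so that i is its order in
    t. *)
Let term (s : multinom m) (i : nat) : mpoly m.+1 F :=
  mmap1 g s * (phi ^+ (i %/ k) * mpolyX F (mnm1 ord0) ^+ (i %% k)).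

Let weight (s : multinom m) (i : nat) := (D * mdeg s + (d * (i %/ k) + i %% k))%N.

Let term_deg s i : (mmeasure mdeg (term s i) <= (weight s i).+1)%N.
Proof.
apply: msizeM_leS; first exact: msize_mmap1_leS.
apply: msizeM_leS; first exact: msize_exp_leS.
rewrite -[X in (_ <= X.+1)%N]mul1n; apply: msize_exp_leS.
by rewrite msizeX mdeg1.
Qed.

(** As d, D >= 1, for k > 0 the bounds on s and i follow from the one on the weight; they make the
    type finite. *)
Let wtype T := {x : bmultinom m T.+1 * 'I_(k * T.+1) |
  (weight (bmnm x.1) x.2 <= T)%N}.

(** Group a relation by powers g^s. Over a small t, each coefficient that is not formally zero
    becomes a unit at the recentered origin, against the analytic independence of the g_j. *)
Let term_independent T (c : wtype T -> F) : (0 < k)%N ->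
  \sum_x c x *: term (bmnm (val x).1) (val x).2 = 0 -> forall x, c x = 0.
Proof.
move=> k0 c0.
pose cc (s : bmultinom m T.+1) (i : 'I_(k * T.+1)) : F := oapp c 0 (insub (s, i)).
have {}c0 : \sum_s \sum_i cc s i *: term (bmnm s) i = 0.
  rewrite pair_bigA/= -[RHS]c0 [LHS](bigID (fun x : bmultinom m T.+1 * 'I_(k * T.+1)
    => weight (bmnm x.1) x.2 <= T)%N)/=.
  rewrite [X in _ + X]big1 ?addr0 => [|[s i] /= wT]; last first.
    by rewrite /cc insubN ?scale0r//=.
  rewrite [LHS](reindex_omap (val : wtype T -> _) insub)/=; last first.
    by move=> x wT; rewrite insubT.
  apply: eq_big => [[[s i] wT]|[[s i] wT] _] /=; first by rewrite insubT wT eqxx.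
  by rewrite /cc insubT/=.
suff cc0 s0 i0 : cc s0 i0 = 0.
  move=> [[s i] wT]; have := cc0 s i; rewrite /cc insubT/=.
  by congr (c _ = _); apply: val_inj.
apply: contrapT => /eqP csi.
pose nz (s : bmultinom m T.+1) := [exists i, cc s i != 0].
pose A i : R := C ^+ (i %/ k).
have A0 i : 0 < A i by rewrite exprn_gt0.
have /choice[rr rrP] : forall s : bmultinom m T.+1, exists r, 0 < r /\
    (nz s -> forall (u : 'I_(k * T.+1) -> F) (t : R), 0 < t <= r ->
    (forall i, absv (u i) = A i * t ^+ i) -> \sum_i cc s i * u i != 0).
  move=> s'; have [/existsP nzs|nzs] := boolP (nz s'); last by exists 1.
  by have [r r1 rP] := sum_neq0_of_dominant A0 nzs; exists r.
(* One radius for the finitely many s, so that a single t serves them all. *)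
pose r1 := \big[Num.min/r0]_s rr s.
have r10 : 0 < r1.
  apply: (big_ind (fun x => 0 < x)) => // [x y x0 y0|s' _].
    by rewrite lt_min x0.
  by case: (rrP s').
have [t t0 tr1] := exists_small (F := F) r10.
have tr0 : absv t <= r0 by rewrite (le_trans (ltW tr1))// bigmin_le_id.
pose w (s : bmultinom m T.+1) := psub (E t)
  (\sum_i cc s i *: (phi ^+ (i %/ k) * mpolyX F (mnm1 ord0) ^+ (i %% k))).
pose ww (s : multinom m) : mpoly m F := oapp w 0 (insub s).
have w0 s' : nz s' -> mcoeff mnm0 (w s') != 0.
  move=> nzs; rewrite /w psub_sum raddf_sum/=.
  rewrite (eq_bigr (fun i : 'I_(k * T.+1) => cc s' i *
      (mcoeff mnm0 (psub (E t) phi) ^+ (i %/ k) * t ^+ (i %% k)))) => [|i _].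
    have [_ /(_ nzs) P] := rrP s'; apply: (P _ (absv t)) => [|i].
      by rewrite absv_gt0 t0/= (le_trans (ltW tr1))// /r1; apply: bigmin_le_cond.
    rewrite absvM !absvX Ephi// exprMn -mulrA -exprM -exprD.
    by rewrite [(k * (i %/ k))%N]mulnC -divn_eq.
  rewrite psubZ mcoeffZ psubM !psub_exp psubXU E0 -(rmorphXn (@mpolyC m F))/=.
  by rewrite [_ * mpolyC m _]mulrC mcoeffCM rmorphXn/= [t ^+ _ * _]mulrC.
pose S := [seq bmnm s | s <- enum [pred s | nz s]].
have : S = [::].
  apply: (@sop_analytic_independence _ _ (fun i => psub (E t) (g i)) e S ww).
  - by move=> i; apply: Eg1.
  - by move=> J p; apply: Ege.
  - by rewrite map_inj_uniq ?enum_uniq//; exact: val_inj.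
  - move=> _ /mapP[s' + ->]; rewrite mem_enum inE /ww => nzs.
    by rewrite valK/=; apply: w0.
  rewrite big_map big_enum/=.
  have := congr1 (psub (E t)) c0; rewrite rmorph0 psub_sum => c0'; apply: etrans c0'.
  rewrite [RHS](bigID nz)/= [X in _ = _ + X]big1 ?addr0 => [|s' nzs].
    apply: eq_big => [s'|s' _]; rewrite ?inE// /ww valK/= /w !psub_sum mulr_suml.
    apply: eq_bigr => i _; rewrite !psubZ -scalerAl /term [in RHS]psubM mulrC.
    congr (_ *: (_ * _)).
    by rewrite /mmap1 psub_prod; apply: eq_bigr => j _; rewrite psub_exp.
  rewrite big1 ?rmorph0// => i _.
  suff -> : cc s' i = 0 by rewrite scale0r.
  by apply/eqP; apply: contraNT nzs => csi'; apply/existsP; exists i.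
have : bmnm s0 \in S.
  by rewrite map_f// mem_enum inE; apply/existsP; exists i0.
by move=> + S0; rewrite S0.
Qed.

Let card_wtype_le T : (0 < k)%N -> (#|{: wtype T}| <= #|{: bmultinom m.+1 T.+1}|)%N.
Proof.
move=> k0; rewrite leqNgt; apply/negP => lt.
have [|c [x cx] c0] := @linear_dependence F m.+1 T.+1 _
  (fun x : wtype T => term (bmnm (val x).1) (val x).2) _ lt.
  move=> [x xT]/=; apply: leq_trans (term_deg _ _) _.
  by rewrite ltnS.
by rewrite (term_independent k0 c0) eqxx in cx.
Qed.

(** Divide the exponent of t by d and the m others by D. The quotients are the exponents of a term,
    and the remainders take d D^m values. The additional power b < k of t adds less than k to the
    weight. *)
Let card_wtype_ge T : (0 < k)%N ->
  (k * #|{: bmultinom m.+1 T.+1}| <= (D ^ m * d) * #|{: wtype (T + k)}|)%N.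
Proof.
move=> k0.
pose s (a : multinom m.+1) := Multinom [tuple (a (lift ord0 i) %/ D)%N | i < m].
pose j (a : multinom m.+1) (b : 'I_k) := (k * (a ord0 %/ d) + b)%N.
have divj a b : (j a b %/ k = a ord0 %/ d)%N.
  by rewrite /j [(k * _)%N]mulnC divnMDl// (divn_small (ltn_ord b)) addn0.
have modj a (b : 'I_k) : (j a b %% k = b)%N.
  by rewrite /j [(k * _)%N]mulnC modnMDl (modn_small (ltn_ord b)).
have degS (a : multinom m.+1) :
    (mdeg a = a ord0 + \sum_(i < m) a (lift ord0 i))%N.
  by rewrite mdegE big_ord_recl.
have wle a b : (weight (s a) (j a b) < mdeg a + k)%N.
  rewrite /weight divj modj addnA -addnS leq_add//.
  rewrite degS addnC; apply: leq_add; first by rewrite mulnC leq_divM.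
  rewrite mdegE big_distrr/=; apply: leq_sum => i _.
  by rewrite multinomE tnth_mktuple mulnC leq_divM.
have sT (a : bmultinom m.+1 T.+1) : (mdeg (s (bmnm a)) < (T + k).+1)%N.
  rewrite ltnS mdegE.
  apply: (@leq_trans (\sum_(i < m) bmnm a (lift ord0 i))%N).
    by apply: leq_sum => i _; rewrite multinomE tnth_mktuple leq_div.
  rewrite (leq_trans _ (leq_addr _ _))// -ltnS (leq_trans _ (bmdeg a))//.
  by rewrite ltnS degS leq_addl.
have jT (a : bmultinom m.+1 T.+1) b : (j (bmnm a) b < k * (T + k).+1)%N.
  apply: (@leq_trans (k * (bmnm a ord0 %/ d).+1)%N).
    by rewrite /j mulnS addnC ltn_add2r.
  rewrite leq_mul2l ltnS; apply/orP; right.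
  rewrite (leq_trans (leq_div _ _))// (leq_trans _ (leq_addr _ _))//.
  by rewrite -ltnS (leq_trans _ (bmdeg a))// ltnS degS leq_addr.
have wT (a : bmultinom m.+1 T.+1) b :
    (weight (bmnm (BMultinom (sT a), Ordinal (jT a b)).1)
       (BMultinom (sT a), Ordinal (jT a b)).2 <= T + k)%N.
  by rewrite /= (leq_trans (ltnW (wle _ _)))// leq_add2r -ltnS; exact: bmdeg.
pose f (x : 'I_k * bmultinom m.+1 T.+1) : {ffun 'I_m -> 'I_D} * 'I_d * wtype (T + k) :=
  (([ffun i => Ordinal (ltn_pmod (bmnm x.2 (lift ord0 i)) D_gt0)],
    Ordinal (ltn_pmod (bmnm x.2 ord0) d_gt0)),
   exist (fun y : bmultinom m (T + k).+1 * 'I_(k * (T + k).+1) =>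
            weight (bmnm y.1) y.2 <= T + k)%N
     (BMultinom (sT x.2), Ordinal (jT x.2 x.1)) (wT x.2 x.1)).
have finj : injective f.
  move=> [b a] [b' a'] [] /ffunP sD jd ss jj.
  have bb' : b = b'.
    by apply/val_inj; have := congr1 (modn^~ k) jj; rewrite !modj.
  congr pair => //; apply/val_inj/mnmP => i.
  have := unliftP ord0 i; case: unliftP => [l ->|->] _.
    rewrite (divn_eq (bmnm a _) D) (divn_eq (bmnm a' _) D).
    have := sD l; rewrite !ffunE => /(congr1 val)/= ->.
    have /eq_in_map/(_ l) := ss; rewrite mem_enum => /(_ isT) ->.
    by [].
  rewrite (divn_eq (bmnm a _) d) (divn_eq (bmnm a' _) d) jd.
  by have := congr1 (divn^~ k) jj; rewrite !divj => ->.
have := leq_card f finj.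
by rewrite !card_prod card_ffun !card_ord.
Qed.

(* For the number c(T) of monomials of degree <= T, linear independence gives
   k c(T) <= d D^m c(T + k): were k larger than d D^m, c would grow exponentially. *)
Lemma bezout_bound : (k <= d * D ^ m)%N.
Proof.
rewrite leqNgt; apply/negP => kE.
have k0 : (0 < k)%N by apply: leq_ltn_trans kE.
apply: (@exp_beats_poly (d * D ^ m) k m.+1 (fun T => #|{: bmultinom m.+1 T.+1}|)).
- by move=> T; apply: card_multinom_le.
- by apply/card_gt0P; exists bm0.
- by rewrite muln_gt0 d_gt0 expn_gt0 D_gt0.
move=> T; apply: (@leq_trans (k * #|{: bmultinom m.+1 T.+1}|)%N).
  by rewrite leq_mul2r kE orbT.
apply: (leq_trans (card_wtype_ge T k0)); rewrite [(D ^ m * d)%N]mulnC leq_mul2l.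
by rewrite card_wtype_le ?orbT.
Qed.

End BezoutBound.

(** * The Krull intersection theorem *)

(** Induction on the number of entries compared. The elements whose last entry is at least M are
    dominated by the basis found for the previous entries; each of the M slices with a smaller last
    entry has its own finite basis. *)
Lemma dickson_nat n (L : set (nat -> nat)) :
  exists (I : finType) (b : I -> nat -> nat),
    (forall i, L (b i)) /\
    forall a, L a -> exists i, forall j, (j < n)%N -> (b i j <= a j)%N.
Proof.
elim: n L => [|n IHn] L.
  have [[a La]|L0] := pselect (exists a, L a).
    by exists unit, (fun=> a); split => // a' La'; exists tt.
  by exists void, (fun (i : void) => match i with end); split => [[]//|a La];
    case: L0; exists a.
have [I [b [bL bP]]] := IHn L.
pose M := \max_i b i n.
have /choice[J cJ] : forall v : 'I_M, exists (J : finType) (c : J -> nat -> nat),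
    (forall i, L (c i) /\ c i n = v) /\
    forall a, L a -> a n = v -> exists i, forall j, (j < n)%N -> (c i j <= a j)%N.
  move=> v; have [J [c [cL cP]]] := IHn [set a | L a /\ a n = v].
  by exists J, c; split => // a La av; apply: cP.
pose c v := projT1 (cid (cJ v)).
have cP v : _ := projT2 (cid (cJ v)); rewrite -/(c _) in cP.
exists (I + {v : 'I_M & J v})%type,
  (fun x => match x with inl i => b i | inr (existT v i) => c v i end).
split => [[i|[v i]]|a La]; [exact: bL|by case: (cP v) => /(_ i)[]|].
have [aM|Ma] := ltnP (a n) M; last first.
  have [i iP] := bP _ La; exists (inl i) => j; rewrite ltnS leq_eqVlt.
  move=> /predU1P[->|/iP//]; apply: leq_trans Ma.
  by rewrite /M (bigD1 i)//= leq_maxl.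
have [cv /(_ a La erefl)[i iP]] := cP (Ordinal aM).
exists (inr (existT _ (Ordinal aM) i)) => j; rewrite ltnS leq_eqVlt.
by move=> /predU1P[->|/iP//]; rewrite /c; case: (cv i) => _ ->.
Qed.

Lemma dickson n (L : set (multinom n)) :
  exists (I : finType) (b : I -> multinom n),
    (forall i, L (b i)) /\ forall a, L a -> exists i, mpoly.lem (b i) a.
Proof.
pose L' := [set u : nat -> nat | exists2 a, L a & forall j : 'I_n, u j = a j].
have [I [b [/= bL bP]]] := dickson_nat n L'.
have /choice[c cP] : forall i, exists a, L a /\ forall j : 'I_n, b i j = a j.
  by move=> i; have [a La ab] := bL i; exists a.
exists I, c; split => [i|a La]; first by case: (cP i).
have [i iP] := bP (fun j => if insub j is Some k then a k else 0%N) (ltac:(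
  exists a => // j; rewrite valK//)).
exists i; apply/mnm_lepP => j; case: (cP i) => _ <-.
by have := iP j (ltn_ord j); rewrite valK.
Qed.

(** Ideals are kept as sets with values in Prop, since they are given by existential conditions;
    [exists_prime_idealr] leads back to points of the spectrum. *)
Definition ideal_closed (A : comNzRingType) (I : set A) :=
  [/\ I 0, forall x y, I x -> I y -> I (x + y) & forall a x, I x -> I (a * x)].

Definition ideal_of (A : comNzRingType) (K : finType) (b : K -> A) : set A :=
  [set x | exists c : K -> A, x = \sum_k c k * b k].

Lemma ideal_of_closed (A : comNzRingType) (K : finType) (b : K -> A) :
  ideal_closed (ideal_of b).
Proof.
split=> [|x y [c ->] [c' ->]|a x [c ->]].
- by exists (fun=> 0); rewrite big1// => k _; rewrite mul0r.
- exists (fun k => c k + c' k); rewrite -big_split; apply: eq_bigr => k _.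
  by rewrite mulrDl.
- by exists (fun k => a * c k); rewrite mulr_sumr; apply: eq_bigr => k _; rewrite mulrA.
Qed.

Lemma ideal_of_mem (A : comNzRingType) (K : finType) (b : K -> A) k :
  ideal_of b (b k).
Proof.
exists (fun l => (l == k)%:R); rewrite (bigD1 k)//= eqxx mul1r big1 ?addr0//.
by move=> l /negPf ->; rewrite mul0r.
Qed.

Section IdealClosed.
Context (A : comNzRingType) (I : set A) (I_ideal : ideal_closed I).

Lemma ideal_closedN x : I x -> I (- x).
Proof. by case: I_ideal => _ _ IM /(IM (-1)); rewrite mulN1r. Qed.

Lemma ideal_closedB x y : I x -> I y -> I (x - y).
Proof. by case: (I_ideal) => _ ID _ Ix /ideal_closedN; apply: ID. Qed.

Lemma ideal_closedMr a x : I x -> I (x * a).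
Proof. by case: I_ideal => _ _ IM Ix; rewrite mulrC; apply: IM. Qed.

Lemma ideal_closed_sum (T : Type) (r : seq T) (P : pred T) (f : T -> A) :
  (forall i, P i -> I (f i)) -> I (\sum_(i <- r | P i) f i).
Proof. by case: I_ideal => I0 ID _ fI; apply: big_ind. Qed.

End IdealClosed.

(** Apply Dickson's lemma to the leading monomials of the ideal: division by the chosen elements
    lowers the leading monomial, in a well-order. *)
Lemma hilbert_basis (F : fieldType) n (I : set (mpoly n F)) : ideal_closed I ->
  exists (K : finType) (b : K -> mpoly n F),
    (forall k, I (b k)) /\ I `<=` ideal_of b.
Proof.
move=> II.
pose L := [set a | exists p, [/\ I p, p != 0 & mlead p = a]].
have [K [a [aL aP]]] := dickson L.
have /choice[b bP] := aL.
exists K, b; split => [k|]; first by case: (bP k).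
suff H l p : I p -> mlead p = l -> ideal_of b p by move=> p Ip; apply: H Ip erefl.
have [b0 bD bM] := ideal_of_closed b.
elim: l / (@ltom_wf n l) p => l _ IH p Ip pl.
have [->//|p0] := eqVneq p 0.
have [k] := aP l (ex_intro _ p (And3 Ip p0 pl)).
have [Ib bk0 bka] := bP k; rewrite -bka => bl.
pose r := (mcoeff l p / mcoeff (mlead (b k)) (b k)) *:
  (mpolyX F (mpoly.mnm_sub l (mlead (b k))) * b k).
have lc0 : mcoeff (mlead (b k)) (b k) != 0 by rewrite mleadc_eq0.
have pl0 : mcoeff l p != 0 by rewrite -pl mleadc_eq0.
have rl : mlead r = l.
  rewrite mleadZ ?mulf_neq0 ?invr_neq0// mleadM//.
    by rewrite mleadXm submK.
  by rewrite -msize_poly_eq0 msizeX.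
have rc : mcoeff l r = mcoeff l p.
  rewrite mcoeffZ mulrC mulrCA mulrC.
  have -> : mcoeff l (mpolyX F (mpoly.mnm_sub l (mlead (b k))) * b k) =
      mcoeff (mlead (b k)) (b k).
    by rewrite mulrC -[X in mcoeff X](submK bl) mcoeffMX.
  by rewrite mulfV ?mul1r.
rewrite -[p](subrK r); apply: bD; last first.
  rewrite /r -mul_mpolyC; apply: (bM); apply: bM; exact: ideal_of_mem.
have [->//|pr0] := eqVneq (p - r) 0.
apply: (IH (mlead (p - r))) => //; last first.
  apply: ideal_closedB => //; rewrite /r -mul_mpolyC.
  by case: II => _ _ IM; apply: (IM); apply: IM.
have := mleadB_le p r; rewrite pl rl joinxx le_eqVlt => /predU1P[prl|//].
by move: pr0; rewrite -mleadc_eq0 prl mcoeffB rc subrr eqxx.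
Qed.

(** The ideal of all the P_i has finitely many generators, which involve only the terms before some
    J. *)
Lemma noetherian_sequence (F : fieldType) n (P : nat -> mpoly n F) :
  exists J (c : nat -> mpoly n F), P J = \sum_(i < J) c i * P i.
Proof.
pose I := [set p | exists N (c : nat -> mpoly n F), p = \sum_(i < N) c i * P i].
have widen N M (c : nat -> mpoly n F) : (N <= M)%N ->
    \sum_(i < N) c i * P i = \sum_(i < M) (if (i < N)%N then c i else 0) * P i.
  move=> NM; rewrite (big_ord_widen M (fun i => c i * P i))// big_mkcond.
  by apply: eq_bigr => i _; case: ifP => //; rewrite mul0r.
have [|K [b [bI bP]]] := @hilbert_basis F n I.
  split=> [|_ _ [N [c ->]] [N' [c' ->]]|a _ [N [c ->]]].
  - by exists 0%N, (fun=> 0); rewrite big_ord0.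
  - exists (maxn N N'), (fun i => (if (i < N)%N then c i else 0) +
      (if (i < N')%N then c' i else 0)).
    rewrite (widen _ _ _ (leq_maxl N N')) [X in _ + X](widen _ _ _ (leq_maxr N N')).
    by rewrite -big_split; apply: eq_bigr => i _; rewrite mulrDl.
  - by exists N, (fun i => a * c i); rewrite mulr_sumr; apply: eq_bigr => i _;
      rewrite mulrA.
have /choice[N /choice[c cP]] := bI.
pose J := \max_k N k; exists J.
have [|e PJ] := bP (P J).
  exists J.+1, (fun i => (i == J)%:R); rewrite big_ord_recr/= eqxx mul1r.
  by rewrite big1 ?add0r// => i _; rewrite ltn_eqF// mul0r.
exists (fun i => \sum_k e k * (if (i < N k)%N then c k i else 0)).
rewrite PJ; under [RHS]eq_bigr do rewrite mulr_suml.
rewrite exchange_big; apply: eq_bigr => k _; rewrite cP (widen _ J).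
  by rewrite mulr_sumr; apply: eq_bigr => i _; rewrite mulrA.
by rewrite /J (bigD1 k)//= leq_maxl.
Qed.

Section KrullIntersection.
Context (F : fieldType) (N : nat).

(* The image of [rees] is the Rees algebra of the ideal of the origin: the
   polynomials in one variable whose j-th coefficient vanishes to order j. *)
Let rees_var (i : 'I_(N + N)) : {poly mpoly N F} :=
  match fintype.split i with
  | inl j => (mpolyX F (mnm1 j))%:P
  | inr j => (mpolyX F (mnm1 j))%:P * 'X
  end.

Let rees : mpoly (N + N) F -> {poly mpoly N F} :=
  mmap (polyC \o @mpolyC N F) rees_var.

Let rees_coef P l : (0 < l)%N -> ordge 1 (rees P)`_l.
Proof.
pose good (p : {poly mpoly N F}) := forall l, (0 < l)%N -> ordge 1 p`_l.
have goodC (c : mpoly N F) : good c%:P.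
  by move=> [//|j] _; rewrite coefC; apply: ordge_zero.
have goodM p q : good p -> good q -> good (p * q).
  move=> gp gq j j0; rewrite coefM; apply: ordge_sum => i _.
  have [i0|i0] := posnP i; last exact/ordgeMr/gp.
  by apply/ordgeMl/gq; rewrite i0 subn0.
suff : good (rees P) by apply.
rewrite /rees /mmap; apply: big_ind => [||a _].
- exact: goodC.
- by move=> p q gp gq j j0; rewrite coefD; apply: ordgeD; [exact: gp|exact: gq].
apply: (goodM); first exact: goodC.
apply: big_ind => [|//|i _]; first exact: goodC.
elim: (a i) => [|k IHk]; first by rewrite expr0; apply: goodC.
rewrite exprS; apply: (goodM) => //; rewrite /rees_var; case: fintype.split => j.
  exact: goodC.
move=> l' _; rewrite coefMX; case: ifP => _; first exact: ordge_zero.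
rewrite coefC; case: ifP => _; last exact: ordge_zero.
by have := @ordgeX F N (mnm1 j); rewrite mdeg1.
Qed.

(** In a monomial of degree at least J, take J of the variables from the second set, each bringing
    one factor of the new variable. *)
Let rees_lift J p : ordge J p -> exists P, rees P = p *: 'X^J.
Proof.
have lift_var i : exists P, rees P = (mpolyX F (mnm1 i))%:P.
  exists (mpolyX F (mnm1 (lshift N i))); rewrite /rees mmapX mmap1U /rees_var.
  by rewrite (unsplitK (inl i : 'I_N + 'I_N)).
have lift_varX i : exists P, rees P = (mpolyX F (mnm1 i))%:P * 'X.
  exists (mpolyX F (mnm1 (rshift N i))); rewrite /rees mmapX mmap1U /rees_var.
  by rewrite (unsplitK (inr i : 'I_N + 'I_N)).
have liftM x y : (exists P, rees P = x) -> (exists P, rees P = y) ->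
    exists P, rees P = x * y.
  by move=> [P <-] [Q <-]; exists (P * Q); rewrite /rees rmorphM.
have lift_mon a : exists P, rees P = (mpolyX F a)%:P.
  rewrite mpolyXE_id rmorph_prod.
  apply: (big_ind (fun x => exists P, rees P = x)) => [|//|i _].
    by exists 1; rewrite /rees rmorph1.
  rewrite rmorphXn; elim: (a i) => [|k IHk]; last first.
    by rewrite exprS; apply: liftM IHk; exact: lift_var.
  by exists 1; rewrite /rees rmorph1 expr0.
have lift_monX j a : (j <= mdeg a)%N -> exists P, rees P = (mpolyX F a)%:P * 'X^j.
  elim: j a => [|j IHj] a; first by rewrite expr0 mulr1.
  move=> ja; have [i ai] : exists i, a i != 0%N.
    apply/existsP; rewrite -negb_forall; apply: contraL ja => /forallP a0.
    by rewrite mdegE big1// => i _; apply/eqP.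
  have aE : a = mpoly.mnm_add (mpoly.mnm_sub a (mnm1 i)) (mnm1 i).
    by rewrite submK// lep1mP.
  rewrite aE mpolyXD rmorphM/= exprSr mulrACA; apply: liftM; last exact: lift_varX.
  by apply: IHj; move: ja; rewrite {1}aE mdegD mdeg1 addn1.
move=> pJ; rewrite -mul_polyC [p]mpolyE rmorph_sum mulr_suml/= big_seq.
apply: (big_ind (fun x => exists P, rees P = x)) => [||a ap].
- by exists 0; rewrite /rees rmorph0.
- by move=> x y [P <-] [Q <-]; exists (P + Q); rewrite /rees rmorphD.
have [P PE] : exists P, rees P = (mpolyX F a)%:P * 'X^J.
  apply: lift_monX; rewrite leqNgt; apply/negP => aJ.
  by move: ap; rewrite mcoeff_msupp pJ// eqxx.
exists (mpolyC _ (mcoeff a p) * P); rewrite /rees rmorphM/= mmapC/=.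
by rewrite -/(rees P) PE -mul_mpolyC rmorphM/= mulrA.
Qed.

(** Write f = eta_J + r_J with eta_J in (h) and r_J of order J. The r_J X^J lie in the Rees algebra,
    which is a quotient of a polynomial ring, so some r_J is a combination of earlier r_i with
    coefficients mu_i of order at least 1. Then u = 1 - sum mu_i sends f into (h). *)
Lemma krull_intersection (K : finType) (h : K -> mpoly N F) f :
  (forall J, exists c : K -> mpoly N F, ordge J (f - \sum_k c k * h k)) ->
  exists2 u, mcoeff mnm0 u = 1 & ideal_of h (u * f).
Proof.
move=> /choice[c cP].
have /choice[P PP] := fun J => rees_lift (cP J).
have [J [e PJ]] := noetherian_sequence P.
have hC := ideal_of_closed h.
pose eta i := \sum_k c i k * h k.
have etah i : ideal_of h (eta i) by exists (c i).
pose mu (i : 'I_J) := (rees (e i))`_(J - i).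
exists (1 - \sum_i mu i).
  rewrite mcoeffB mcoeff1 eqxx raddf_sum/= big1 ?subr0// => i _.
  by apply: rees_coef; rewrite ?subn_gt0 ?mdeg0.
have := congr1 (fun p => (rees p)`_J) PJ; rewrite /= PP coefZ coefXn eqxx mulr1.
rewrite /rees rmorph_sum coef_sum/= => fJ.
have -> : (1 - \sum_i mu i) * f = eta J - \sum_i mu i * eta i.
  suff : f - eta J = (\sum_i mu i) * f - \sum_i mu i * eta i.
    move=> /eqP; rewrite subr_eq => /eqP fE.
    by rewrite mulrBl mul1r {1}fE addrAC [X in X + _]addrAC subrr sub0r addrC.
  rewrite /eta fJ mulr_suml -sumrB; apply: eq_bigr => i _.
  rewrite -mulrBr rmorphM/= -/(rees _) -/(rees _) PP.
  by rewrite -scalerAr coefZ coefMXn ltnNge (ltnW (ltn_ord i))/= mulrC.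
apply: ideal_closedB => //; apply: ideal_closed_sum => // i _.
by case: hC => _ _; apply.
Qed.

End KrullIntersection.

(** * Prime ideals and radicals *)

Lemma exists_prime_idealr (A : comNzRingType) (I : set A) : ideal_closed I ->
  ~ I 1 -> (forall u v, I (u * v) -> I u \/ I v) ->
  exists P : prime_idealr A, forall x, (x \in P) <-> I x.
Proof.
move=> [I0 ID IM] I1 Iprime.
pose S : A -> bool := fun x => `[< I x >].
have S1 : idealr_closed S.
  split; first exact/asboolP.
    by apply/asboolP.
  by move=> a u v /asboolP Iu /asboolP Iv; apply/asboolP/ID => //; apply: IM.
have S2 : prime_idealr_closed S.
  by move=> u v /asboolP/Iprime[] Iw; apply/orP; [left|right]; apply/asboolP.
pose P : prime_idealr A := HB.pack S (isIdealr.Build A S S1)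
  (isPrimeIdealrClosed.Build A S S2).
by exists P => x; split => [/asboolP|Ix]; last exact/asboolP.
Qed.

Lemma radical_of_vanishing (A : comNzRingType) (K : finType) (g : K -> A) f :
  vanishing_ideal (zero_locus (range g)) f -> exists e, ideal_of g (f ^+ e).
Proof.
move=> fV; apply: contrapT => /forallNP fe.
pose good (I : set A) := [/\ ideal_closed I, forall k, I (g k) & forall e, ~ I (f ^+ e)].
have good_g : good (ideal_of g).
  by split => //; [exact: ideal_of_closed|exact: ideal_of_mem].
have [C Ctot|I [[I0|[IC Ig If]] Imax]] := @Zorn_bigcup A (fun I => I = set0 \/ good I).
- move=> CC.
  have [[I CI [IC Ig If]]|C0] := pselect (exists2 I, C I & good I); last first.
    left; apply/seteqP; split => // x [J CJ Jx].
    have [J0|gJ] := Ctot _ CJ; last by case: C0; exists J.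
    by rewrite J0 in Jx.
  right; split => [|k|e [J CJ Jf]]; last 2 first.
  + by exists I.
  + by have [J0|[_ _ /(_ e)//]] := Ctot _ CJ; rewrite J0 in Jf.
  split => [|x y [J CJ Jx] [J' CJ' J'y]|a x [J CJ Jx]].
  + by exists I => //; case: IC.
  + have [J0|[JC _ _]] := Ctot _ CJ; first by rewrite J0 in Jx.
    have [J0|[J'C _ _]] := Ctot _ CJ'; first by rewrite J0 in J'y.
    have [JJ'|J'J] := CC _ _ CJ CJ'.
      by exists J' => //; case: J'C => _ + _; apply => //; apply: JJ'.
    by exists J => //; case: JC => _ + _; apply => //; apply: J'J.
  + have [J0|[[_ _ JM] _ _]] := Ctot _ CJ; first by rewrite J0 in Jx.
    by exists J => //; apply: JM.
- apply: (Imax (ideal_of g)); last by right.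
  rewrite I0; split => // /(_ 0); apply.
  by case: (ideal_of_closed g).
have I1 : ~ I 1 by have := If 0%N; rewrite expr0.
have [|P PI] := exists_prime_idealr IC I1.
  move=> u v Iuv; apply: contrapT => /not_orP[Iu Iv].
  have [I0 ID IM] := IC.
  (* By maximality, the ideal generated by I and w contains a power of f. *)
  have extend w : ~ I w -> exists e a, I (f ^+ e - a * w).
    move=> Iw; pose Iw' := [set x | exists a, I (x - a * w)].
    have Iw'C : ideal_closed Iw'.
      split => [|x y [a xa] [b yb]|c x [a xa]].
      - by exists 0; rewrite mul0r subr0.
      - by exists (a + b); rewrite mulrDl opprD addrACA; apply: ID.
      - by exists (c * a); rewrite -mulrA -mulrBr; apply: IM.
    apply: contrapT => /forallNP fw; apply: (Imax Iw'); last first.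
      right; split; first exact: Iw'C.
        by move=> k; exists 0; rewrite mul0r subr0.
      by move=> e [a fa]; apply: (fw e); exists a.
    split => [|sub]; first by move=> x Ix; exists 0; rewrite mul0r subr0.
    by apply: Iw; apply: sub; exists 1; rewrite mul1r subrr.
  have [e1 [a1 f1]] := extend _ Iu; have [e2 [a2 f2]] := extend _ Iv.
  apply: (If (e1 + e2)%N); rewrite exprD.
  have -> : f ^+ e1 * f ^+ e2 = f ^+ e2 * (f ^+ e1 - a1 * u) +
      (a1 * u * (f ^+ e2 - a2 * v) + a1 * a2 * (u * v)).
    rewrite [a1 * a2 * _]mulrACA !mulrBr (subrK (a1 * u * (a2 * v))).
    by rewrite [a1 * u * _]mulrC subrK mulrC.
  by apply: (ID); [exact: IM|apply: (ID); exact: IM].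
have /fV /PI : zero_locus (range g) P.
  by move=> _ [k _ <-]; apply/PI/Ig.
by have := If 1%N; rewrite expr1.
Qed.

(** * Gauss norms and convergent power series *)

Section GaussNorm.
Context {R : realType} {F : nonArchLocalFieldType R}.
Implicit Types (B e : R).

Definition gauss n B (p : mpoly n F) := forall a, absv (mcoeff a p) <= B.

Definition unit_ball n (v : 'I_n -> F) := forall i, absv (v i) <= 1.

Section Gauss.
Context (n : nat).
Implicit Types (p q : mpoly n F).

Lemma gaussW B B' p : B <= B' -> gauss B p -> gauss B' p.
Proof. by move=> BB' pB a; apply: le_trans BB'. Qed.

Lemma gauss0 B : 0 <= B -> gauss B (0 : mpoly n F).
Proof. by move=> B0 a; rewrite mcoeff0 absv0. Qed.

Lemma gaussD B p q : gauss B p -> gauss B q -> gauss B (p + q).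
Proof. by move=> pB qB a; rewrite mcoeffD; apply: absvD_le. Qed.

Lemma gauss_sum B (I : Type) (r : seq I) (P : pred I) (p : I -> mpoly n F) :
  0 <= B -> (forall i, P i -> gauss B (p i)) -> gauss B (\sum_(i <- r | P i) p i).
Proof.
by move=> B0 pB; apply: big_ind => //; [exact: gauss0|exact: gaussD].
Qed.

Lemma gaussM B B' p q : 0 <= B -> 0 <= B' -> gauss B p -> gauss B' q ->
  gauss (B * B') (p * q).
Proof.
move=> B0 B'0 pB qB a; rewrite mcoeffM; apply: absv_sum_le => [|k _].
  exact: mulr_ge0.
by rewrite absvM ler_pM ?absv_ge0.
Qed.

Lemma gaussZ B B' c p : 0 <= B -> absv c <= B' -> gauss B p ->
  gauss (B' * B) (c *: p).
Proof. by move=> B0 cB pB a; rewrite mcoeffZ absvM ler_pM ?absv_ge0. Qed.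

Lemma gaussC B c : 0 <= B -> absv c <= B -> gauss B (mpolyC n c).
Proof.
move=> B0 cB a; rewrite mcoeffC absvM; case: eqP => _.
  by rewrite absv1 mulr1.
by rewrite absv0 mulr0.
Qed.

Lemma gaussX a : gauss 1 (mpolyX F a : mpoly n F).
Proof. by move=> b; rewrite mcoeffX; case: eqP; rewrite ?absv1 ?absv0 ?ler01. Qed.

Lemma gauss_exists p : exists2 B, 0 <= B & gauss B p.
Proof.
have sum0 : 0 <= \sum_(a <- msupp p) absv (mcoeff a p).
  by apply: sumr_ge0 => a _; apply: absv_ge0.
exists (\sum_(a <- msupp p) absv (mcoeff a p)) => // a.
have [ap|ap] := boolP (a \in msupp p); last by rewrite memN_msupp_eq0// absv0.
rewrite (bigD1_seq a) ?msupp_uniq//= lerDl; apply: sumr_ge0 => b _.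
exact: absv_ge0.
Qed.

End Gauss.

Section Lipschitz.
Context (k : nat) (e : R) (e0 : 0 <= e).

Let close (x y : mpoly k F) := [/\ gauss 1 x, gauss 1 y & gauss e (x - y)].

Let closeM x y x' y' : close x y -> close x' y' -> close (x * x') (y * y').
Proof.
move=> [x1 y1 xy] [x'1 y'1 xy'].
split; [rewrite -[1]mulr1; exact: gaussM..|].
rewrite -[x * x'](subrK (y * x')) -mulrBl -addrA -mulrBr; apply: gaussD.
  by rewrite -[e]mulr1; exact: gaussM.
by rewrite -[e]mul1r; exact: gaussM.
Qed.

Lemma gauss_mmap1 n (q q' : 'I_n -> mpoly k F) a :
  (forall i, gauss 1 (q i)) -> (forall i, gauss 1 (q' i)) ->
  (forall i, gauss e (q i - q' i)) ->
  gauss 1 (mmap1 q a) /\ gauss e (mmap1 q a - mmap1 q' a).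
Proof.
move=> q1 q'1 qq'.
have g1 : gauss 1 (1 : mpoly k F) by rewrite -mpolyC1; apply: gaussC; rewrite ?absv1.
have c1 : close 1 1 by split; rewrite ?subrr//; apply: gauss0.
suff [] : close (mmap1 q a) (mmap1 q' a) by [].
apply: big_ind2 => [//|x y x' y'|i _]; first exact: closeM.
elim: (a i) => [|j IHj]; first by rewrite !expr0.
by rewrite !exprS; apply: closeM.
Qed.

Lemma gauss_psub_lip n (q q' : 'I_n -> mpoly k F) B p : 0 <= B ->
  (forall i, gauss 1 (q i)) -> (forall i, gauss 1 (q' i)) ->
  (forall i, gauss e (q i - q' i)) -> gauss B p ->
  gauss B (psub q p) /\ gauss (B * e) (psub q p - psub q' p).
Proof.
move=> B0 q1 q'1 qq' pB; split.
  rewrite psubE; apply: gauss_sum => // a _.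
  rewrite -[B]mulr1; apply: gaussZ => //.
  by have [] := gauss_mmap1 a q1 q'1 qq'.
rewrite !psubE -sumrB; apply: gauss_sum => [|a _]; first exact: mulr_ge0.
rewrite -scalerBr; apply: gaussZ => //.
by have [] := gauss_mmap1 a q1 q'1 qq'.
Qed.

End Lipschitz.

Lemma gauss_psub n k (q : 'I_n -> mpoly k F) B p : 0 <= B ->
  (forall i, gauss 1 (q i)) -> gauss B p -> gauss B (psub q p).
Proof.
move=> B0 q1 pB; have qq i : gauss 1 (q i - q i) by rewrite subrr; apply: gauss0.
by have [] := gauss_psub_lip ler01 B0 q1 q1 qq pB.
Qed.

(** Evaluation is substitution by polynomials in 0 variables, so bounds on values are instances of
    bounds on substitutions. *)
Let psub_const n (v : 'I_n -> F) p :
  psub (fun i => mpolyC 0 (v i)) p = mpolyC 0 (meval v p).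
Proof.
rewrite psubE mevalE rmorph_sum/=; apply: eq_bigr => a _.
rewrite rmorphM/= mul_mpolyC; congr (_ *: _); rewrite /mmap1 rmorph_prod/=.
by apply: eq_bigr => i _; rewrite rmorphXn.
Qed.

Let gauss_const B c : gauss B (mpolyC 0 c) -> absv c <= B.
Proof. by move=> /(_ mnm0); rewrite mcoeffC eqxx mulr1. Qed.

Lemma meval_le n (v : 'I_n -> F) B p : 0 <= B -> unit_ball v -> gauss B p ->
  absv (meval v p) <= B.
Proof.
move=> B0 v1 pB; apply: gauss_const; rewrite -psub_const; apply: gauss_psub => //.
by move=> i; apply: gaussC.
Qed.

Lemma meval_lip n (v v' : 'I_n -> F) e B p : 0 <= e -> 0 <= B ->
  unit_ball v -> unit_ball v' -> (forall i, absv (v i - v' i) <= e) ->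
  gauss B p -> absv (meval v p - meval v' p) <= B * e.
Proof.
move=> e0 B0 v1 v'1 vv' pB; apply: gauss_const; rewrite rmorphB/= -!psub_const.
apply: (proj2 (gauss_psub_lip e0 B0 _ _ _ pB)) => i; [exact: gaussC..|].
by rewrite -rmorphB/=; apply: gaussC.
Qed.

Lemma meval_ordge_le n (w : 'I_n -> F) B e K p : 0 <= B -> 0 <= e <= 1 ->
  (forall i, absv (w i) <= e) -> gauss B p -> ordge K p ->
  absv (meval w p) <= B * e ^+ K.
Proof.
move=> B0 /andP[e0 e1] we pB pK; rewrite mevalE; apply: absv_sum_le => [|a _].
  by rewrite mulr_ge0// exprn_ge0.
have [aK|Ka] := ltnP (mdeg a) K.
  by rewrite pK// mul0r absv0 mulr_ge0// exprn_ge0.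
rewrite absvM ler_pM ?absv_ge0// absv_prod.
apply: (@le_trans _ _ (e ^+ mdeg a)); last exact: ler_wiXn2l.
rewrite mdegE -prodrXr; apply: ler_prod => i _.
by rewrite absv_ge0/= absvX lerXn2r ?nnegrE ?absv_ge0.
Qed.

Definition truncate n K (c : multinom n -> F) : mpoly n F :=
  \sum_(a : bmultinom n K) c (bmnm a) *: mpolyX F (bmnm a).

Lemma mcoeff_truncate n K c (a : multinom n) :
  mcoeff a (truncate K c) = if (mdeg a < K)%N then c a else 0.
Proof.
rewrite /truncate raddf_sum/=; case: ltnP => [aK|Ka].
  rewrite (bigD1 (BMultinom aK))//= mcoeffZ mcoeffX eqxx mulr1 big1 ?addr0//.
  move=> b ba; rewrite mcoeffZ mcoeffX; case: eqP => [e|]; last by rewrite mulr0.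
  by case/eqP: ba; apply: val_inj.
rewrite big1// => b _; rewrite mcoeffZ mcoeffX; case: eqP => [ba|]; last by rewrite mulr0.
by have := bmdeg b; rewrite ba ltnNge Ka.
Qed.

Lemma meval_truncate n K c (w : 'I_n -> F) :
  meval w (truncate K c) =
  \sum_(a : bmultinom n K) c (bmnm a) * \prod_i w i ^+ (bmnm a : multinom n) i.
Proof.
by rewrite /truncate raddf_sum/=; apply: eq_bigr => a _; rewrite mevalZ mevalX.
Qed.

Local Notation qV := ((@resq R F)%:R^-1 : R).

(** Errors do not add up in an ultrametric space: all terms after u_j, and hence the limit, stay
    within the bound of the j-th step. *)
Lemma geometric_limit (u : nat -> F) B : 0 <= B ->
  (forall j, absv (u j.+1 - u j) <= B * qV ^+ j) ->
  exists l, forall j, absv (l - u j) <= B * qV ^+ j.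
Proof.
move=> B0 uB; have qV0 := ltW (@qV_gt0 R F); have qV1 := ltW (@qV_lt1 R F).
have step j i : absv (u (j + i)%N - u j) <= B * qV ^+ j.
  elim: i => [|i IHi]; first by rewrite addn0 subrr absv0 mulr_ge0 ?exprn_ge0.
  rewrite addnS -[u _.+1](subrK (u (j + i)%N)) -addrA; apply: absvD_le => //.
  by apply: (le_trans (uB _)); rewrite ler_wpM2l// ler_wiXn2l// leq_addr.
have small e : 0 < e -> exists N, forall j, (N <= j)%N -> B * qV ^+ j < e.
  move=> e0; have [|N NP] := @qVX_small R F (e / (B + 1)).
    by rewrite divr_gt0// ltr_wpDl.
  exists N => j Nj; have := NP j Nj; rewrite ltr_pdivlMr ?ltr_wpDl//.
  by apply: le_lt_trans; rewrite mulrC ler_wpM2l ?exprn_ge0// lerDl.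
have [e e0|l lP] := @absv_complete R F u.
  have [N NP] := small e e0; exists N => i j Ni Nj.
  wlog ij : i j Ni Nj / (i <= j)%N => [H|].
    by have [/H->//|/ltnW/H] := leqP i j; rewrite absvB_sym; apply.
  by rewrite absvB_sym -(subnKC ij) (le_lt_trans (step _ _))// NP.
exists l => j; rewrite leNgt; apply/negP => lj.
have [|N NP] := lP (absv (l - u j)).
  by apply: le_lt_trans lj; rewrite mulr_ge0 ?exprn_ge0.
have : absv (l - u j) < absv (l - u j).
  rewrite -{1}[l](subrK (u (j + N)%N)) -addrA.
  apply: (le_lt_trans (absvD _ _)); rewrite gt_max absvB_sym NP ?leq_addl//=.
  exact: le_lt_trans (step j N) lj.
by rewrite ltxx.
Qed.

(** Passage to the limit for estimates proved at each finite stage j, with an error that enters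
    through a maximum. *)
Lemma le_of_geometric (x y B : R) : 0 <= y ->
  (forall j, x <= Num.max (B * qV ^+ j) y) -> x <= y.
Proof.
move=> y0 xB; rewrite leNgt; apply/negP => yx.
have x0 : 0 < x by apply: le_lt_trans yx.
have xBj j : x <= B * qV ^+ j.
  by have := xB j; rewrite le_max => /orP[//|]; rewrite leNgt yx.
have B0 : 0 < B by have := xBj 0%N; rewrite expr0 mulr1; apply: lt_le_trans.
have [|j /(_ j (leqnn j))] := @qVX_small R F (x / B); first exact: divr_gt0.
by rewrite ltr_pdivlMr// mulrC ltNge xBj.
Qed.

(* Gauss limits of polynomials stand for the power series converging on the unit
   ball. *)
Definition gauss_limit n (B : R) (P : nat -> mpoly n F) (f : ('I_n -> F) -> F) :=
  [/\ 0 <= B, forall j, gauss B (P j),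
      forall j, gauss (B * qV ^+ j) (P j.+1 - P j) &
      forall j v, unit_ball v -> absv (f v - meval v (P j)) <= B * qV ^+ j].

Lemma gauss_limit_exists n B (P : nat -> mpoly n F) : 0 <= B ->
  (forall j, gauss B (P j)) -> (forall j, gauss (B * qV ^+ j) (P j.+1 - P j)) ->
  exists f, gauss_limit B P f.
Proof.
move=> B0 PB Pj; have qV0 := ltW (@qV_gt0 R F).
have /choice[f fP] : forall v : 'I_n -> F, exists l, unit_ball v ->
    forall j, absv (l - meval v (P j)) <= B * qV ^+ j.
  move=> v; have [v1|v1] := pselect (unit_ball v); last by exists 0.
  have [|l lP] := @geometric_limit (fun j => meval v (P j)) B B0; last by exists l.
  by move=> j; rewrite -mevalB; apply: meval_le => //; rewrite mulr_ge0 ?exprn_ge0.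
by exists f; split => // j v v1; apply: fP.
Qed.

Section GaussLimit.
Context (n : nat) (B : R) (P : nat -> mpoly n F) (f : ('I_n -> F) -> F).
Hypothesis fP : gauss_limit B P f.

Lemma gauss_limit_coef : exists c : multinom n -> F,
  (forall a, absv (c a) <= B) /\
  forall a j, absv (c a - mcoeff a (P j)) <= B * qV ^+ j.
Proof.
have [B0 PB Pj _] := fP; have qV0 := ltW (@qV_gt0 R F).
have /choice[c cP] : forall a, exists l, forall j,
    absv (l - mcoeff a (P j)) <= B * qV ^+ j.
  by move=> a; apply: geometric_limit => // j; rewrite -mcoeffB; apply: Pj.
exists c; split => // a; rewrite -[c a](subrK (mcoeff a (P 0%N))).
apply: absvD_le; last exact: PB.
by have := cP a 0%N; rewrite expr0 mulr1.
Qed.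

(** At stage j, the part of P_j of degree at least K contributes at most B e^K; replacing f by P_j,
    and its low coefficients by c, costs at most B / q^j. *)
Lemma gauss_limit_expansion (c : multinom n -> F) K (w : 'I_n -> F) e :
  (forall a j, absv (c a - mcoeff a (P j)) <= B * qV ^+ j) ->
  0 <= e <= 1 -> (forall i, absv (w i) <= e) ->
  absv (f w - meval w (truncate K c)) <= B * e ^+ K.
Proof.
have [B0 PB Pj fPj] := fP; have qV0 := ltW (@qV_gt0 R F).
move=> cP e01 we; have w1 : unit_ball w.
  by move=> i; apply: le_trans (we i) _; case/andP: e01.
apply: (@le_of_geometric _ _ B) => [|j].
  by case/andP: e01 => e0 _; rewrite mulr_ge0 ?exprn_ge0.
rewrite -[f w](subrK (meval w (P j))) -addrA; apply: absvD_le.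
  by rewrite le_max fPj.
pose r := truncate K (fun a => mcoeff a (P j)).
rewrite -[P j](subrK r) mevalD -addrA; apply: absvD_le.
  rewrite le_max; apply/orP; right; apply: meval_ordge_le => // a.
    rewrite mcoeffB mcoeff_truncate; case: ifP => _.
    by rewrite subrr absv0.
    by rewrite subr0; apply: PB.
  by move=> aK; rewrite mcoeffB mcoeff_truncate aK subrr.
rewrite -mevalB le_max; apply/orP; left; apply: meval_le => //.
  by rewrite mulr_ge0 ?exprn_ge0.
move=> a; rewrite mcoeffB !mcoeff_truncate; case: ifP => _.
  by rewrite absvB_sym.
by rewrite subrr absv0 mulr_ge0 ?exprn_ge0.
Qed.

Lemma gauss_limit_lip e v v' : 0 <= e -> unit_ball v -> unit_ball v' ->
  (forall i, absv (v i - v' i) <= e) -> absv (f v - f v') <= B * e.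
Proof.
have [B0 PB Pj fPj] := fP; have qV0 := ltW (@qV_gt0 R F).
move=> e0 v1 v'1 vv'; apply: (@le_of_geometric _ _ B) => [|j].
  exact: mulr_ge0.
rewrite -[f v](subrK (meval v (P j))) -addrA; apply: absvD_le.
  by rewrite le_max fPj.
rewrite -[meval v _](subrK (meval v' (P j))) -addrA; apply: absvD_le.
  by rewrite le_max; apply/orP; right; apply: meval_lip.
by rewrite absvB_sym le_max fPj.
Qed.

Lemma gauss_limit_shift v0 : unit_ball v0 ->
  gauss_limit B (fun j => psub (fun i => mpolyX F (mnm1 i) + mpolyC n (v0 i)) (P j))
    (fun w => f (fun i => w i + v0 i)).
Proof.
have [B0 PB Pj fPj] := fP; have qV0 := ltW (@qV_gt0 R F).
move=> v01.
have X1 i : gauss 1 (mpolyX F (mnm1 i) + mpolyC n (v0 i)).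
  by apply: gaussD; [exact: gaussX|exact: gaussC].
split => // [j|j|j w w1].
- exact: gauss_psub.
- by rewrite -psubB; apply: gauss_psub => //; rewrite mulr_ge0 ?exprn_ge0.
rewrite meval_psub (_ : (fun i => meval w _) = (fun i => w i + v0 i)).
  by apply: fPj => i; apply: absvD_le.
by apply/funext => i; rewrite mevalD mevalXU mevalC.
Qed.

End GaussLimit.

(** Kronecker substitution x_i = t^(s^i): as s exceeds all exponents, base s digits keep the
    monomials apart. The resulting polynomial in t cannot vanish at as many distinct powers of the
    uniformizer as its size. *)
Lemma meval_neq0 n (p : mpoly n F) : p != 0 ->
  exists2 v, unit_ball v & meval v p != 0.
Proof.
move=> p0; pose s := mmeasure mdeg p.
pose wt (a : multinom n) := (\sum_(i < n) a i * s ^ i)%N.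
have wt_inj (l : nat) (a b : 'I_l -> nat) : (forall i, a i < s)%N ->
    (forall i, b i < s)%N ->
    (\sum_(i < l) a i * s ^ i)%N = (\sum_(i < l) b i * s ^ i)%N -> a =1 b.
  elim: l a b => [|l IHl] a b aS bS; first by move=> _ [].
  have E (c : 'I_l.+1 -> nat) : (\sum_(i < l.+1) c i * s ^ i =
      (\sum_(i < l) c (lift ord0 i) * s ^ i) * s + c ord0)%N.
    rewrite big_ord_recl expn0 muln1 addnC big_distrl/=; congr (_ + _)%N.
    by apply: eq_bigr => i _; rewrite /bump/= add1n expnS -mulnA [(s * _)%N]mulnC.
  rewrite !E => ab.
  have s0 : (0 < s)%N by apply: leq_ltn_trans (aS ord0).
  have ab0 : a ord0 = b ord0.
    by have := congr1 (modn^~ s) ab; rewrite !modnMDl !modn_small.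
  have abl := congr1 (divn^~ s) ab; rewrite !divnMDl// !divn_small// !addn0 in abl.
  move=> i; case: (unliftP ord0 i) => [j ->|->] //.
  by apply: (IHl (fun i => a (lift ord0 i)) (fun i => b (lift ord0 i))).
pose g : {poly F} := \sum_(a <- msupp p) mcoeff a p *: 'X^(wt a).
have lt_s a i : a \in msupp p -> (a i < s)%N.
  move=> /msize_mdeg_lt; apply: leq_ltn_trans.
  by rewrite mdegE (bigD1 i)//= leq_addr.
have g0 : g != 0.
  apply/eqP => /(congr1 (fun h : {poly F} => h`_(wt (mlead p)))).
  rewrite coef0 /g coef_sum (bigD1_seq (mlead p)) ?msupp_uniq ?mlead_supp//=.
  rewrite coefZ coefXn eqxx mulr1 big_seq_cond big1 ?addr0.
    by apply/eqP; rewrite mleadc_eq0.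
  move=> a /andP[ap al]; rewrite coefZ coefXn; case: eqP => [wa|]; last by rewrite mulr0.
  case/eqP: al; apply/mnmP => i; apply/esym.
  by apply: (wt_inj _ _ _ _ _ wa) => j; apply: lt_s => //; apply: mlead_supp.
pose rs := [seq (unif : F) ^+ j | j <- iota 0 (size g)].
have [/allP rsg|] := boolP (all (root g) rs).
  have : (size rs < size g)%N.
    apply: max_poly_roots => //; rewrite ?map_inj_uniq ?iota_uniq//; first exact/allP.
    move=> i j /(congr1 (@absv R F)); rewrite !absv_unifX.
    by apply: ieexprIn; [exact: qV_gt0|rewrite lt_eqF// qV_lt1].
  by rewrite size_map size_iota ltnn.
rewrite -has_predC => /hasP[t /mapP[j _ tj]] /= gt0.
exists (fun i => t ^+ (s ^ i)).
  move=> i; rewrite tj -exprM absvX absv_unif.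
  by rewrite exprn_ile1 ?(ltW (@qV_gt0 R F)) ?(ltW (@qV_lt1 R F)).
apply: contraNN gt0 => /eqP pt; apply/rootP; rewrite -[RHS]pt mevalE horner_sum.
apply: eq_bigr => a _; rewrite hornerZ hornerXn; congr (_ * _).
rewrite /wt -prodrXr/=; apply: eq_bigr => i _.
by rewrite -exprM mulnC.
Qed.

End GaussNorm.

(** * The implicit function theorem *)

Section IdealCongruence.
Context (F : fieldType) (n k : nat) (I : set (mpoly k F)) (I_ideal : ideal_closed I).
Context (q q' : 'I_n -> mpoly k F) (qq' : forall i, I (q i - q' i)).

Lemma mmap1_congr a : I (mmap1 q a - mmap1 q' a).
Proof.
have [I0 ID IM] := I_ideal.
have step x y x' y' : I (x - y) -> I (x' - y') -> I (x * x' - y * y').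
  move=> xy xy'; rewrite -[x * x'](subrK (y * x')) -mulrBl -addrA -mulrBr.
  by apply: (ID); [exact: ideal_closedMr|exact: IM].
apply: (big_ind2 (fun x y => I (x - y))) => [|x y x' y'|i _].
- by rewrite subrr.
- exact: step.
elim: (a i) => [|j IHj]; first by rewrite !expr0 subrr.
by rewrite !exprS; apply: step.
Qed.

Lemma psub_congr p : I (psub q p - psub q' p).
Proof.
rewrite !psubE -sumrB; apply: ideal_closed_sum => // a _.
rewrite -scalerBr -mul_mpolyC; case: I_ideal => _ _; apply; exact: mmap1_congr.
Qed.

End IdealCongruence.

(** The ideal (h) plus the J-th power of the ideal of the origin; for the family indexed by [void],
    that power alone. *)
Definition adic_closure (F : fieldType) (N : nat) (K : finType) (h : K -> mpoly N F)
  (J : nat) : set (mpoly N F) :=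
  [set p | exists c : K -> mpoly N F, ordge J (p - \sum_k c k * h k)].

Section AdicClosure.
Context (F : fieldType) (N : nat) (K : finType) (h : K -> mpoly N F).

Lemma adic_closureP J p :
  adic_closure h J p <-> exists a b, [/\ p = a + b, ideal_of h a & ordge J b].
Proof.
split=> [[c pc]|[a [b [-> [c ->] bJ]]]]; last by exists c; rewrite addrAC subrr add0r.
exists (\sum_k c k * h k), (p - \sum_k c k * h k).
by split => //; [rewrite addrC subrK|exists c].
Qed.

Lemma adic_closure_ordge J p : ordge J p -> adic_closure h J p.
Proof.
move=> pJ; apply/adic_closureP; exists 0, p; split; rewrite ?add0r//.
by have [] := ideal_of_closed h.
Qed.

Lemma adic_closure_mem J k : adic_closure h J (h k).
Proof.
apply/adic_closureP; exists (h k), 0.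
by split; [rewrite addr0|exact: ideal_of_mem|exact: ordge_zero].
Qed.

Lemma adic_closure_ideal J : ideal_closed (adic_closure h J).
Proof.
have [h0 hD hM] := ideal_of_closed h.
split => [|x y /adic_closureP[a [b [-> ha bJ]]] /adic_closureP[a' [b' [-> ha' bJ']]]
  |x y /adic_closureP[a [b [-> ha bJ]]]].
- exact/adic_closure_ordge/ordge_zero.
- apply/adic_closureP; exists (a + a'), (b + b').
  by split; [rewrite addrACA|exact: hD|exact: ordgeD].
apply/adic_closureP; exists (x * a), (x * b).
by split; [rewrite mulrDr|exact: hM|exact: ordgeMl].
Qed.

Lemma adic_closureM_ordge J J' p q :
  ordge J p -> adic_closure h J' q -> adic_closure h (J + J') (p * q).
Proof.
move=> pJ /adic_closureP[a [b [-> ha bJ]]].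
apply/adic_closureP; exists (p * a), (p * b); split; first by rewrite mulrDr.
  by have [_ _] := ideal_of_closed h; apply.
exact: ordgeM.
Qed.

(** In a monomial of degree at least 2, the difference of one factor is multiplied by another factor
    of order at least 1, whence the gain of one order. *)
Lemma psub_adic_congr n (q q' : 'I_n -> mpoly N F) J p : ordge 2 p ->
  (forall i, ordge 1 (q i)) -> (forall i, ordge 1 (q' i)) ->
  (forall i, adic_closure h J (q i - q' i)) ->
  adic_closure h J.+1 (psub q p - psub q' p).
Proof.
move=> p2 q1 q'1 qq'; have hI := adic_closure_ideal.
rewrite !psubE -sumrB; apply: (ideal_closed_sum (hI _)) => a _.
rewrite -scalerBr -mul_mpolyC.
have [a2|a2] := ltnP (mdeg a) 2; first by rewrite p2// mpolyC0 mul0r; case: (hI J.+1).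
case: (hI J.+1) => _ hD hM; apply: (hM).
have [i ai] : exists i, a i != 0%N.
  apply/existsP; rewrite -negb_forall; apply: contraL a2 => /forallP a0.
  by rewrite mdegE big1// => i _; apply/eqP.
have aE : a = mpoly.mnm_add (mpoly.mnm_sub a (mnm1 i)) (mnm1 i).
  by rewrite submK// lep1mP.
move: (mpoly.mnm_sub a _) aE => b aE; rewrite aE !mmap1D !mmap1U.
have b1 : (1 <= mdeg b)%N by move: a2; rewrite aE mdegD mdeg1 addn1.
rewrite -[_ * q i](subrK (mmap1 q b * q' i)) -mulrBr -addrA -mulrBl; apply: hD.
  by rewrite -add1n; apply: adic_closureM_ordge => //; apply/(ordgeW b1)/ordge_mmap1.
rewrite mulrC -add1n; apply: adic_closureM_ordge => //.
exact: mmap1_congr.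
Qed.

End AdicClosure.

Definition joinv (A : Type) n m (y : 'I_n -> A) (z : 'I_m -> A) (i : 'I_(n + m)) : A :=
  match fintype.split i with inl j => y j | inr j => z j end.

Lemma joinv_lshift (A : Type) n m (y : 'I_n -> A) (z : 'I_m -> A) i :
  joinv y z (lshift m i) = y i.
Proof. by rewrite /joinv (unsplitK (inl i : 'I_n + 'I_m)). Qed.

Lemma joinv_rshift (A : Type) n m (y : 'I_n -> A) (z : 'I_m -> A) i :
  joinv y z (rshift n i) = z i.
Proof. by rewrite /joinv (unsplitK (inr i : 'I_n + 'I_m)). Qed.

Lemma joinv_ind (A : Type) n m (y : 'I_n -> A) (z : 'I_m -> A) (P : A -> Prop) :
  (forall i, P (y i)) -> (forall i, P (z i)) -> forall i, P (joinv y z i).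
Proof. by move=> Py Pz i; rewrite /joinv; case: fintype.split. Qed.

Lemma joinv_ind2 (A : Type) n m (y y' : 'I_n -> A) (z z' : 'I_m -> A)
    (P : A -> A -> Prop) :
  (forall i, P (y i) (y' i)) -> (forall i, P (z i) (z' i)) ->
  forall i, P (joinv y z i) (joinv y' z' i).
Proof. by move=> Py Pz i; rewrite /joinv; case: fintype.split. Qed.

Lemma joinv_map (A B : Type) n m (y : 'I_n -> A) (z : 'I_m -> A) (f : A -> B) :
  (fun i => f (joinv y z i)) = joinv (f \o y) (f \o z).
Proof. by apply/funext => i; rewrite /joinv; case: fintype.split. Qed.

Section ImplicitFunction.
Context {R : realType} {F : nonArchLocalFieldType R} (n m : nat).
Local Notation qV := ((@resq R F)%:R^-1 : R).
Context (Phi : 'I_m -> mpoly (n + m) F).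
Hypothesis Phi_gauss : forall i, gauss qV (Phi i).
Hypothesis Phi_ord : forall i, ordge 2 (Phi i).

Let yvar (i : 'I_n) : mpoly n F := mpolyX F (mnm1 i).

(** Picard iteration for z = Phi(y, z). It contracts twice: by 1/q in Gauss norm, because of the
    bound on Phi, and by one order of vanishing per step, because Phi has order 2. *)
Fixpoint picard (j : nat) : 'I_m -> mpoly n F :=
  if j is j'.+1 then fun i => psub (joinv yvar (picard j')) (Phi i) else fun=> 0.

Let picardS j i : picard j.+1 i = psub (joinv yvar (picard j)) (Phi i).
Proof. by []. Qed.

Let qV0 : 0 <= qV. Proof. exact/ltW/qV_gt0. Qed.
Let qV1 : qV <= 1. Proof. exact/ltW/qV_lt1. Qed.

Lemma picard_gauss j i : gauss qV (picard j i).
Proof.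
elim: j i => [|j IHj] i /=; first exact: gauss0.
apply: gauss_psub => // k; apply: joinv_ind k => k; first exact: gaussX.
exact: gaussW (IHj k).
Qed.

Let picard_gauss1 j i : gauss 1 (joinv yvar (picard j) i).
Proof.
apply: joinv_ind i => i; first exact: gaussX.
exact/(gaussW qV1)/picard_gauss.
Qed.

Lemma picard_step j i : gauss (qV * qV ^+ j) (picard j.+1 i - picard j i).
Proof.
elim: j i => [|j IHj] i; first by rewrite expr0 mulr1 subr0; apply: picard_gauss.
rewrite (picardS j.+1) (picardS j) exprS;
  apply: (proj2 (@gauss_psub_lip _ _ _ _ _ _ _ _ _ _ _ _ _ _ (Phi_gauss i))).
- by rewrite mulr_ge0// exprn_ge0.
- by [].
- exact: picard_gauss1.
- exact: picard_gauss1.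
move=> k; apply: (joinv_ind2 (P := fun x y => gauss (qV * qV ^+ j) (x - y))) k => k.
  by rewrite subrr; apply: gauss0; rewrite mulr_ge0// exprn_ge0.
exact: IHj.
Qed.

Lemma picard_ordge1 j i : ordge 1 (picard j i).
Proof.
elim: j i => [|j IHj] i /=; first exact: ordge_zero.
apply: ordge_psub => [k|]; last exact: ordgeW (Phi_ord i).
by apply: joinv_ind k => k //; have := @ordgeX F n (mnm1 k); rewrite mdeg1.
Qed.

Let joinv_picard_ordge1 j i : ordge 1 (joinv yvar (picard j) i).
Proof.
apply: joinv_ind i => i; last exact: picard_ordge1.
by have := @ordgeX F n (mnm1 i); rewrite mdeg1.
Qed.

Lemma picard_step_ordge j i : ordge j.+1 (picard j.+1 i - picard j i).
Proof.
elim: j i => [|j IHj] i; first by rewrite subr0; apply: picard_ordge1.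
pose h (x : void) : mpoly n F := match x with end.
have clos J p : adic_closure h J p -> ordge J p.
  move=> [c]; rewrite big1 ?subr0// => -[].
rewrite (picardS j.+1) (picardS j); apply: clos; apply: psub_adic_congr => //.
move=> k; apply: (joinv_ind2 (P := fun x y => adic_closure h j.+1 (x - y))) k => k.
  by rewrite subrr; apply/adic_closure_ordge/ordge_zero.
exact/adic_closure_ordge/IHj.
Qed.

Lemma picard_stable j l p a : (mdeg a <= j)%N -> (j <= l)%N ->
  mcoeff a (psub (joinv yvar (picard l)) p) = mcoeff a (psub (joinv yvar (picard j)) p).
Proof.
move=> aj /subnKC <-; elim: (l - j)%N => [|i IHi]; first by rewrite addn0.
rewrite -IHi addnS; apply/eqP; rewrite -subr_eq0 -mcoeffB; apply/eqP.
have := @psub_congr F _ _ _ (adic_closure_ideal (fun x : void =>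
  match x with end) (j + i).+1)
  (joinv yvar (picard (j + i).+1)) (joinv yvar (picard (j + i))) _ p.
case => [k|c]; last first.
  by rewrite big1 ?subr0 => [|[]//]; apply; rewrite ltnS (leq_trans aj)// leq_addr.
apply: (joinv_ind2 (P := fun x y => adic_closure _ _ (x - y))) k => k.
  by rewrite subrr; apply/adic_closure_ordge/ordge_zero.
exact/adic_closure_ordge/picard_step_ordge.
Qed.

Let zeq (i : 'I_m) : mpoly (n + m) F := mpolyX F (mnm1 (rshift n i)) - Phi i.

(** Modulo z = Phi, each z_i may be replaced by its j-th iterate with an error of order j + 1, which
    eliminates z from p. *)
Lemma picard_reduction j p :
  adic_closure zeq j.+1
    (p - psub (fun i => mpolyX F (mnm1 (lshift m i)))
           (psub (joinv yvar (picard j)) p)).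
Proof.
pose yv i : mpoly (n + m) F := mpolyX F (mnm1 (lshift m i)).
have varge1 N (i : 'I_N) : ordge 1 (mpolyX F (mnm1 i)).
  by have := @ordgeX F N (mnm1 i); rewrite mdeg1.
have sub1 l i : ordge 1 (joinv yv (psub yv \o picard l) i).
  apply: joinv_ind i => i; first exact: varge1.
  by apply: ordge_psub; [move=> k; exact: varge1|exact: picard_ordge1].
have subE l : (fun i => psub yv (joinv yvar (picard l) i)) =
    joinv yv (psub yv \o picard l).
  rewrite joinv_map; congr joinv; apply/funext => i /=.
  exact: psubXU.
have zP l i : adic_closure zeq l.+1
    (mpolyX F (mnm1 (rshift n i)) - psub yv (picard l i)).
  elim: l i => [|l IHl] i.
    by rewrite /= rmorph0 subr0; apply: adic_closure_ordge; apply: varge1.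
  rewrite /= psub_comp subE.
  rewrite -[mpolyX _ _](subrK (Phi i)) -addrA.
  case: (adic_closure_ideal zeq l.+2) => _ hD _; apply: (hD).
    exact: (adic_closure_mem zeq l.+2 i).
  rewrite -{1}[Phi i]psub_id.
  apply: psub_adic_congr => //.
  move=> k; rewrite -[k]splitK; case: (fintype.split k) => k' /=.
    rewrite joinv_lshift subrr; apply: adic_closure_ordge; exact: ordge_zero.
  by rewrite joinv_rshift; apply: IHl.
rewrite psub_comp subE -[p in X in X - _]psub_id.
apply: (psub_congr (adic_closure_ideal _ _)) => k.
rewrite -[k]splitK; case: (fintype.split k) => k' /=.
  by rewrite joinv_lshift subrr; apply/adic_closure_ordge/ordge_zero.
by rewrite joinv_rshift; apply: zP.
Qed.

Lemma picard_limit : exists zeta : 'I_m -> ('I_n -> F) -> F,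
  forall i, gauss_limit qV (picard^~ i) (zeta i).
Proof.
have /choice[z zP] : forall i, exists z, gauss_limit qV (picard^~ i) z.
  move=> i; apply: gauss_limit_exists => // j; first exact: picard_gauss.
  exact: picard_step.
by exists z.
Qed.

Context (zeta : 'I_m -> ('I_n -> F) -> F).
Hypothesis zetaP : forall i, gauss_limit qV (picard^~ i) (zeta i).

Definition graph (y : 'I_n -> F) : 'I_(n + m) -> F := joinv y (zeta^~ y).

Lemma zeta_le y i : unit_ball y -> absv (zeta i y) <= qV.
Proof.
by have [_ _ _ /(_ 0%N y)] := zetaP i; rewrite /= meval0 subr0 expr0 mulr1.
Qed.

Lemma graph_unit_ball y : unit_ball y -> unit_ball (graph y).
Proof.
move=> y1 i; apply: (@joinv_ind F n m _ _ (fun x => absv x <= 1)) i => i.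
  exact: y1.
exact: le_trans (zeta_le i y1) qV1.
Qed.

Lemma meval_graph_limit p B : 0 <= B -> gauss B p ->
  gauss_limit B (fun j => psub (joinv yvar (picard j)) p) (fun y => meval (graph y) p).
Proof.
move=> B0 pB; split => // [j|j|j y y1].
- exact: gauss_psub.
- apply: (proj2 (@gauss_psub_lip _ _ _ _ _ _ _ _ _ _ _ _ _ _ pB)) => //;
    try exact: exprn_ge0; move=> k.
  apply: (joinv_ind2 (P := fun x y => gauss (qV ^+ j) (x - y))) k => k.
    by rewrite subrr; apply: gauss0; rewrite exprn_ge0.
  apply: gaussW (picard_step j k).
  by rewrite ler_piMl// exprn_ge0.
have evj : (fun i => meval y (joinv yvar (picard j) i)) =
    joinv y (fun k => meval y (picard j k)).
  rewrite joinv_map; congr joinv; apply/funext => i /=.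
  exact: mevalXU.
have e0 : 0 <= qV ^+ j by apply: exprn_ge0.
have g1 := graph_unit_ball y1.
have p1 : unit_ball (joinv y (fun k => meval y (picard j k))).
  move=> k; apply: (@joinv_ind F n m _ _ (fun x => absv x <= 1)) k => k //.
  by apply: (le_trans _ qV1); apply: meval_le => //; exact: picard_gauss.
rewrite meval_psub evj; apply: meval_lip => // k.
apply: (joinv_ind2 (P := fun x y => absv (x - y) <= qV ^+ j)) k => k.
  by rewrite subrr absv0 exprn_ge0.
have [_ _ _ /(_ j y y1)] := zetaP k.
by move=> /le_trans; apply; rewrite ler_piMl// exprn_ge0.
Qed.

Lemma zeta_fixed y i : unit_ball y -> zeta i y = meval (graph y) (Phi i).
Proof.
move=> y1; apply/eqP; rewrite -subr_eq0; apply/eqP/absv_eq0/eqP.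
rewrite eq_le absv_ge0 andbT; apply: (@le_of_geometric _ F _ _ 1) => // j.
rewrite le_max mul1r; apply/orP; left.
rewrite -[zeta i y](subrK (meval y (picard j.+1 i))) -addrA; apply: absvD_le.
  have [_ _ _ /(_ j.+1 y y1)/le_trans] := zetaP i; apply.
  by rewrite exprS mulrA ler_piMl ?exprn_ge0// -expr2 exprn_ile1.
rewrite absvB_sym.
have [_ _ _ /(_ j y y1)/le_trans] := meval_graph_limit qV0 (Phi_gauss i); apply.
by rewrite ler_piMl ?exprn_ge0.
Qed.

(** The contraction by 1/q brings any solution over y within q^(-j) of zeta(y) for all j. *)
Lemma zeta_unique y z : unit_ball y -> unit_ball z ->
  (forall i, z i = meval (joinv y z) (Phi i)) -> z = zeta^~ y.
Proof.
move=> y1 z1 zP.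
have close j i : absv (z i - zeta i y) <= qV ^+ j.
  elim: j i => [|j IHj] i.
    rewrite expr0; apply: absvB_le => //.
    exact: le_trans (zeta_le i y1) qV1.
  have e0 : 0 <= qV ^+ j by apply: exprn_ge0.
  have g1 := graph_unit_ball y1.
  have p1 : unit_ball (joinv y z).
    by move=> k; apply: (@joinv_ind F n m _ _ (fun x => absv x <= 1)) k.
  rewrite zP zeta_fixed// exprS; apply: meval_lip => // k.
  apply: (joinv_ind2 (P := fun x y => absv (x - y) <= qV ^+ j)) k => k //.
  by rewrite subrr absv0 exprn_ge0.
apply/funext => i; apply/eqP; rewrite -subr_eq0; apply/eqP/absv_eq0/eqP.
rewrite eq_le absv_ge0 andbT; apply: (@le_of_geometric _ F _ _ 1) => // j.
by rewrite le_max mul1r close.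
Qed.

End ImplicitFunction.

(** * Sublevel sets on lines *)

Section SublevelSets.
Context {R : realType} {F : nonArchLocalFieldType R}.
Local Notation qV := ((@resq R F)%:R^-1 : R).

(* Each division by a factor t - s costs a factor 1/delta and lowers k by 1. *)
Lemma divided_differences (g : {poly F}) k (c : F) (eta delta eps : R) (ts : seq F) :
  0 < delta -> 0 <= eta < absv c -> size ts = k.+1 ->
  (forall t, t \in ts -> absv t <= 1) ->
  pairwise (fun x y => delta <= absv (x - y)) ts ->
  (forall t, t \in ts -> absv (g.[t]) <= eps) ->
  absv (g`_k - c) <= eta -> (forall j, (k < j)%N -> absv g`_j <= eta) ->
  absv c * delta ^+ k <= eps.
Proof.
move=> d0 /andP[eta0 etac]; elim: k g eps ts => [|k IHk] g eps [//|s ts].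
  case: ts => // _ s1 _ gs gk gj; rewrite expr0 mulr1.
  have [s1' gs'] := (s1 s (mem_head _ _), gs s (mem_head _ _)).
  have cg : absv (c + (g.[s] - c)) = absv c.
    apply: absvDl; apply: le_lt_trans etac.
    rewrite horner_coef; case E : (size g) => [|n].
      by rewrite big_ord0; move: gk; rewrite nth_default ?E.
    rewrite big_ord_recl expr0 mulr1 addrAC; apply: absvD_le => //.
    apply: absv_sum_le => // i _; rewrite absvM -[eta]mulr1 ler_pM ?absv_ge0 ?gj//.
    by rewrite absvX exprn_ile1 ?absv_ge0.
  by rewrite -cg addrC subrK.
move=> [sz] ts1 /= /andP[/allP sts pts] gts gk gj.
have [s1 gs] := (ts1 s (mem_head _ _), gts s (mem_head _ _)).
have [g1 gE] : exists g1, g - (g.[s])%:P = g1 * ('X - s%:P).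
  by apply/factor_theorem/rootP; rewrite hornerD hornerN hornerC subrr.
have coefE i : g`_i.+1 = g1`_i - s * g1`_i.+1.
  have := congr1 (fun p : {poly F} => p`_i.+1) gE.
  rewrite coefB coefC subr0 => ->.
  by rewrite mulrBr coefB coefMX/= coefMC mulrC.
(* Descending induction, starting beyond the degree of the quotient. *)
have g1j i : (k < i)%N -> absv g1`_i <= eta.
  have [u] := ubnP (size g1 - i)%N; elim: u i => // u IHu i; rewrite ltnS => iu ki.
  have [gi|ig] := leqP (size g1) i; first by rewrite nth_default// absv0.
  rewrite (_ : g1`_i = g`_i.+1 + s * g1`_i.+1); last by rewrite coefE subrK.
  apply: absvD_le; first by apply: gj; rewrite ltnS.
  rewrite absvM -[eta]mul1r ler_pM ?absv_ge0// IHu ?(leqW ki)//.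
  by apply: leq_trans iu; rewrite subnS prednK ?subn_gt0.
rewrite exprS mulrCA -ler_pdivlMl// [leRHS]mulrC.
apply: (IHk g1 _ ts) => // [t tts|t tts|].
- by apply: ts1; rewrite inE tts orbT.
- have := congr1 (fun p : {poly F} => p.[t]) gE.
  rewrite hornerD hornerN hornerC hornerM hornerXsubC => gt.
  rewrite ler_pdivlMr//; apply: (@le_trans _ _ (absv (g1.[t] * (t - s)))).
    by rewrite absvM ler_wpM2l ?absv_ge0// absvB_sym sts.
  by rewrite -gt; apply: absvB_le => //; apply: gts; rewrite inE tts orbT.
rewrite (_ : g1`_k = g`_k.+1 + s * g1`_k.+1); last by rewrite coefE subrK.
rewrite addrAC; apply: absvD_le => //.
by rewrite absvM -[eta]mul1r ler_pM ?absv_ge0// g1j.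
Qed.

Definition line_poly n (b : F) (w v : 'I_n -> F) (p : mpoly n F) : {poly F} :=
  mmap polyC (fun i => b *: ((w i)%:P + v i *: 'X)) p.

Lemma line_polyE n b (w v : 'I_n -> F) p t :
  (line_poly b w v p).[t] = meval (fun i => b * (w i + t * v i)) p.
Proof.
rewrite /line_poly /mmap mevalE horner_sum; apply: eq_bigr => a _.
rewrite hornerM hornerC /mmap1 horner_prod; congr (_ * _).
apply: eq_bigr => i _; rewrite horner_exp hornerZ hornerD hornerC hornerZ hornerX.
by rewrite [t * _]mulrC.
Qed.

Let line_monomial n b (w v : 'I_n -> F) (a : multinom n) :
  unit_ball w -> unit_ball v ->
  let p := mmap1 (fun i => b *: ((w i)%:P + v i *: 'X)) a in
  [/\ (size p <= (mdeg a).+1)%N,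
      p`_(mdeg a) = b ^+ mdeg a * \prod_i v i ^+ a i &
      forall j, absv p`_j <= absv b ^+ mdeg a].
Proof.
move=> w1 v1; rewrite /mmap1 mdegE /=.
pose good (p : {poly F}) (l : nat) (x : F) := [/\ (size p <= l.+1)%N,
  p`_l = b ^+ l * x & forall j, absv p`_j <= absv b ^+ l].
have good1 : good 1 0%N 1.
  split; rewrite ?size_poly1 ?coef1 ?mulr1// => j.
  by rewrite coef1; case: (j == 0%N); rewrite ?absv1 ?absv0 ?ler01.
have goodM p l x p' l' x' : good p l x -> good p' l' x' ->
    good (p * p') (l + l')%N (x * x').
  move=> [sp pl pb] [sp' pl' pb']; split => [||j].
  - apply: (leq_trans (size_polyMleq _ _)); rewrite -ltnS.
    apply: (@leq_trans (l.+1 + l'.+1)); last by rewrite addSn addnS.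
    by case: (size p + size p')%N (leq_add sp sp').
  - rewrite coefM.
    have lt : (l < (l + l').+1)%N by rewrite ltnS leq_addr.
    rewrite (bigD1 (Ordinal lt))//= addKn pl pl' exprD mulrACA big1 ?addr0// => i il.
    have [lti|] := ltnP (val i) l.
      rewrite [p'`__]nth_default ?mulr0// (leq_trans sp')//.
      by rewrite ltn_subRL ltn_add2r.
    rewrite leq_eqVlt => /predU1P[li|li]; last first.
      by rewrite nth_default ?mul0r// (leq_trans sp).
    by case/eqP: il; apply: val_inj.
  rewrite coefM; apply: absv_sum_le => [|i _]; first by rewrite exprn_ge0 ?absv_ge0.
  by rewrite absvM exprD ler_pM ?absv_ge0.
have goodL i : good (b *: ((w i)%:P + v i *: 'X)) 1%N (v i).
  split => [||j].
  - apply: (leq_trans (size_scale_leq _ _)); apply: (leq_trans (size_polyD _ _)).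
    rewrite geq_max (leq_trans (size_polyC_leq1 _))//=.
    by rewrite (leq_trans (size_scale_leq _ _))// size_polyX.
  - by rewrite coefZ coefD coefC/= add0r coefZ coefX/= mulr1 expr1.
  rewrite coefZ absvM expr1 ler_piMr ?absv_ge0// coefD coefC coefZ coefX.
  case: j => [|[|j]] /=; rewrite ?mulr0 ?mulr1 ?addr0 ?add0r//.
  by rewrite absv0 ler01.
suff : good (\prod_(i < n) (b *: ((w i)%:P + v i *: 'X)) ^+ a i)
    (\sum_i a i)%N (\prod_(i < n) v i ^+ a i) by [].
apply: (big_rec3 (fun x l p => good p l x)) => // i x l p _ IH.
apply: (goodM) => //; elim: (a i) => [|j IHj]; first by rewrite !expr0.
by rewrite !exprS -add1n; apply: (goodM).
Qed.

(** A monomial of degree k gives b^k times its value at v in degree k, and nothing beyond; one of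
    larger degree carries a factor b^(k + 1). *)
Lemma line_poly_coefs n b (w v : 'I_n -> F) (p : mpoly n F) k (B : R) :
  unit_ball w -> unit_ball v -> 0 <= B -> absv b <= 1 ->
  gauss B p -> ordge k p ->
  absv ((line_poly b w v p)`_k -
     b ^+ k * \sum_(a <- msupp p | mdeg a == k) mcoeff a p * \prod_i v i ^+ a i)
    <= B * absv b ^+ k.+1 /\
  forall j, (k < j)%N -> absv (line_poly b w v p)`_j <= B * absv b ^+ k.+1.
Proof.
move=> w1 v1 B0 b1 pB pk.
have rhs0 : 0 <= B * absv b ^+ k.+1 by rewrite mulr_ge0 ?exprn_ge0 ?absv_ge0.
have bound a j : mdeg a != k ->
    absv (mcoeff a p * (mmap1 (fun i => b *: ((w i)%:P + v i *: 'X)) a)`_j)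
      <= B * absv b ^+ k.+1.
  move=> ak; have [ka|ak'] := ltnP k (mdeg a); last first.
    by rewrite pk ?mul0r ?absv0// ltn_neqAle ak.
  have [_ _ /(_ j) bj] := line_monomial b a w1 v1.
  rewrite absvM ler_pM ?absv_ge0// (le_trans bj)//.
  by rewrite ler_wiXn2l ?absv_ge0.
rewrite /line_poly /mmap; split => [|j kj]; rewrite coef_sum.
  rewrite (bigID (fun a => mdeg a == k))/= addrAC mulr_sumr -sumrB big1 ?add0r.
    by apply: absv_sum_le => // a ak; rewrite coefCM; apply: bound.
  move=> a /eqP ak; rewrite coefCM; have [_ + _] := line_monomial b a w1 v1.
  by rewrite ak => ->; rewrite mulrCA subrr.
apply: absv_sum_le => // a _; rewrite coefCM.
have [ak|ak] := eqVneq (mdeg a) k; last exact: bound.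
have [sz _ _] := line_monomial b a w1 v1.
by rewrite [X in _ * X]nth_default ?mulr0 ?absv0// (leq_trans sz)// ak.
Qed.

Definition form_at n k (p : mpoly n F) (v : 'I_n -> F) : F :=
  \sum_(a <- msupp p | mdeg a == k) mcoeff a p * \prod_i v i ^+ a i.

Lemma form_at_homogeneous n k (p : mpoly n F) : (forall a, mdeg a != k -> mcoeff a p = 0) ->
  forall v, form_at k p v = meval v p.
Proof.
move=> pk v; rewrite mevalE /form_at big_mkcond; apply: eq_bigr => a _.
by case: eqP => // /eqP ak; rewrite pk// mul0r.
Qed.

(** The expansions with l digits in the uniformizer: two of them differ at a digit of index below
    l. *)
Lemma separated_points l : exists (T : finType) (p : T -> F),
  [/\ #|T| = ((@resq R F) ^ l)%N, forall x, absv (p x) <= 1 &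
      forall x y, x != y -> qV ^+ l < absv (p x - p y)].
Proof.
have [rep [rep1 repP]] := @resfield R F.
elim: l => [|l [T [p [cT p1 pT]]]].
  exists unit, (fun=> 0); split => [||x y].
  - by rewrite card_unit expn0.
  - by move=> _; rewrite absv0 ler01.
  - by case: x; case: y.
exists ('I_(@resq R F) * T)%type, (fun x => rep x.1 + unif * p x.2); split.
- by rewrite card_prod card_ord cT expnS.
- move=> x; apply: absvD_le => //; rewrite absvM absv_unif.
  by rewrite mulr_ile1 ?absv_ge0// ltW// ?qV_gt0// qV_lt1.
move=> [i x] [j y]; rewrite xpair_eqE negb_and /= => ij.
have [ijE|nij] := eqVneq i j.
  rewrite ijE eqxx/= in ij; rewrite ijE opprD addrACA subrr add0r -mulrBr.
  by rewrite absvM absv_unif exprS ltr_pM2l ?qV_gt0// pT.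
have rep_ij : absv (rep i - rep j) = 1.
  apply/eqP; rewrite eq_le absvB_le//= leNgt; apply/negP => lt1.
  case/eqP: nij; have [i' [_ uniq]] := repP (rep i) (rep1 i).
  by rewrite -(uniq i) ?subrr ?absv0 ?ltr01// -(uniq j).
rewrite opprD addrACA -mulrBr absvDl rep_ij.
  by rewrite exprn_ilt1 ?qV_lt1 ?(ltW (@qV_gt0 R F)).
rewrite absvM absv_unif; apply: le_lt_trans (@qV_lt1 R F).
by rewrite ler_piMr ?(ltW (@qV_gt0 R F))// absvB_le.
Qed.

Section LowestForm.
Context (n : nat) (B : R) (P : nat -> mpoly n F) (f : ('I_n -> F) -> F).
Hypothesis fP : gauss_limit B P f.
Context (c : multinom n -> F).
Hypothesis c_le : forall a, absv (c a) <= B.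
Hypothesis cP : forall a j, absv (c a - mcoeff a (P j)) <= B * qV ^+ j.

Let B0 : 0 <= B. Proof. by case: fP. Qed.

(** Otherwise the form Q of least degree is non-zero at some v, and f(t v) equals t^k Q(v) up to B
    |t|^(k + 1), which is non-zero for small t. *)
Lemma coef0_of_vanishing r : 0 < r ->
  (forall v, (forall i, absv (v i) <= r) -> f v = 0) -> forall a, c a = 0.
Proof.
move=> r0 f0 a; apply: contrapT => /eqP ca.
have [k [b /andP[/eqP bk cb]] kmin] : exists2 k, exists b, (mdeg b == k) && (c b != 0) &
    forall b, (mdeg b < k)%N -> c b = 0.
  have exk : exists k, `[< exists b, (mdeg b == k) && (c b != 0) >].
    by exists (mdeg a); apply/asboolP; exists a; rewrite eqxx.
  case: (ex_minnP exk) => k /asboolP kP kmin; exists k => // b bk.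
  apply/eqP; apply: contraLR bk => cb; rewrite -leqNgt; apply: kmin.
  by apply/asboolP; exists b; rewrite eqxx.
pose Q := truncate k.+1 c.
have Qk d : mdeg d != k -> mcoeff d Q = 0.
  by move=> dk; rewrite mcoeff_truncate ltnS leq_eqVlt (negPf dk)/=; case: ifP => // /kmin.
have Q0 : Q != 0.
  by apply: contraNneq cb => /(congr1 (mcoeff b));
    rewrite mcoeff_truncate bk ltnSn mcoeff0 => ->.
have [v v1 Qv] := meval_neq0 Q0.
have Qhom t : meval (fun i => t * v i) Q = t ^+ k * meval v Q.
  rewrite !mevalE mulr_sumr big_seq [RHS]big_seq; apply: eq_bigr => d.
  rewrite mcoeff_msupp => dQ; have dk : mdeg d = k.
    by apply/eqP; apply: contraNT dQ => /Qk ->.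
  rewrite mulrCA; congr (_ * _); rewrite -dk mdegE -prodrXr -big_split/=.
  by apply: eq_bigr => i _; rewrite exprMn.
have [t t0] : exists2 t : F, t != 0 &
    absv t < Num.min 1 (Num.min r (absv (meval v Q) / (B + 1))).
  apply: exists_small; rewrite !lt_min ltr01 r0 divr_gt0 ?absv_gt0//.
  by rewrite ltr_wpDl.
rewrite !lt_min => /and3P[/ltW t1 /ltW tr tQ].
have tv i : absv (t * v i) <= absv t by rewrite absvM ler_piMr ?absv_ge0.
have := @gauss_limit_expansion _ _ _ _ _ _ fP c k.+1 (fun i => t * v i) (absv t) cP.
rewrite absv_ge0 t1 => /(_ isT tv); rewrite f0; last first.
  by move=> i; rewrite (le_trans (tv i)).
rewrite sub0r absvN -/Q Qhom absvM absvX exprSr mulrCA ler_pM2l ?exprn_gt0 ?absv_gt0//.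
rewrite leNgt => /negP; apply.
move: tQ; rewrite ltr_pdivlMr ?ltr_wpDl//; apply: le_lt_trans.
by rewrite mulrC ler_wpM2l ?absv_ge0// lerDl.
Qed.

Context (k : nat).
Hypothesis c_low : forall b, (mdeg b < k)%N -> c b = 0.
Context (b : multinom n).
Hypotheses (bk : mdeg b = k) (cb : c b != 0).

Let Q := truncate k.+1 c.

Let Qk d : mdeg d != k -> mcoeff d Q = 0.
Proof.
by move=> dk; rewrite mcoeff_truncate ltnS leq_eqVlt (negPf dk)/=; case: ifP => // /c_low.
Qed.

(** [Q] is the form of least degree of the series. For the second bound, f on the line is replaced
    by a truncation whose error is below eps. After division by beta^k, its coefficient of degree k
    is within B |beta| of Q(v) and the later ones are at most B |beta|, as [divided_differences]
    requires. *)
Lemma lowest_form : exists2 Q : mpoly n F, Q != 0 &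
  forall v x, unit_ball v -> x = meval v Q ->
  (forall t, absv t <= 1 ->
    absv (f (fun i => t * v i) - t ^+ k * x) <= B * absv t ^+ k.+1) /\
  (forall beta w (ts : seq F) delta eps, absv beta < 1 -> B * absv beta < absv x ->
    unit_ball w ->
    0 < delta -> 0 < eps -> beta != 0 ->
    size ts = k.+1 -> (forall t, t \in ts -> absv t <= 1) ->
    pairwise (fun x y => delta <= absv (x - y)) ts ->
    (forall t, t \in ts -> absv (f (fun i => beta * (w i + t * v i))) <= eps) ->
    absv x * absv beta ^+ k * delta ^+ k <= eps).
Proof.
have Q0 : Q != 0.
  by apply: contraNneq cb => /(congr1 (mcoeff b));
    rewrite mcoeff_truncate bk ltnSn mcoeff0 => ->.
exists Q => // v x v1 ->{x}; split =>
  [t t1|beta w ts delta eps beta1 Bbeta w1 d0 e0 beta0 sz ts1 pts fts].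
  have Qhom : meval (fun i => t * v i) Q = t ^+ k * meval v Q.
    rewrite !mevalE mulr_sumr big_seq [RHS]big_seq; apply: eq_bigr => d.
    rewrite mcoeff_msupp => dQ; have dk : mdeg d = k.
      by apply/eqP; apply: contraNT dQ => /Qk ->.
    rewrite mulrCA; congr (_ * _); rewrite -dk mdegE -prodrXr -big_split/=.
    by apply: eq_bigr => i _; rewrite exprMn.
  rewrite -Qhom.
  have := @gauss_limit_expansion _ _ _ _ _ _ fP c k.+1 (fun i => t * v i) (absv t) cP.
  rewrite absv_ge0 t1 => /(_ isT); apply => i.
  by rewrite absvM ler_piMr ?absv_ge0.
have beta_gt0 : 0 < absv beta by rewrite absv_gt0.
have [K kK BK] : exists2 K, (k < K)%N & B * absv beta ^+ K <= eps.
  have := @cvg_expr R (absv beta); rewrite ger0_norm ?absv_ge0// => /(_ beta1).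
  have eB : 0 < eps / (B + 1) by rewrite divr_gt0// ltr_wpDl.
  move=> /cvgr0Pnorm_lt /(_ _ eB) [j _ jP]; exists (j + k.+1)%N.
    by rewrite addnS ltnS leq_addl.
  have := jP (j + k.+1)%N (leq_addr _ _).
  rewrite /= ger0_norm ?exprn_ge0 ?absv_ge0// ltr_pdivlMr ?ltr_wpDl// => /ltW.
  by apply: le_trans; rewrite mulrC ler_wpM2l ?exprn_ge0 ?absv_ge0// lerDl.
pose p := truncate K c.
have pB : gauss B p.
  by move=> a; rewrite mcoeff_truncate; case: ifP => // _; rewrite absv0.
have pk : ordge k p.
  by move=> a ak; rewrite mcoeff_truncate c_low//; case: ifP.
have pQ : form_at k p v = meval v Q.
  rewrite -(form_at_homogeneous Qk) /form_at -big_filter -[RHS]big_filter.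
  have supp a : mdeg a = k -> mcoeff a p = mcoeff a Q.
    by move=> ak; rewrite !mcoeff_truncate ak kK ltnSn.
  have perm : perm_eq [seq a <- msupp p | mdeg a == k] [seq a <- msupp Q | mdeg a == k].
    apply: uniq_perm; rewrite ?filter_uniq ?msupp_uniq// => a.
    by rewrite !mem_filter; case: eqP => //= /supp ak; rewrite !mcoeff_msupp ak.
  rewrite (perm_big _ perm)/= !big_filter; apply: eq_bigr => a /eqP ak.
  by rewrite supp.
have [] := line_poly_coefs w1 v1 B0 (ltW beta1) pB pk.
rewrite -/(form_at k p v) pQ => gk gj.
pose g := (beta ^+ k)^-1 *: line_poly beta w v p.
have bk0 : beta ^+ k != 0 by rewrite expf_neq0.
have abk : absv (beta ^+ k)^-1 = (absv beta ^+ k)^-1 by rewrite absvV absvX.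
rewrite mulrAC -ler_pdivlMr ?exprn_gt0// [leRHS]mulrC.
apply: (@divided_differences g k (meval v Q) (B * absv beta) delta _ ts) => //.
- by rewrite mulr_ge0 ?absv_ge0.
- move=> t tts; rewrite /g hornerZ absvM abk ler_pM2l ?invr_gt0 ?exprn_gt0//.
  rewrite line_polyE.
  have := @gauss_limit_expansion _ _ _ _ _ _ fP c K
    (fun i => beta * (w i + t * v i)) (absv beta) cP.
  rewrite absv_ge0 ltW// => /(_ isT) H.
  rewrite -[meval _ _](subKr (f (fun i => beta * (w i + t * v i)))).
  apply: absvB_le; first exact: fts.
  apply: le_trans (H _) BK => i.
  rewrite absvM ler_piMr ?absv_ge0//; apply: absvD_le => //.
  by rewrite absvM mulr_ile1 ?absv_ge0// ts1.
- rewrite /g coefZ -[X in _ - X](mulKf bk0) -mulrBr absvM abk.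
  by rewrite ler_pdivrMl ?exprn_gt0// mulrCA -exprSr.
move=> j kj; rewrite /g coefZ absvM abk.
by rewrite ler_pdivrMl ?exprn_gt0// mulrCA -exprSr gj.
Qed.

End LowestForm.

End SublevelSets.

(** * The local model of a smooth variety *)

Definition affine_sub (F : fieldType) N (x0 : 'I_N -> F) (T : 'M[F]_N) (i : 'I_N) :
    mpoly N F :=
  mpolyC N (x0 i) + \sum_j T j i *: mpolyX F (mnm1 j).

Section Affine.
Context (F : fieldType) (N : nat).

Lemma meval_affine_sub (x0 : 'I_N -> F) T (w : 'I_N -> F) i :
  meval w (affine_sub x0 T i) = x0 i + \sum_j w j * T j i.
Proof.
rewrite mevalD mevalC raddf_sum/=; congr (_ + _); apply: eq_bigr => j _.
by rewrite mevalZ mevalXU mulrC.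
Qed.

Lemma msize_affine_sub (x0 : 'I_N -> F) T i : (mmeasure mdeg (affine_sub x0 T i) <= 2)%N.
Proof.
apply: (leq_trans (msizeD_le _ _)); rewrite geq_max; apply/andP; split.
  by rewrite msizeC; case: (_ != _).
apply: (leq_trans (msize_sum _ _ _)); apply/bigmax_leqP => j _.
by apply: (leq_trans (msizeZ_le _ _)); rewrite msizeX mdeg1.
Qed.

Definition affine_inv (x0 : 'I_N -> F) (T : 'M[F]_N) : 'I_N -> mpoly N F :=
  affine_sub (fun i => - \sum_j x0 j * invmx T j i) (invmx T).

Let affine_sub_comp (x0 y0 : 'I_N -> F) (S T : 'M[F]_N) i : S *m T = 1%:M ->
  (forall j, y0 j = - \sum_l x0 l * S l j) ->
  psub (affine_sub y0 S) (affine_sub x0 T i) = mpolyX F (mnm1 i).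
Proof.
move=> ST y0E; have STE k : \sum_j S k j * T j i = (k == i)%:R.
  by have /matrixP/(_ k i) := ST; rewrite !mxE.
have E1 : \sum_j T j i *: mpolyC N (y0 j) = - mpolyC N (x0 i).
  under eq_bigr do rewrite -mul_mpolyC -rmorphM/= y0E mulrN mulr_sumr.
  rewrite -rmorph_sum -rmorphN/= sumrN exchange_big/=; congr (mpolyC _ (- _)).
  under eq_bigr do under eq_bigr do rewrite mulrCA [T _ _ * _]mulrC.
  under eq_bigr do rewrite -mulr_sumr STE.
  rewrite (bigD1 i)//= eqxx mulr1 big1 ?addr0// => l /negPf ->.
  by rewrite mulr0.
have E2 : \sum_j T j i *: \sum_k S k j *: mpolyX F (mnm1 k) = mpolyX F (mnm1 i).
  under eq_bigr do rewrite scaler_sumr.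
  rewrite exchange_big/=.
  under eq_bigr do under eq_bigr do rewrite scalerA mulrC.
  under eq_bigr do rewrite -scaler_suml STE.
  rewrite (bigD1 i)//= eqxx scale1r big1 ?addr0// => l /negPf ->.
  by rewrite scale0r.
rewrite {2}/affine_sub psubD psubC psub_sum.
under eq_bigr do rewrite psubZ psubXU scalerDr.
by rewrite big_split/= E1 E2 addrA subrr add0r.
Qed.

Lemma affine_subK (x0 : 'I_N -> F) (T : 'M[F]_N) : T \in unitmx ->
  cancel (psub (affine_sub x0 T)) (psub (affine_inv x0 T)).
Proof.
move=> Tu p; rewrite psub_comp -[RHS]psub_id; apply: eq_psub => i.
by apply: affine_sub_comp => //; rewrite mulVmx.
Qed.

Lemma affine_invK (x0 : 'I_N -> F) (T : 'M[F]_N) : T \in unitmx ->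
  cancel (psub (affine_inv x0 T)) (psub (affine_sub x0 T)).
Proof.
move=> Tu p; rewrite psub_comp -[RHS]psub_id; apply: eq_psub => i.
apply: affine_sub_comp => [|j]; first by rewrite mulmxV.
under [in RHS]eq_bigr do rewrite mulNr mulr_suml.
rewrite sumrN opprK exchange_big/=.
have TTE l : \sum_k invmx T l k * T k j = (l == j)%:R.
  by have /matrixP/(_ l j) := mulVmx Tu; rewrite !mxE.
under eq_bigr do under eq_bigr do rewrite -mulrA.
under eq_bigr do rewrite -mulr_sumr TTE.
rewrite (bigD1 j)//= eqxx mulr1 big1 ?addr0// => l /negPf ->.
by rewrite mulr0.
Qed.

Lemma mcoeff0_psub k (q : 'I_N -> mpoly k F) p :
  mcoeff mnm0 (psub q p) = meval (fun i => mcoeff mnm0 (q i)) p.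
Proof.
rewrite psubE mevalE raddf_sum/=; apply: eq_bigr => a _.
rewrite mcoeffZ /mmap1 rmorph_prod/=; congr (_ * _).
by apply: eq_bigr => i _; rewrite rmorphXn.
Qed.

Lemma mcoeff1M k (p q : mpoly k F) j :
  mcoeff (mnm1 j) (p * q) =
  mcoeff (mnm1 j) p * mcoeff mnm0 q + mcoeff mnm0 p * mcoeff (mnm1 j) q.
Proof.
have split0 (r : mpoly k F) : ordge 1 (r - mpolyC k (mcoeff mnm0 r)).
  by apply: ordge1P; rewrite mcoeffB mcoeffC eqxx mulr1 subrr.
have := ordgeM (split0 p) (split0 q) (_ : (mdeg (mnm1 j) < 2)%N).
rewrite mdeg1 => /(_ isT); rewrite mulrBr !mulrBl -rmorphM/= !mcoeffB mcoeffCM.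
rewrite [p * mpolyC _ _]mulrC !mcoeffCM mcoeffC mnm1_eq0 mulr0 subr0.
move=> /eqP; rewrite subr_eq add0r subr_eq => /eqP ->.
by rewrite [_ * mcoeff mnm0 q]mulrC addrC.
Qed.

(** The chain rule at the origin. Both sides are linear in p and obey the Leibniz rule at x0, so it
    is enough to check constants and variables. *)
Lemma mcoeff1_affine (x0 : 'I_N -> F) T p j :
  mcoeff (mnm1 j) (psub (affine_sub x0 T) p) = \sum_l meval x0 (mderiv l p) * T j l.
Proof.
have D0 q : mcoeff mnm0 (psub (affine_sub x0 T) q) = meval x0 q.
  rewrite mcoeff0_psub; apply: meval_eq => i.
  rewrite mcoeffD mcoeffC eqxx mulr1 raddf_sum/= big1 ?addr0// => l _.
  by rewrite mcoeffZ mcoeffX mnm1_eq0 mulr0.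
pose good q := mcoeff (mnm1 j) (psub (affine_sub x0 T) q) =
  \sum_l meval x0 (mderiv l q) * T j l.
have goodC c : good (mpolyC N c).
  rewrite /good psubC mcoeffC mnm1_eq0 mulr0 big1// => l _.
  by rewrite mderivC meval0 mul0r.
have goodD q r : good q -> good r -> good (q + r).
  rewrite /good psubD mcoeffD => -> ->; rewrite -big_split; apply: eq_bigr => l _.
  by rewrite mderivD mevalD mulrDl.
have goodM q r : good q -> good r -> good (q * r).
  rewrite /good psubM mcoeff1M !D0 => -> ->.
  rewrite mulr_suml mulr_sumr -big_split; apply: eq_bigr => l _ /=.
  by rewrite mderivM mevalD !mevalM mulrDl mulrAC mulrA.
have goodX i : good (mpolyX F (mnm1 i)).
  rewrite /good psubXU /affine_sub mcoeffD mcoeffC mnm1_eq0 mulr0 add0r.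
  rewrite raddf_sum/= (bigD1 j)//= mcoeffZ mcoeffXU eqxx mulr1 big1 ?addr0.
    rewrite (bigD1 i)//= mderivX mevalZ mnm1E eqxx mul1r.
    rewrite [mpoly.mnm_sub _ _](_ : _ = mnm0); last first.
      by apply/mnmP => l; rewrite mnmBE mnm0E subnn.
    rewrite mpolyX0 meval1 mul1r big1 ?addr0// => l li.
    by rewrite mderivX mevalZ mnm1E eq_sym (negPf li) !mul0r.
  by move=> l lj; rewrite mcoeffZ mcoeffXU (negPf lj) mulr0.
suff : good p by [].
rewrite [p]mpolyE; apply: (big_ind good); [|exact: goodD|move=> a _].
  by rewrite -mpolyC0; apply: goodC.
rewrite -mul_mpolyC; apply: (goodM) => //.
rewrite mpolyXE_id; apply: (big_ind good); [|exact: goodM|move=> i _].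
  by rewrite -mpolyC1; apply: goodC.
elim: (a i) => [|l IHl]; first by rewrite expr0 -mpolyC1; apply: goodC.
by rewrite exprS; apply: (goodM).
Qed.

Definition scale_sub (b : F) (i : 'I_N) : mpoly N F := b *: mpolyX F (mnm1 i).

Lemma mcoeff_scale_sub b p a :
  mcoeff a (psub (scale_sub b) p) = b ^+ mdeg a * mcoeff a p.
Proof.
have mon d : mmap1 (scale_sub b) d = b ^+ mdeg d *: mpolyX F d.
  rewrite /mmap1 mdegE mpolyXE_id -prodrXr; apply: (big_rec3 (fun x y z => x = z *: y)).
    by rewrite scale1r.
  move=> i x y z _ ->; rewrite /scale_sub exprZn.
  by rewrite -scalerAl -scalerAr scalerA.
rewrite psubE raddf_sum/= [in RHS](mpolyE p) raddf_sum/= mulr_sumr.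
apply: eq_bigr => d _; rewrite mon !mcoeffZ mcoeffX; case: eqP => [->|_].
  by rewrite mulrCA.
by rewrite !mulr0.
Qed.

Lemma affine_sub_scale (x0 : 'I_N -> F) (T : 'M[F]_N) b p :
  psub (scale_sub b) (psub (affine_sub x0 T) p) = psub (affine_sub x0 (b *: T)) p.
Proof.
rewrite psub_comp; apply: eq_psub => i.
rewrite /affine_sub psubD psubC psub_sum; congr (_ + _); apply: eq_bigr => j _.
by rewrite psubZ psubXU mxE scalerA mulrC.
Qed.

End Affine.

Lemma row_free_completion (F : fieldType) n m (A : 'M[F]_(m, n + m)) : row_free A ->
  exists C : 'M[F]_(n, n + m), col_mx C A \in unitmx.
Proof.
move=> Af; have rC : \rank (A^C)%MS = n.
  by rewrite mxrank_compl (eqP Af) addnK.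
exists (castmx (rC, erefl) (row_base (A^C)%MS)).
rewrite -row_full_unit -sub1mx -addsmxE.
have : (1%:M <= A + A^C)%MS by rewrite sub1mx addsmx_compl_full.
move=> /submx_trans; apply; rewrite addsmxC; apply: addsmxS => //.
by rewrite eqmx_cast eq_row_base.
Qed.

Lemma evaluation_prime (F : fieldType) N (x : 'I_N -> F) :
  exists P : prime_idealr (mpoly N F), forall p, (p \in P) <-> meval x p = 0.
Proof.
apply: exists_prime_idealr => /=.
- split => [|p q p0 q0|a p p0]; first by rewrite meval0.
    by rewrite mevalD p0 q0 addr0.
  by rewrite mevalM p0 mulr0.
- by rewrite meval1; apply/eqP; rewrite oner_eq0.
move=> p q; rewrite mevalM => /eqP; rewrite mulf_eq0.
by case/orP => /eqP; [left|right].
Qed.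

Lemma prime_idealr_closed_ideal (A : comNzRingType) (P : prime_idealr A) :
  ideal_closed (fun x => x \in P).
Proof.
split => [|x y|a x]; [exact: rpred0|exact: rpredD|by move=> xP;
  rewrite ring_quotient.idealMr].
Qed.

Lemma mdeg_le1 N (a : multinom N) : (mdeg a < 2)%N ->
  a = mnm0 \/ exists j, a = mnm1 j.
Proof.
rewrite ltnS leq_eqVlt => /orP[|]; last by rewrite ltnS leqn0 mdeg_eq0 => /eqP; left.
by rewrite mdeg_eq1 => /existsP[j /eqP ->]; right; exists j.
Qed.

(** The Jacobian of the local equations h_i at x0 has rank m and completes to an invertible matrix;
    in the corresponding coordinates h_i has linear part z_i. The dilation w -> b w followed by
    division by b multiplies the terms of degree l by b^(l - 1), which makes the non-linear part
    small. *)
Lemma local_model {R : realType} {F : nonArchLocalFieldType R} (n m : nat)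
    (g : 'I_m -> mpoly (n + m) F) (x0 : 'I_(n + m) -> F) :
  smooth_of_dim (zero_locus (range g)) -> (forall j, meval x0 (g j) = 0) ->
  exists (T : 'M[F]_(n + m)) (Phi hh : 'I_m -> mpoly (n + m) F),
  [/\ T \in unitmx,
      forall i, gauss (@resq R F)%:R^-1 (Phi i) /\ ordge 2 (Phi i),
      forall i, psub (affine_sub x0 T) (hh i) =
        mpolyX F (mnm1 (rshift n i)) - Phi i,
      forall i, vanishing_ideal (zero_locus (range g)) (hh i) &
      forall w, unit_ball w ->
        (forall i, w (rshift n i) = meval w (Phi i)) ->
        forall j, meval w (psub (affine_sub x0 T) (g j)) = 0].
Proof.
move=> smooth gx0.
have [P0 P0P] := evaluation_prime x0.
have XP0 : zero_locus (range g) P0 by move=> _ [j _ <-]; apply/P0P.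
have [h [hV hgen hind]] := smooth P0 XP0.
pose Jh := \matrix_(i < m, l < n + m) meval x0 (mderiv l (h i)).
have Jfree : row_free Jh.
  rewrite -kermx_eq0; apply/rowV0P => v /sub_kermxP vJ.
  apply/rowP => i; rewrite mxE.
  have vP l : \sum_i mpolyC (n + m) (v 0 i) * mderiv l (h i) \in P0.
    apply/P0P; have /rowP/(_ l) := vJ; rewrite !mxE => vJl; apply: etrans vJl.
    rewrite raddf_sum/=; apply: eq_bigr => i' _.
    by rewrite mevalM mevalC mxE.
  by have /P0P := hind _ vP i; rewrite mevalC.
have [C Su] := row_free_completion Jfree.
pose V := invmx (col_mx C Jh)^T.
have VJ j i : \sum_l meval x0 (mderiv l (h i)) * V j l = (j == rshift n i)%:R.
  have : V *m (col_mx C Jh)^T = 1%:M by rewrite mulVmx// unitmx_tr.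
  move=> /matrixP/(_ j (rshift n i)); rewrite !mxE => <-.
  by apply: eq_bigr => l _; rewrite mxE col_mxEd mxE mulrC.
pose H i := psub (affine_sub x0 V) (h i).
have H0 i : mcoeff mnm0 (H i) = 0.
  rewrite mcoeff0_psub -[RHS](P0P (h i)).1; last exact: hV.
  apply: meval_eq => l; rewrite mcoeffD mcoeffC eqxx mulr1 raddf_sum/= big1 ?addr0//.
  by move=> j _; rewrite mcoeffZ mcoeffX mnm1_eq0 mulr0.
have H1 i j : mcoeff (mnm1 j) (H i) = (j == rshift n i)%:R by rewrite mcoeff1_affine VJ.
(* The multipliers u_j will carry vanishing from the h_i back to the g_j, wherever u_j is
   non-zero. *)
have /choice[u uP] : forall j, exists u, meval x0 u <> 0 /\ ideal_of h (u * g j).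
  move=> j; have [|u [c [uP0 ugc]]] := hgen (g j); first by move=> P; apply; exists j.
  by exists u; split; [move=> /P0P ux; rewrite ux in uP0|exists c].
pose U j := psub (affine_sub x0 V) (u j).
have U0 j : mcoeff mnm0 (U j) = meval x0 (u j).
  rewrite mcoeff0_psub; apply: meval_eq => l.
  rewrite mcoeffD mcoeffC eqxx mulr1 raddf_sum/= big1 ?addr0//.
  by move=> i _; rewrite mcoeffZ mcoeffX mnm1_eq0 mulr0.
have U0_gt0 j : 0 < absv (mcoeff mnm0 (U j)).
  by rewrite absv_gt0 U0; apply/eqP; case: (uP j).
have qV0 := @qV_gt0 R F; set qV := _^-1 in qV0.
have small B e : 0 <= B -> 0 < e -> exists a0, forall a, (a0 <= a)%N -> B * qV ^+ a < e.
  move=> B0 e0; have [|a0 a0P] := @qVX_small R F (e / (B + 1)).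
    by rewrite divr_gt0// ltr_wpDl.
  exists a0 => a a0a; have := a0P a a0a; rewrite ltr_pdivlMr ?ltr_wpDl//.
  by apply: le_lt_trans; rewrite mulrC ler_wpM2l ?exprn_ge0 ?(ltW qV0)// lerDl.
have /choice[a1 a1P] : forall i, exists a0, forall a, (a0 <= a)%N ->
    gauss (qV * (qV ^+ a)^-1) (H i).
  move=> i; have [B B0 HB] := gauss_exists (H i).
  have [a0 a0P] := small B qV B0 qV0; exists a0 => a a0a.
  by apply: gaussW HB; rewrite ler_pdivlMr ?exprn_gt0// ltW// a0P.
have /choice[a2 a2P] : forall j, exists a0, forall a, (a0 <= a)%N ->
    exists2 B, gauss B (U j) & 0 <= B /\ B * qV ^+ a < absv (mcoeff mnm0 (U j)).
  move=> j; have [B B0 UB] := gauss_exists (U j).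
  by have [a0 a0P] := small B _ B0 (U0_gt0 j); exists a0 => a a0a; exists B => //;
    split => //; apply: a0P.
(* Large enough for two purposes: Phi gets Gauss norm at most 1/q, and the constant term of each U_j
   dominates on the dilated unit ball, so that u_j has no zero there. *)
pose a := (\max_i a1 i + \max_j a2 j)%N.
have a1a i : (a1 i <= a)%N by rewrite /a (leq_trans _ (leq_addr _ _))// (bigD1 i)//=
  leq_maxl.
have a2a i : (a2 i <= a)%N by rewrite /a (leq_trans _ (leq_addl _ _))// (bigD1 i)//=
  leq_maxl.
pose b : F := unif ^+ a.
have b0 : b != 0 by rewrite expf_neq0// unif_neq0.
have bE : absv b = qV ^+ a by rewrite absv_unifX.
have b1 : absv b <= 1 by rewrite bE exprn_ile1 ?(ltW qV0)// ltW// qV_lt1.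
pose Phi i := mpolyX F (mnm1 (rshift n i)) - b^-1 *: psub (scale_sub b) (H i).
have Phi_coef i al : mcoeff al (Phi i) =
    (mnm1 (rshift n i) == al)%:R - b^-1 * (b ^+ mdeg al * mcoeff al (H i)).
  by rewrite mcoeffB mcoeffX mcoeffZ mcoeff_scale_sub.
have Phi2 i : ordge 2 (Phi i).
  move=> al /mdeg_le1[->|[j ->]]; rewrite Phi_coef.
    by rewrite H0 !mulr0 mnm1_eq0 subr0.
  rewrite H1 mdeg1 expr1 mulKf//.
  by rewrite eq_mnm1 eq_sym subrr.
have scaleE p : psub (affine_sub x0 (b *: V)) p = psub (scale_sub b) (psub
  (affine_sub x0 V) p).
  by rewrite affine_sub_scale.
exists (b *: V), Phi, (fun i => b^-1 *: h i).
have hhE i : psub (affine_sub x0 (b *: V)) (b^-1 *: h i) =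
    mpolyX F (mnm1 (rshift n i)) - Phi i.
  by rewrite psubZ scaleE /Phi opprB addrC subrK.
split => // [|i|i P XP|w w1 wPhi j].
- by rewrite unitmxZ ?unitfE// unitmx_inv unitmx_tr.
- split => // al; have [al2|al2] := ltnP (mdeg al) 2.
    by rewrite Phi2// absv0 ltW.
  rewrite Phi_coef; case: eqP al2 => [<-|_ al2]; first by rewrite mdeg1.
  rewrite sub0r absvN -(subnKC (ltnW al2)) exprD expr1 -mulrA mulKf// absvM absvX.
  have := a1P i a (a1a i) al; rewrite ler_pdivlMr ?exprn_gt0//.
  apply: le_trans; rewrite mulrC -bE ler_wpM2l ?absv_ge0//.
  by rewrite -[leRHS]expr1 ler_wiXn2l ?absv_ge0// subn_gt0.
- by rewrite -mul_mpolyC; have [_ _] := prime_idealr_closed_ideal P; apply; apply: hV.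
have hw i : meval w (psub (affine_sub x0 (b *: V)) (h i)) = 0.
  have := congr1 (meval w) (hhE i); rewrite psubZ mevalZ mevalB mevalXU wPhi subrr.
  by move=> /eqP; rewrite mulf_eq0 invr_eq0 (negPf b0) => /eqP.
have [_ [c ugc]] := uP j.
have : meval w (psub (affine_sub x0 (b *: V)) (u j * g j)) = 0.
  rewrite ugc psub_sum (raddf_sum (meval w)) big1// => i _.
  by rewrite /= psubM mevalM hw mulr0.
rewrite psubM mevalM => /eqP; rewrite mulf_eq0 => /orP[|/eqP//].
suff : absv (meval w (psub (affine_sub x0 (b *: V)) (u j))) != 0.
  by move=> /eqP + /eqP uw; rewrite uw absv0.
rewrite gt_eqF//; have [B UB [B0 BU]] := a2P j a (a2a j).
rewrite scaleE -/(U j).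
rewrite -[psub _ _](subrK (mpolyC _ (mcoeff mnm0 (U j)))) mevalD mevalC addrC.
rewrite absvDl//; apply: le_lt_trans BU; apply: meval_le => //.
  by rewrite mulr_ge0// exprn_ge0// ltW.
move=> al; rewrite mcoeffB mcoeff_scale_sub mcoeffC.
have [->|al0] := eqVneq al mnm0.
  by rewrite mdeg0 expr0 mul1r mulr1 subrr absv0 mulr_ge0 ?exprn_ge0// ltW.
rewrite mulr0 subr0 absvM absvX -bE mulrC; apply: ler_pM; rewrite ?exprn_ge0 ?absv_ge0//.
by rewrite -[leRHS]expr1 ler_wiXn2l ?absv_ge0// lt0n mdeg_eq0.
Qed.

(** * The order of a restricted polynomial *)

Lemma ideal_closed_mulrn (A : comNzRingType) (I : set A) x k :
  ideal_closed I -> I x -> I (x *+ k).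
Proof. by move=> [_ _ IM] Ix; rewrite -mulr_natl; apply: IM. Qed.

Lemma ideal_closed_exp (A : comNzRingType) (I : set A) x j k :
  ideal_closed I -> (j <= k)%N -> I (x ^+ j) -> I (x ^+ k).
Proof. by move=> II /subnKC <- Ix; rewrite exprD; apply: ideal_closedMr. Qed.

(** In each term of the binomial expansion, one of the two exponents is large enough. *)
Lemma ideal_exp_sum (A : comNzRingType) (I : set A) (T : Type) (r : seq T)
    (x : T -> A) e : ideal_closed I -> (forall t, I (x t ^+ e)) ->
  I ((\sum_(t <- r) x t) ^+ (size r * e).+1).
Proof.
move=> II xe; elim: r => [|t r IHr]; first by rewrite big_nil expr1; case: II.
rewrite big_cons /= mulSn -addnS; move: IHr; set y := \sum_(_ <- _) _.
set N := (size r * e).+1 => yN.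
rewrite exprDn; apply: ideal_closed_sum => // i _; apply: ideal_closed_mulrn => //.
have [iN|Ni] := ltnP i N; last first.
  by case: (II) => _ _; apply; apply: ideal_closed_exp Ni yN.
apply: ideal_closedMr => //; apply: ideal_closed_exp (xe t) => //.
by rewrite -addnBA ?leq_addr// ltnW.
Qed.

Section Etale.
Context {R : realType} {F : nonArchLocalFieldType R} (m : nat).
Local Notation qV := ((@resq R F)%:R^-1 : R).
Context (h : 'I_m -> mpoly m F).
Hypothesis h1 : forall i, ordge 1 (h i).
Hypothesis hA : forall i l, absv (mcoeff (mnm1 l) (mpolyX F (mnm1 i) - h i)) <= qV.

Let Mx := \matrix_(i, l) mcoeff (mnm1 l) (h i).

(** Modulo the maximal ideal this is the identity: a kernel vector is its own image under a matrix
    of norm at most 1/q, impossible at a coordinate of largest absolute value. *)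
Let Mx_unit : Mx \in unitmx.
Proof.
rewrite -row_free_unit -kermx_eq0; apply/rowV0P => v /sub_kermxP vM.
apply/rowP => i; rewrite mxE; apply: contrapT => /eqP vi.
have [l _ lmax] := @arg_maxP _ _ _ i xpredT (fun i => absv (v 0 i)) isT.
have vl : 0 < absv (v 0 l) by apply: lt_le_trans (lmax i isT); rewrite absv_gt0.
have : absv (v 0 l) <= qV * absv (v 0 l).
  have vlE : v 0 l = \sum_j v 0 j * mcoeff (mnm1 l) (mpolyX F (mnm1 j) - h j).
    under eq_bigr do rewrite mcoeffB mulrBr mcoeffXU.
    rewrite sumrB [X in _ - X](_ : _ = 0); last first.
      have /rowP/(_ l) := vM; rewrite !mxE => vMl; apply: etrans vMl.
      by apply: eq_bigr => j _; rewrite mxE.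
    rewrite subr0 (bigD1 l)//= eqxx mulr1 big1 ?addr0// => j /negPf ->.
    by rewrite mulr0.
  rewrite {1}vlE; apply: absv_sum_le => [|j _].
    by rewrite mulr_ge0 ?absv_ge0// ltW// qV_gt0.
  by rewrite absvM mulrC ler_pM ?absv_ge0//; apply: lmax.
by rewrite -{1}[absv (v 0 l)]mul1r ler_pM2r// leNgt qV_lt1.
Qed.

Let var_adic i : adic_closure h 2 (mpolyX F (mnm1 i)).
Proof.
exists (fun l => mpolyC m (invmx Mx i l)) => a /mdeg_le1[->|[k ->]];
  rewrite mcoeffB raddf_sum/=.
  rewrite mcoeffX mnm1_eq0 sub0r big1 ?oppr0// => l _.
  by rewrite mcoeffCM h1 ?mulr0// mdeg0.
rewrite mcoeffXU; have /matrixP/(_ i k) := mulVmx Mx_unit; rewrite !mxE => <-.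
by apply/eqP; rewrite subr_eq0; apply/eqP/eq_bigr => l _; rewrite mcoeffCM mxE.
Qed.

(** As the linear parts of the h_i form a basis, each variable is in (h) up to order 2; the error is
    then pushed to higher order step by step. *)
Lemma etale_adic J p : ordge 1 p -> adic_closure h J p.
Proof.
have step j q : (0 < j)%N -> ordge j q -> adic_closure h j.+1 q.
  move=> j0 qj; rewrite [q]mpolyE.
  apply: (ideal_closed_sum (adic_closure_ideal h j.+1)) => a _.
  have [aj|ja] := ltnP (mdeg a) j.
    by rewrite qj// scale0r; apply/adic_closure_ordge/ordge_zero.
  case: (adic_closure_ideal h j.+1) => _ hD hM; rewrite -mul_mpolyC; apply: (hM).
  have [i ai] : exists i, a i != 0%N.
    apply/existsP; rewrite -negb_forall; apply: contraL (leq_trans j0 ja).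
    move=> /forallP a0.
    by rewrite mdegE big1// => i _; apply/eqP.
  have aE : a = mpoly.mnm_add (mpoly.mnm_sub a (mnm1 i)) (mnm1 i).
    by rewrite submK// lep1mP.
  move: (mpoly.mnm_sub a _) aE => b aE; rewrite aE mpolyXD.
  have [x [y [-> hx y2]]] := (adic_closureP h 2 _).1 (var_adic i).
  rewrite mulrDr; apply: hD.
    apply/(adic_closureP h); exists (mpolyX F b * x), 0; split; rewrite ?addr0//.
      by case: (ideal_of_closed h) => _ _; apply.
    exact: ordge_zero.
  apply: adic_closure_ordge; apply: (@ordgeW _ _ _ (mdeg b + 2)).
    by move: ja; rewrite aE mdegD mdeg1 addn1 addn2 ltnS.
  by apply: ordgeM => //; apply: ordgeX.
move=> p1; case: J => [|J]; first exact: adic_closure_ordge.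
elim: J => [|J IHJ]; first exact: adic_closure_ordge.
have [x [y [-> hx yJ]]] := (adic_closureP h J.+1 _).1 IHJ.
case: (adic_closure_ideal h J.+2) => _ hD _; apply: hD; last exact: step.
apply/(adic_closureP h); exists x, 0; split; rewrite ?addr0//.
exact: ordge_zero.
Qed.

(** Up to order J a variable is a combination of the m functions h_l, so its power of exponent m e +
    1 lies in (f). A monomial of degree above m (m e + 1) contains such a power. *)
Lemma etale_sop (f : 'I_m -> mpoly m F) e : (forall i, ideal_of f (h i ^+ e)) ->
  forall J p, ordge (m * (m * e).+1).+1 p ->
    exists a : 'I_m -> mpoly m F, ordge J (p - \sum_i a i * f i).
Proof.
move=> he J p pe; suff : adic_closure f J p by [].
have fI := adic_closure_ideal f J; have [f0 fD fM] := fI.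
have var1 (i : 'I_m) : ordge 1 (mpolyX F (mnm1 i)).
  by have := @ordgeX F m (mnm1 i); rewrite mdeg1.
have /choice[c cP] := fun i => etale_adic J (var1 i).
pose eta i := \sum_l c i l * h l.
rewrite -[p]psub_id -[psub _ p](subrK (psub eta p)); apply: (fD).
  by apply: (psub_congr fI) => i; apply/adic_closure_ordge/cP.
rewrite psubE; apply: (ideal_closed_sum fI) => a _.
have [aj|ja] := ltnP (mdeg a) (m * (m * e).+1).+1.
  by rewrite pe// scale0r.
rewrite -mul_mpolyC; apply: (fM).
have [i ai] : exists i, ((m * e).+1 <= a i)%N.
  apply/existsP; apply: contraLR ja; rewrite negb_exists => /forallP am.
  rewrite -ltnNge ltnS mdegE -[X in (_ <= X * _)%N]card_ord -sum_nat_const.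
  by apply: leq_sum => i _; have := am i; rewrite -ltnNge => /ltnW.
rewrite /mmap1 (bigD1 i)//=; apply: (ideal_closedMr fI).
apply: (ideal_closed_exp fI ai).
have := @ideal_exp_sum _ _ _ (index_enum 'I_m) (fun l => c i l * h l) e fI.
rewrite [size _](_ : _ = m); last first.
  by rewrite -[index_enum _]enumT size_enum_ord.
apply => l; rewrite exprMn; apply: fM; apply/(adic_closureP f).
by exists (h l ^+ e), 0; split; [rewrite addr0|exact: he|exact: ordge_zero].
Qed.

End Etale.

Section LocalModel.
Context {R : realType} {F : nonArchLocalFieldType R} (n m : nat).
Local Notation qV := ((@resq R F)%:R^-1 : R).
Context (g : 'I_m -> mpoly (n + m) F) (x0 : 'I_(n + m) -> F).
Context (T : 'M[F]_(n + m)) (Phi hh : 'I_m -> mpoly (n + m) F).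
Hypothesis T_unit : T \in unitmx.
Hypothesis PhiP : forall i, gauss qV (Phi i) /\ ordge 2 (Phi i).
Let L := psub (affine_sub x0 T).
Hypothesis hhE : forall i, L (hh i) = mpolyX F (mnm1 (rshift n i)) - Phi i.
Hypothesis hhV : forall i, vanishing_ideal (zero_locus (range g)) (hh i).
Hypothesis gL : forall w, unit_ball w ->
  (forall i, w (rshift n i) = meval w (Phi i)) -> forall j, meval w (L (g j)) = 0.
Context (zeta : 'I_m -> ('I_n -> F) -> F).
Hypothesis zetaP : forall i, gauss_limit qV ((picard Phi)^~ i) (zeta i).

Let qV0 : 0 <= qV. Proof. exact/ltW/qV_gt0. Qed.
Let Phi_gauss i : gauss qV (Phi i). Proof. by case: (PhiP i). Qed.
Let Phi_ord i : ordge 2 (Phi i). Proof. by case: (PhiP i). Qed.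

Lemma graph_eqn y i : unit_ball y ->
  graph zeta y (rshift n i) = meval (graph zeta y) (Phi i).
Proof. by move=> y1; rewrite {1}/graph joinv_rshift; apply: zeta_fixed. Qed.

Lemma graph_zero y j : unit_ball y -> meval (graph zeta y) (L (g j)) = 0.
Proof.
move=> y1; apply: gL => [|i]; first exact: graph_unit_ball.
exact: graph_eqn.
Qed.

Section OrderBound.
Context (d D k : nat) (phi : mpoly (n + m) F) (v : 'I_n -> F) (x : F) (B : R).
Hypotheses (d_gt0 : (0 < d)%N) (D_gt0 : (0 < D)%N).
Hypothesis g_deg : forall i, (mmeasure mdeg (g i) <= D.+1)%N.
Hypothesis phi_deg : (mmeasure mdeg phi <= d.+1)%N.
Hypotheses (v1 : unit_ball v) (x_neq0 : x != 0) (B0 : 0 <= B).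
Hypothesis f_order : forall t, absv t <= 1 ->
  absv (meval (graph zeta (fun i => t * v i)) (L phi) - t ^+ k * x) <= B * absv t ^+ k.+1.

(** The preimage in (y, z)-space of the line y = t v, with coordinates t, of index [ord0], and z_1,
    ..., z_m. *)
Let line : 'I_(n + m) -> mpoly m.+1 F :=
  joinv (fun i => v i *: mpolyX F (mnm1 ord0)) (fun i => mpolyX F (mnm1 (lift ord0 i))).

Let tv (t : F) i := t * v i.

(** Fixes t and moves the point z = zeta(t v) of the graph to the origin. *)
Let fibre (t : F) (i : 'I_m.+1) : mpoly m F :=
  if unlift ord0 i is Some j then mpolyX F (mnm1 j) + mpolyC m (zeta j (tv t))
  else mpolyC m t.

Let recenter (t : F) : 'I_(n + m) -> mpoly m F :=
  joinv (fun i => mpolyC m (tv t i))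
    (fun j => mpolyX F (mnm1 j) + mpolyC m (zeta j (tv t))).

Let fibre_line t p : psub (fibre t) (psub line p) = psub (recenter t) p.
Proof.
rewrite psub_comp; apply: eq_psub => i; rewrite /line /recenter.
rewrite -[i]splitK; case: (fintype.split i) => j /=.
  rewrite !joinv_lshift psubZ psubXU /fibre unlift_none.
  by rewrite -mul_mpolyC -rmorphM/= mulrC.
by rewrite !joinv_rshift psubXU /fibre liftK.
Qed.

Let tv1 t : absv t <= 1 -> unit_ball (tv t).
Proof. by move=> t1 i; rewrite absvM mulr_ile1 ?absv_ge0. Qed.

Let recenter0 t p : mcoeff mnm0 (psub (recenter t) p) = meval (graph zeta (tv t)) p.
Proof.
rewrite mcoeff0_psub; apply: meval_eq => i; rewrite /recenter /graph.
rewrite -[i]splitK; case: (fintype.split i) => j /=.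
  by rewrite !joinv_lshift mcoeffC eqxx mulr1.
by rewrite !joinv_rshift mcoeffD mcoeffX mcoeffC mnm1_eq0 eqxx add0r mulr1.
Qed.

(** On a fibre, the equations hh_i have linear part close to the identity, and their powers lie in
    the ideal of the g_j because they vanish on X. Hence [etale_sop] provides the system of
    parameters that [bezout_bound] asks for. *)
Lemma order_bound : (k <= d * D ^ m)%N.
Proof.
have line2 i : (mmeasure mdeg (line i) <= 2)%N.
  apply: (@joinv_ind _ n m _ _ (fun p => (mmeasure mdeg p <= 2)%N)) i => i.
    by rewrite (leq_trans (msizeZ_le _ _))// msizeX mdeg1.
  by rewrite msizeX mdeg1.
have deg p N : (mmeasure mdeg p <= N)%N -> (mmeasure mdeg (psub line (L p)) <= N)%N.
  move=> pN; apply: leq_trans pN; apply: (leq_trans (msize_psub _ line2)).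
  by apply: msize_psub => i; apply: msize_affine_sub.
have [e heP] : exists e, forall i, ideal_of g (hh i ^+ e).
  have /choice[e eP] := fun i => radical_of_vanishing (hhV i).
  exists (\max_i e i) => i; apply: ideal_closed_exp (eP i).
    exact: ideal_of_closed.
  by rewrite (bigD1 i)//= leq_maxl.
have ax0 : 0 < absv x by rewrite absv_gt0.
(* Up to this radius B |t| < |x|, so that |phi| at the point over t v is exactly |x| |t|^k. *)
pose r := Num.min 1 (absv x / (B + B + 1)).
have BB1 : 0 < B + B + 1 by rewrite ltr_wpDl// addr_ge0.
have r0 : 0 < r by rewrite lt_min ltr01 divr_gt0.
have small t : absv t <= r -> absv t <= 1 /\ B * absv t < absv x.
  rewrite le_min => /andP[t1 tB]; split => //.
  move: tB; rewrite ler_pdivlMr// => tB; have := absv_ge0 t.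
  have [->|t0] := eqVneq (absv t) 0; first by rewrite mulr0.
  move=> t00; apply: lt_le_trans tB; rewrite mulrC.
  rewrite ltr_pM2l ?lt_def ?t0//; lra.
apply: (@bezout_bound R F m d D k d_gt0 D_gt0 (fun i => psub line (L (g i)))
  (psub line (L phi)) _ _ fibre (m * (m * e).+1).+1 (absv x) r) => //.
- by move=> i; apply: deg.
- exact: deg.
- by move=> t; rewrite /fibre unlift_none.
- move=> t t0 /small[t1 tB]; rewrite fibre_line recenter0.
  have tk : 0 < absv t ^+ k by rewrite exprn_gt0// absv_gt0.
  have e0 : absv (t ^+ k * x) = absv x * absv t ^+ k by rewrite absvM absvX mulrC.
  rewrite -[meval _ _](subrK (t ^+ k * x)) addrC absvDl e0//.
  apply: le_lt_trans (f_order t1) _.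
  by rewrite exprSr mulrA mulrAC ltr_pM2r.
- move=> t i t0 /small[t1 _]; rewrite fibre_line.
  by apply: ordge1P; rewrite recenter0 graph_zero//; apply: tv1.
move=> t J p t0 /small[t1 _] pe; have tv1t := tv1 t1.
pose h i := psub (recenter t) (L (hh i)).
have hX i : mpolyX F (mnm1 i) - h i =
    psub (recenter t) (Phi i) - mpolyC m (zeta i (tv t)).
  rewrite /h hhE psubB psubXU /recenter joinv_rshift.
  by rewrite opprB addrCA opprD [X in _ + X]addrA subrr add0r.
have rec1 i : gauss 1 (recenter t i).
  apply: (@joinv_ind _ n m _ _ (gauss 1)) i => i; first exact: gaussC.
  apply: gaussD; first exact: gaussX.
  apply: gaussC => //; apply: le_trans (zeta_le zetaP i tv1t) _.
  exact/ltW/qV_lt1.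
apply: (@etale_sop R F m h _ _ (fun i => psub (fibre t) (psub line (L (g i)))) e) => //.
- move=> i; apply: ordge1P; rewrite recenter0 hhE mevalB mevalXU.
  by rewrite graph_eqn// subrr.
- move=> i l; rewrite hX mcoeffB mcoeffC mnm1_eq0 mulr0 subr0.
  exact: gauss_psub.
move=> i; have [c cE] := heP i; exists (fun j => psub (recenter t) (L (c j))).
rewrite /h -psub_exp -[L _ ^+ _]psub_exp cE /L (psub_sum (affine_sub x0 T)) (psub_sum
  (recenter t)); apply: eq_bigr => j _.
by rewrite !psubM fibre_line.
Qed.

End OrderBound.

Let coefs p : exists c B, [/\ 0 <= B, gauss_limit B
    (fun j => psub (joinv (fun i => mpolyX F (mnm1 i)) (picard Phi j)) (L p))
    (fun y => meval (graph zeta y) (L p)),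
    forall a : multinom n, absv (c a) <= B &
    forall a j, absv (c a - mcoeff a
      (psub (joinv (fun i => mpolyX F (mnm1 i)) (picard Phi j)) (L p))) <= B * qV ^+ j].
Proof.
have [B B0 pB] := gauss_exists (L p).
have fP := meval_graph_limit Phi_gauss zetaP B0 pB.
by have [c [cB cP]] := gauss_limit_coef fP; exists c, B.
Qed.

(** On the ball of radius 1/q < 1, the truncations of the power series converge geometrically, so
    vanishing there amounts to a zero series. *)
Definition germ_vanishing (p : mpoly (n + m) F) :=
  forall y, (forall i, absv (y i) <= qV) ->
    meval (graph zeta y) (psub (affine_sub x0 T) p) = 0.

(** Were all coefficients zero, the truncation error would force p to vanish on the ball of radius
    1/q; so there is a least degree k with a non-zero coefficient. *)
Lemma leading_form p : ~ germ_vanishing p -> exists k (Q : mpoly n F) B,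
  [/\ 0 <= B, Q != 0 & forall v, unit_ball v ->
  (forall t, absv t <= 1 -> absv (meval (graph zeta (fun i => t * v i)) (L p)
     - t ^+ k * meval v Q) <= B * absv t ^+ k.+1) /\
  (forall beta w (ts : seq F) delta eps,
     absv beta < 1 -> B * absv beta < absv (meval v Q) -> unit_ball w ->
     0 < delta -> 0 < eps -> beta != 0 ->
     size ts = k.+1 -> (forall t, t \in ts -> absv t <= 1) ->
     pairwise (fun x y => delta <= absv (x - y)) ts ->
     (forall t, t \in ts ->
        absv (meval (graph zeta (fun i => beta * (w i + t * v i))) (L p)) <= eps) ->
     absv (meval v Q) * absv beta ^+ k * delta ^+ k <= eps)].
Proof.
move=> pV; have [c [B [B0 fP cB cP]]] := coefs p.
have [a ca] : exists a, c a != 0.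
  apply: contrapT => /forallNP c0; apply: pV => y y1.
  have {}c0 a : c a = 0 by have /negP := c0 a; rewrite negbK => /eqP.
  have trunc0 K : truncate K c = 0.
    by rewrite /truncate big1// => a _; rewrite c0 scale0r.
  apply/absv_eq0/eqP; rewrite eq_le absv_ge0 andbT.
  apply: (@le_of_geometric _ F _ _ B) => // j; rewrite le_max.
  have := @gauss_limit_expansion _ _ _ _ _ _ fP c j y qV cP.
  rewrite qV0 (ltW (@qV_lt1 R F)) => /(_ isT y1).
  by rewrite trunc0 meval0 subr0 => ->.
have exk : exists k, `[< exists b, (mdeg b == k) && (c b != 0) >].
  by exists (mdeg a); apply/asboolP; exists a; rewrite eqxx.
case: (ex_minnP exk) => k /asboolP[b /andP[/eqP bk cb]] kmin.
have c_low b' : (mdeg b' < k)%N -> c b' = 0.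
  move=> bk'; apply/eqP; apply: contraLR bk' => cb'; rewrite -leqNgt; apply: kmin.
  by apply/asboolP; exists b'; rewrite eqxx.
have [Q Q0 QP] := lowest_form fP cB cP c_low bk cb.
by exists k, Q, B; split => // v vu; apply: QP.
Qed.

(** At a v where both forms of least degree are non-zero, both functions are non-zero at t v for
    small t. *)
Let germ_prime p p' : germ_vanishing (p * p') -> germ_vanishing p \/ germ_vanishing p'.
Proof.
move=> pp'; apply: contrapT => /not_orP[/leading_form + /leading_form].
move=> [k [Q [B [B0 Q0 QP]]]] [k' [Q' [B' [B'0 Q'0 Q'P]]]].
have [v v1] := meval_neq0 (mulf_neq0 Q0 Q'0).
rewrite mevalM mulf_eq0 negb_or => /andP[Qv Q'v].
have [qP _] := QP v v1; have [q'P _] := Q'P v v1.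
have BB1 : 0 < B + B' + 1 by rewrite ltr_wpDl// addr_ge0.
have [t t0] : exists2 t : F, t != 0 & absv t <
    Num.min qV (Num.min (absv (meval v Q) / (B + B' + 1)) (absv (meval v Q') / (B +
      B' + 1))).
  by apply: exists_small; rewrite !lt_min qV_gt0 !divr_gt0// absv_gt0.
rewrite !lt_min !ltr_pdivlMr// => /and3P[/ltW tq tQ tQ'].
have t1 : absv t <= 1 by rewrite (le_trans tq)// ltW// qV_lt1.
have neq0 (f x : F) C j : 0 <= C -> absv t * (B + B' + 1) < absv x -> C <= B + B' ->
    absv (f - t ^+ j * x) <= C * absv t ^+ j.+1 -> f != 0.
  move=> C0 tx CB fx; apply/eqP => f0; move: fx; rewrite f0 sub0r absvN absvM absvX.
  rewrite exprSr mulrCA ler_pM2l ?exprn_gt0 ?absv_gt0// leNgt => /negP; apply.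
  apply: le_lt_trans tx; rewrite mulrC ler_wpM2l ?absv_ge0//.
  by rewrite (le_trans CB)// lerDl.
have := pp' (fun i => t * v i).
rewrite psubM mevalM => /(_ _)/eqP;
  rewrite mulf_eq0 (negPf (neq0 _ _ _ _ B0 tQ _ (qP t t1))) ?lerDl//.
rewrite (negPf (neq0 _ _ _ _ B'0 tQ' _ (q'P t t1))) ?lerDr//.
move=> H; suff : false by []; apply: H => i.
by rewrite absvM (le_trans _ tq)// ler_piMr ?absv_ge0.
Qed.

Let germ_ideal_closed : ideal_closed germ_vanishing.
Proof.
split=> [y _|p p' pV p'V y y1|a p pV y y1].
- by rewrite rmorph0 meval0.
- by rewrite psubD mevalD pV// p'V// addr0.
- by rewrite psubM mevalM pV// mulr0.
Qed.

Let germ_origin p : germ_vanishing p -> mcoeff mnm0 (L p) = 0.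
Proof.
move=> /(_ (fun=> 0)) pV.
have g0 : graph zeta (fun=> 0) = fun=> 0.
  rewrite -[RHS](_ : joinv (fun=> 0) (fun=> 0) = _); last first.
    by apply/funext => i; rewrite /joinv; case: fintype.split.
  apply/esym; congr joinv; apply: zeta_unique => //.
  - by move=> i; rewrite absv0 ler01.
  - by move=> i; rewrite absv0 ler01.
  move=> i; rewrite (_ : joinv _ _ = fun=> 0); last first.
    by apply/funext => j; rewrite /joinv; case: fintype.split.
  rewrite -[RHS](_ : mcoeff mnm0 (Phi i) = _); first by rewrite Phi_ord ?mdeg0.
  rewrite -[in LHS](psub_id (Phi i)) mcoeff0_psub; apply: meval_eq => l.
  by rewrite mcoeffX mnm1_eq0.
move: pV; rewrite g0 => /(_ _) <- => [|i]; last by rewrite absv0.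
rewrite -[in LHS](psub_id (L p)) mcoeff0_psub; apply: meval_eq => l.
by rewrite mcoeffX mnm1_eq0.
Qed.

Let zeq i := mpolyX F (mnm1 (rshift n i)) - Phi i.

(** The series of p in y is zero, and substituting the J-th Picard iterate already gives its exact
    coefficients up to degree J. What remains is p modulo z = Phi, by [picard_reduction]. *)
Let germ_adic p J : germ_vanishing p -> adic_closure zeq J (L p).
Proof.
move=> pV; have [c [B [B0 fP cB cP]]] := coefs p.
have c0 : forall a, c a = 0.
  exact: (coef0_of_vanishing fP cP (@qV_gt0 R F) pV).
have pJ : ordge J.+1
    (psub (joinv (fun i => mpolyX F (mnm1 i)) (picard Phi J)) (L p)).
  move=> a; rewrite ltnS => aJ.
  apply/absv_eq0/eqP; rewrite eq_le absv_ge0 andbT.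
  apply: (@le_of_geometric _ F _ _ B) => // j; rewrite le_max.
  have := cP a (J + j)%N; rewrite c0 sub0r absvN (picard_stable Phi_ord _ aJ) ?leq_addr//.
  move=> /le_trans -> //; rewrite ler_wpM2l// ler_wiXn2l ?leq_addl//.
  exact/ltW/qV_lt1.
have [x [y [pE zx yJ]]] := (adic_closureP zeq J.+1 _).1
  (picard_reduction Phi_ord J (L p)).
apply/(adic_closureP zeq); move/eqP: pE; rewrite subr_eq => /eqP ->.
set s := psub _ (psub _ _); exists x, (y + s); split => //; first by rewrite addrA.
apply: ordgeD; first exact: ordgeW yJ.
apply: (@ordgeW _ _ _ J.+1) => //.
apply: ordge_psub => // i.
by have := @ordgeX F _ (mnm1 (lshift m i)); rewrite mdeg1.
Qed.

(* By Krull's intersection theorem, each function with zero germ has a multiple, by a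
   function not vanishing at the origin, in the ideal of X: the locus of these
   functions lies in no larger irreducible subset of X. *)
Lemma germ_component : exists X', irreducible_component (zero_locus (range g)) X' /\
  forall p, germ_vanishing p -> vanishing_ideal X' p.
Proof.
have [|P PP] := exists_prime_idealr germ_ideal_closed _ germ_prime.
  by move=> /germ_origin /eqP; rewrite /L rmorph1 mcoeff1 eqxx oner_eq0.
exists (zero_locus germ_vanishing); split; last by move=> p pV P' P'V; apply: P'V.
have VP : zero_locus germ_vanishing P by move=> p /PP.
have gV j : germ_vanishing (g j).
  move=> y y1; apply: graph_zero => i; apply: le_trans (y1 i) _.
  exact/ltW/qV_lt1.
split.
- by move=> P' P'V _ [j _ <-]; apply: P'V.
- split; first by exists P.
  move=> Z1 Z2 [S1 ->] [S2 ->] sub.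
  have mono S : zero_locus S P -> zero_locus germ_vanishing `<=` zero_locus S.
    by move=> SP P' P'V p Sp; apply: P'V; apply/PP/SP.
  by have [/mono|/mono] := sub P VP; [left|right].
move=> W WX Wirr VW P' WP' p pV.
pose IW := vanishing_ideal W.
have IWI : ideal_closed IW.
  split => [Q _|a b aW bW Q WQ|a b bW Q WQ].
  - by case: (prime_idealr_closed_ideal Q).
  - by case: (prime_idealr_closed_ideal Q) => _ + _; apply; [exact: aW|exact: bW].
  - by case: (prime_idealr_closed_ideal Q) => _ _; apply; apply: bW.
have IWgerm q : IW q -> germ_vanishing q by move=> /(_ P (VW P VP)) /PP.
have hhW i : IW (hh i) by move=> Q /WX; apply: hhV.
have [u u0 [c uc]] := krull_intersection (fun J => germ_adic J pV).
pose u' := psub (affine_inv x0 T) u.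
have Lu' : L u' = u by apply: affine_invK.
have u'p : IW (u' * p).
  have -> : u' * p = \sum_i psub (affine_inv x0 T) (c i) * hh i.
    apply: (can_inj (affine_subK x0 T_unit)); rewrite psubM -/(L u') -/(L p) Lu' uc.
    rewrite psub_sum; apply: eq_bigr => i _.
    by rewrite psubM (affine_invK x0 T_unit) -/(L (hh i)) hhE.
  apply: (ideal_closed_sum IWI) => i _; case: IWI => _ _; apply; exact: hhW.
(* The zero loci of u' and p cover W. That of u' does not contain W: functions vanishing on W have
   zero germ, whereas u' takes the value 1 at x0. *)
have [_ /(_ (zero_locus [set u']) (zero_locus [set p]))] := Wirr.
case; [by exists [set u']|by exists [set p]| | |].
- move=> Q WQ; have := u'p Q WQ; rewrite prime_idealrM => /orP[u'Q|pQ]; [left|right].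
    by move=> _ ->.
  by move=> _ ->.
- move=> Wu'; have /IWgerm/germ_origin : IW u' by move=> Q WQ; apply: Wu'.
  by rewrite Lu' u0 => /eqP; rewrite oner_eq0.
by move=> Wp; apply: Wp.
Qed.

End LocalModel.

(** * Haar measure of sublevel sets and integrals *)

Lemma borel_open (T : topologicalType) (t : T) (U : set T) : open U ->
  measurable (U : set (borel t)).
Proof. by move=> oU; apply: sub_sigma_algebra. Qed.

Lemma borel_closed (T : topologicalType) (t : T) (U : set T) : closed U ->
  measurable (U : set (borel t)).
Proof.
move=> cU; rewrite -[U]setCK; apply: (@measurableC _ (borel t)).
by apply: (@borel_open T t); apply: closed_openC.
Qed.

(** Compares the simple functions below f1 and f2, so measurability is not involved; it applies to
    the minimum over an arbitrary system of generators. *)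
Lemma le_integral_ge0 d (T : measurableType d) (R : realType)
    (mu : {measure set T -> \bar R}) (f1 f2 : T -> \bar R) :
  (forall x, 0 <= f1 x)%E -> (forall x, f1 x <= f2 x)%E ->
  (\int[mu]_x f1 x <= \int[mu]_x f2 x)%E.
Proof.
move=> f10 f12; rewrite !ge0_integralTE// => [|x]; last exact: le_trans (f12 x).
apply: le_ereal_sup => _ [h hf1 <-]; exists h => // x.
exact: le_trans (f12 x).
Qed.

(** Integrate over A the sum of the indicators of the E_i, which is at most k. *)
Lemma measure_multiplicity d (T : measurableType d) (R : realType)
    (mu : {measure set T -> \bar R}) (I : finType) (E : I -> set T) (A : set T) k :
  measurable A -> (forall i, measurable (E i)) -> (forall i, E i `<=` A) ->
  (forall y, (#|[pred i | `[< E i y >]]| <= k)%N) ->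
  (\sum_i mu (E i) <= k%:R%:E * mu A)%E.
Proof.
move=> mA mE EA Ek.
rewrite (eq_bigr (fun i => \int[mu]_(x in A) (\1_(E i) x)%:E)%E); last first.
  by move=> i _; rewrite integral_indic// setIidl.
rewrite -ge0_integral_sum//; last first.
  by move=> i; apply/measurable_EFinP/measurable_indic.
rewrite -(integral_cst mu mA) [leLHS]integral_mkcond [leRHS]integral_mkcond.
apply: le_integral_ge0 => x; rewrite !patchE; case: ifP => // _.
  by apply: sume_ge0 => i _; rewrite lee_fin.
rewrite sumEFin lee_fin /cst; apply: le_trans (_ : (#|[pred i | `[< E i x >]]|)%:R <= _).
  rewrite -sum1_card natr_sum [leRHS]big_mkcond/=; apply: ler_sum => i _.
  have [Eix|Eix] := pselect (E i x); rewrite indicE.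
    have Ei : `[< E i x >] by apply/asboolP.
    by rewrite mem_set// unfold_in /= Ei.
  by rewrite memNset//; case: ifP.
by rewrite ler_nat.
Qed.

Section Topology.
Context {R : realType} {F : nonArchLocalFieldType R}.
Local Notation qV := ((@resq R F)%:R^-1 : R).

Lemma ball_rowE n (x y : 'rV[F]_n) (e : R) : 0 < e ->
  ball x e y <-> forall i, absv (x 0 i - y 0 i) < e.
Proof.
move=> e0; split=> [[_ xy] i|xy]; first exact: xy.
by split => // i j; rewrite ord1; apply: xy.
Qed.

Lemma lipschitz_continuous n p (f : 'rV[F]_n -> 'rV[F]_p) (C : R) : 0 < C ->
  (forall (x y : 'rV[F]_n) (e : R), 0 <= e -> (forall i, absv (x 0 i - y 0 i) <= e) ->
     forall i, absv (f x 0 i - f y 0 i) <= C * e) -> continuous f.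
Proof.
move=> C0 fC x A /nbhs_ballP[e /= e0 eA].
have e2 : 0 < e / (C + C) by rewrite divr_gt0// addr_gt0.
suff : nbhs x (f @^-1` A) by [].
apply/nbhs_ballP; exists (e / (C + C)) => //= y /(ball_rowE _ _ e2) xy.
apply: eA; apply/ball_rowE => // i.
apply: (@le_lt_trans _ _ (C * (e / (C + C)))).
  by apply: fC => [|j]; rewrite ltW.
rewrite mulrCA gtr_pMr// ltr_pdivrMr ?addr_gt0// mul1r.
by rewrite ltrDl.
Qed.

Definition rfun n (y : 'rV[F]_n) : 'I_n -> F := fun i => y 0 i.

(** Near a point where f is non-zero, the Lipschitz bound makes |f| constant, by the ultrametric
    inequality. *)
Lemma closed_lipschitz_sublevel n (f : ('I_n -> F) -> F) (B b eps : R) :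
  0 <= B -> 0 < b ->
  (forall e v v', 0 <= e -> (forall i, absv (v i) <= b) ->
    (forall i, absv (v' i) <= b) -> (forall i, absv (v i - v' i) <= e) ->
    absv (f v - f v') <= B * e) ->
  closed [set y : 'rV[F]_n | (forall i, absv (y 0 i) <= b) /\ absv (f (rfun y)) <= eps].
Proof.
move=> B0 b0 fB y ycl.
have near e : 0 < e -> exists2 z : 'rV[F]_n, (forall i, absv (y 0 i - z 0 i) < e) &
    (forall i, absv (z 0 i) <= b) /\ absv (f (rfun z)) <= eps.
  move=> e0; have [z [zE yz]] := ycl _ (nbhsx_ballx y e e0).
  by exists z => //; apply/ball_rowE.
have yb i : absv (y 0 i) <= b.
  have [z yz [zb _]] := near b b0.
  rewrite -[y 0 i](subrK (z 0 i)); apply: absvD_le => //; exact: ltW.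
split => //; rewrite leNgt; apply/negP => epsf.
have f0 : 0 < absv (f (rfun y)).
  have [z _ [_ fz]] := near 1 ltr01.
  by apply: le_lt_trans epsf; apply: le_trans (absv_ge0 _) fz.
pose e := absv (f (rfun y)) / (B + B + 1).
have BB : 0 < B + B + 1 by rewrite ltr_wpDl// addr_ge0.
have e0 : 0 < e by rewrite divr_gt0.
have [z yz [zb fz]] := near e e0.
have : absv (f (rfun y) - f (rfun z)) < absv (f (rfun y)).
  apply: (@le_lt_trans _ _ (B * e)).
    by apply: (fB e) => [|i|i|i]; [exact: ltW|exact: yb|exact: zb|exact: ltW (yz i)].
  by rewrite /e mulrCA gtr_pMr// ltr_pdivrMr// mul1r; lra.
rewrite absvB_sym => fyz.
have := absvDl fyz; rewrite addrC subrK => fE.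
by move: fz; rewrite fE leNgt epsf.
Qed.

End Topology.

Section HaarSublevel.
Context {R : realType} {F : nonArchLocalFieldType R} (n : nat).
Local Notation qV := ((@resq R F)%:R^-1 : R).
Context (haar : {measure set (borel (0 : 'rV[F]_n)) -> \bar R}).
Hypothesis haarP : normalized_haar haar.

Lemma closed_unit_ball : closed [set x : 'rV[F]_n | forall i, absv (x 0 i) <= 1].
Proof.
have := @closed_lipschitz_sublevel R F n (fun=> 0) 0 1 1 (lexx _) ltr01.
rewrite (_ : [set y | _] = [set x : 'rV[F]_n | forall i, absv (x 0 i) <= 1]).
  by apply => *; rewrite subrr absv0 mul0r.
by apply/seteqP; split => [x []//|x x1]; split => //; rewrite absv0 ler01.
Qed.

(* The translates of E by the points of a delta-separated subset of the line
   spanned by v cover each point at most k times. *)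
Lemma haar_le_of_multiplicity (v : 'I_n -> F) k l (beta : F) (E : set 'rV[F]_n) :
  unit_ball v -> beta != 0 -> absv beta <= 1 -> closed E ->
  (forall y, E y -> forall i, absv (y 0 i) <= absv beta) ->
  (forall (w : 'I_n -> F) (ts : seq F), unit_ball w -> size ts = k.+1 ->
    (forall t, t \in ts -> absv t <= 1) ->
    pairwise (fun x y => qV ^+ l <= absv (x - y)) ts ->
    (forall t, t \in ts -> E (\row_i (beta * (w i + t * v i)))) -> False) ->
  (haar E <= (k%:R * qV ^+ l)%:E)%E.
Proof.
move=> v1 beta0 beta1 Ecl Eb Emult.
have [T [p [cT p1 psep]]] := @separated_points R F l.
pose a x : 'rV[F]_n := \row_i (beta * (p x * v i)).
pose Ex x : set 'rV[F]_n := [set y + - a x | y in E].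
have ExE x y : Ex x y <-> E (y + a x).
  split => [[z Ez <-]|Ey]; first by rewrite subrK.
  by exists (y + a x) => //; rewrite addrK.
have acont x : continuous (fun y : 'rV[F]_n => y + a x).
  apply: (@lipschitz_continuous _ _ _ _ _ 1) => // y z e e0 yz i.
  by rewrite !mxE opprD addrACA subrr addr0 mul1r.
have Ex_closed x : closed (Ex x).
  rewrite (_ : Ex x = (fun y => y + a x) @^-1` E); last first.
    by apply/seteqP; split => y yE; have /= := ExE x y; tauto.
  by apply: closed_comp => // y _; apply: acont.
have haarEx x : haar (Ex x) = haar E by apply: haarP.1;
  apply: (@borel_closed _ (0 : 'rV[F]_n)).
have ax x i : absv (a x 0 i) <= absv beta.
  rewrite mxE absvM ler_piMr ?absv_ge0// absvM mulr_ile1 ?absv_ge0//.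
have Ex_ball x y : Ex x y -> forall i, absv (y 0 i) <= absv beta.
  move=> /ExE/Eb yb i; have := yb i; rewrite mxE => yi.
  by rewrite -[y 0 i](addrK (a x 0 i)); apply: absvB_le.
have : (\sum_x haar (Ex x) <= k%:R%:E * haar [set x : 'rV[F]_n | forall i, (absv (x
  ord0 i) <= 1)%R])%E.
  apply: measure_multiplicity.
- exact: (@borel_closed _ (0 : 'rV[F]_n) _ closed_unit_ball).
- by move=> x; apply: (@borel_closed _ (0 : 'rV[F]_n)).
- by move=> x y /Ex_ball yb i; apply: le_trans (yb i) beta1.
- move=> y; rewrite leqNgt; apply/negP => ky.
  (* If k + 1 translates contain y, then k + 1 separated points of the line through y lie in E. *)
  pose s := take k.+1 (enum [pred x | `[< Ex x y >]]).
  have sk : size s = k.+1 by rewrite size_takel// -cardE.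
  have sE x : x \in s -> E (y + a x).
    by move=> /mem_take; rewrite mem_enum => Exy; apply: (ExE x y).1; move: Exy;
      rewrite unfold_in /= => /asboolP.
  have s0 : exists x, x \in s by case: (s) sk => // x s' _; exists x; rewrite mem_head.
  have yb i : absv (y 0 i) <= absv beta.
    by have [x /sE Ey] := s0; apply: (Ex_ball x); exact: (ExE x y).2.
  apply: (Emult (fun i => y 0 i / beta) (map p s)).
  - by move=> i; rewrite absvM absvV ler_pdivrMr ?absv_gt0// mul1r.
  - by rewrite size_map.
  - by move=> _ /mapP[x _ ->].
  - have : uniq s by rewrite take_uniq ?enum_uniq.
    rewrite uniq_pairwise pairwise_map; apply: sub_pairwise => x x' xx'.
    by rewrite /= ltW// psep.
  move=> _ /mapP[x xs ->]; have := sE x xs; congr (E _).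
  by apply/rowP => i; rewrite !mxE mulrDr [beta * (_ / _)]mulrC divfK.
rewrite (eq_bigr (fun=> haar E)) => [|x _]; last exact: haarEx.
have -> : (\sum_(x : T) haar E = (#|T|%:R)%:E * haar E)%E.
  rewrite big_const; elim: #|T| => [|j IHj]; first by rewrite mul0e.
  by rewrite iterS IHj -natr1 EFinD ge0_muleDl// mul1e addeC.
rewrite haarP.2 mule1 cT => le_k.
rewrite exprVn mulrC EFinM lee_pdivlMl ?exprn_gt0 ?q_gt0//.
by rewrite -natrX.
Qed.

End HaarSublevel.

(* The integrand is at most b w^l on S l outside S l.+1, where S l has measure at
   most c z^l, and the geometric series of ratio w z converges. *)
Lemma layer_integral_lty d (T : measurableType d) (R : realType)
    (mu : {measure set T -> \bar R}) (g : T -> \bar R) (S : nat -> set T)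
    (b w c z : R) :
  (forall x, 0 <= g x)%E -> S 0 = setT -> (forall l, measurable (S l)) ->
  (forall l, mu (S l) <= (c * z ^+ l)%:E)%E ->
  (forall l x, ~ S l.+1 x -> g x <= (b * w ^+ l)%:E)%E ->
  0 < b -> 1 <= w -> 0 < z -> w * z < 1 ->
  (\int[mu]_x g x < +oo)%E.
Proof.
move=> g0 S0 mS muS gS b0 w1 z0 wz.
have w0 : 0 < w by apply: lt_le_trans w1.
have bw l : 0 < b * w ^+ l by rewrite mulr_gt0// exprn_gt0.
have c0 : 0 <= c.
  by have := le_trans (measure_ge0 mu (S 0)) (muS 0); rewrite lee_fin expr0 mulr1.
pose u l x : \bar R := ((b * w ^+ l)%:E * (\1_(S l) x)%:E)%E.
have u0 l x : (0 <= u l x)%E by rewrite mule_ge0// lee_fin ltW.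
have u_mem l x : S l x -> u l x = (b * w ^+ l)%:E.
  by move=> Sx; rewrite /u indicE mem_set// mule1.
apply: (@le_lt_trans _ _ (\int[mu]_x \sum_(l <oo) u l x)%E).
  apply: le_integral_ge0 => // x.
  have partial k : (\sum_(0 <= l < k) u l x <= \sum_(l <oo) u l x)%E.
    by apply: nneseries_lim_ge.
  (* Where x is in all S l, nothing is known about g, but the series is infinite since each term is
     at least b. Elsewhere the first S l.+1 that misses x gives the bound. *)
  have [Sx|] := pselect (forall l, S l x).
    suff -> : (\sum_(l <oo) u l x = +oo)%E by rewrite leey.
    have kb k : ((b * k%:R)%:E <= \sum_(l <oo) u l x)%E.
      apply: le_trans (partial k); rewrite (eq_bigr (fun l => (b * w ^+ l)%:E)) => [|l _].
        rewrite sumEFin lee_fin (_ : b * k%:R = \sum_(0 <= l < k) b); last first.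
          by rewrite sumr_const_nat subn0 mulr_natr.
        by apply: ler_sum => l _; rewrite ler_peMr ?exprn_ege1// ltW.
      exact: u_mem.
    move: kb; case: (\sum_(l <oo) u l x)%E => // [r|] kb; last first.
      by have := kb 0%N; rewrite leeNy_eq.
    have := kb (Num.truncn (r / b)).+1; rewrite lee_fin leNgt.
    by rewrite -ltr_pdivrMl// mulrC truncnS_gt.
  move=> /existsNP Sx.
  have exl : exists l, ~~ `[< S l x >] by case: Sx => l Sx; exists l; apply/asboolPn.
  case: (ex_minnP exl) => -[|l] /asboolPn Slx lmin; first by case: Slx; rewrite S0.
  have {}Sx : S l x by apply/asboolP/negPn/negP => /lmin; rewrite ltnn.
  apply: (le_trans (gS l x Slx)); rewrite -(u_mem _ _ Sx).
  by apply: le_trans (partial l.+1); rewrite big_nat_recr//= leeDr//; apply: sume_ge0.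
have mu_ l : measurable_fun setT (u l).
  apply: emeasurable_funM => //; exact/measurable_EFinP/measurable_indic.
rewrite integral_nneseries//.
apply: (@le_lt_trans _ _ ((b * c) * (1 - w * z)^-1)%:E); last by rewrite ltry.
apply: lime_le; first by apply: is_cvg_nneseries => l _ _; apply: integral_ge0.
apply: nearW => k.
apply: (@le_trans _ _ (\sum_(0 <= l < k) ((b * c) * (w * z) ^+ l)%:E)%E).
  apply: lee_sum => l _.
  rewrite (@ge0_integralZl_EFin _ _ _ mu setT measurableT (EFin \o \1_(S l)));
    [|by move=> x _; rewrite lee_fin|exact/measurable_EFinP/measurable_indic|exact: ltW].
  rewrite integral_indic// setIT exprMn mulrACA [in leRHS]EFinM.
  by apply: lee_pmul => //; rewrite ?lee_fin ?ltW.
rewrite sumEFin lee_fin.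
have wz0 : 0 < w * z by rewrite mulr_gt0.
have := @geometric_le_lim R k (b * c) (w * z).
by rewrite seriesEnat /geometric; apply => //; [rewrite mulr_ge0// ltW|rewrite gtr0_norm].
Qed.

(** Layers are cut where h passes C eta^(k l): there g is at most of order eta^(- k s l), on a set
    of measure of order eta^l, and k s < 1. *)
Lemma neg_power_integral_lty d (T : measurableType d) (R : realType)
    (mu : {measure set T -> \bar R}) (K : set T) (h : T -> R) (g : T -> \bar R)
    (C eta s A c : R) (k : nat) :
  measurable K -> mu (~` K) = 0%E -> (mu K <= c%:E)%E ->
  0 < C -> 0 < eta -> eta < 1 -> 0 <= s -> k%:R * s < 1 -> 0 < A ->
  (forall x, K x -> g x <= A%:E * neg_power (h x) s)%E -> (forall x, 0 <= g x)%E ->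
  (forall l, exists S, [/\ measurable S,
     forall x, K x -> h x <= C * eta ^+ (k * l) -> S x &
     (mu S <= (c * eta ^+ l)%:E)%E]) ->
  (\int[mu]_x g x < +oo)%E.
Proof.
move=> mK muK muKc C0 eta0 eta1 s0 ks A0 gA g0 /choice[S SP].
have mKC : measurable (~` K) by exact: measurableC.
have c0 : 0 <= c by have := le_trans (measure_ge0 mu K) muKc; rewrite lee_fin.
have muUC B : measurable B -> (mu (B `|` ~` K) <= mu B)%E.
  by move=> mB; rewrite -[leRHS]adde0 -muK; apply: measureU2.
have one r : (1 : R) `^ r = 1 by rewrite powR1.
(* The null set outside K joins every layer because g is bounded by h only on K. The shift of index,
   which starts the layers at the whole space, accounts for the constant c / eta. *)
pose U l := if l is l'.+1 then S l' `|` ~` K else setT.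
apply: (@layer_integral_lty _ _ _ mu g U (A * C `^ (- s)) (eta `^ (- (k%:R * s))) (c
  / eta) eta) => //.
- case=> [|l]; first exact: measurableT.
  by apply: measurableU => //; case: (SP l).
- case=> [|l] /=.
    by rewrite -(setUv K) (le_trans (muUC K mK))// (le_trans muKc)// lee_fin expr0
      mulr1 ler_pdivlMr// ler_piMr// ltW.
  by case: (SP l) => mS _ muS; rewrite (le_trans (muUC _ mS))// (le_trans muS)//
    lee_fin exprS mulrA divfK// gt_eqF.
- move=> l x /= /not_orP[Sx /contrapT Kx].
  apply: (le_trans (gA x Kx)); rewrite -mulrA EFinM lee_pmul2l ?lte_fin//.
  have hx : C * eta ^+ (k * l) < h x.
    by rewrite ltNge; apply/negP => hx; apply: Sx; case: (SP l) => _ + _; apply.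
  have Ceta : 0 < C * eta ^+ (k * l) by rewrite mulr_gt0// exprn_gt0.
  rewrite /neg_power gt_eqF/= ?(lt_trans Ceta hx)// lee_fin.
  have -> : C `^ (- s) * eta `^ (- (k%:R * s)) ^+ l = (C * eta ^+ (k * l)) `^ (- s).
    rewrite powRM ?exprn_ge0 ?ltW// -!powR_mulrn ?powR_ge0 ?ltW// -!powRrM.
    by congr (_ * _ `^ _); rewrite natrM; lra.
  rewrite !powRN lef_pV2 ?posrE ?powR_gt0 ?(lt_trans Ceta hx)//.
  by apply: ge0_ler_powR; rewrite ?nnegrE;
    [|exact: ltW|exact: ltW (lt_trans Ceta hx)|exact: ltW].
- by rewrite mulr_gt0// powR_gt0.
- rewrite powRN invf_ge1 ?powR_gt0// -[leRHS](one (k%:R * s)).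
  by apply: ge0_ler_powR; rewrite ?nnegrE ?mulr_ge0// ltW.
- rewrite -[X in _ * X < 1](@powRr1 _ eta) ?ltW// -powRD; last first.
    by rewrite (gt_eqF eta0) implybT.
  have ks1 : 0 < - (k%:R * s) + 1 by rewrite addrC subr_gt0.
  rewrite -[ltRHS](one (- (k%:R * s) + 1)).
  by apply: gt0_ltr_powR; rewrite // ?nnegrE// ltW.
Qed.

Section LocallyConstant.
Import numFieldNormedType.Exports.

Lemma locally_constant_bounded (R : realType) (Y : topologicalType) (A : set Y) (f :
  Y -> R) :
  compact A -> (forall x, A x -> \forall y \near x, f y = f x) ->
  exists2 M, 0 < M & forall x, A x -> f x <= M.
Proof.
move=> Ac fA.
have fc : {within A, continuous f}.
  apply: continuous_in_subspaceT => x; rewrite inE => Ax.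
  by apply: cvg_near_cst; apply: fA.
have [M [_ MP]] := compact_bounded (continuous_compact fc Ac).
exists (`|M| + 1) => [|x Ax]; first by rewrite ltr_wpDl.
apply: (le_trans (ler_norm _)); apply: (MP (`|M| + 1)); last by exists x.
by rewrite (le_lt_trans (ler_norm _))// ltrDl.
Qed.

End LocallyConstant.

(** * Analytic functions and charts *)

Section PowerSeries.
Context {R : realType} {F : nonArchLocalFieldType R}.
Local Notation qV := ((@resq R F)%:R^-1 : R).

(** Absolute values are integral powers of q, so none lies strictly between 1/q and 1. *)
Lemma absv_lt1 (x : F) : absv x < 1 -> absv x <= qV.
Proof.
have [->|x0 x1] := eqVneq x 0; first by rewrite absv0 ltW ?qV_gt0.
have [k xk] := @absv_discrete R F x (elimN eqP x0); move: x1; rewrite xk.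
case: k {xk} => [k|k].
  by rewrite -exprnP ltNge exprn_ege1// ltW// q_gt1.
rewrite NegzE -exprnN exprnP -exprnP => _;
  rewrite -exprVn exprS ler_piMr ?(ltW (@qV_gt0 R F))//.
by rewrite exprn_ile1 ?(ltW (@qV_gt0 R F)) ?(ltW (@qV_lt1 R F)).
Qed.

Context (Y : Type) (n : nat) (D : set Y) (u : Y -> 'rV[F]_n).

Lemma power_series_poly (f : Y -> F) (p : mpoly n F) y :
  (forall z, D z -> f z = meval (rfun (u z - u y)) p) -> power_series_at D u f y.
Proof.
move=> fp; have [B B0 pB] := gauss_exists p.
exists (fun a => mcoeff a p), 1, B; split => // [a|z Dz _].
  by rewrite expr1n mulr1; apply: pB.
apply: cvg_near_cst; exists (mmeasure mdeg p) => // k /= pk.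
rewrite fp// (_ : p = truncate k (fun a => mcoeff a p)); last first.
  apply/mpolyP => a; rewrite mcoeff_truncate; case: ltnP => // ka.
  by apply/memN_msupp_eq0/mmeasure_mnm_ge; apply: leq_trans ka.
rewrite meval_truncate; apply: eq_bigr => a _; rewrite mcoeff_truncate bmdeg.
by congr (_ * _); apply: eq_bigr => i _; rewrite /rfun !mxE.
Qed.

(** Recentre at u(y). The open ball of radius 1 is the closed ball of radius 1/q, on which the
    truncations converge geometrically. *)
Lemma power_series_gauss (f : Y -> F) B P (f0 : ('I_n -> F) -> F) y :
  gauss_limit B P f0 -> unit_ball (rfun (u y)) ->
  (forall z, D z -> f z = f0 (rfun (u z))) -> power_series_at D u f y.
Proof.
move=> f0P y1 ff0; have fP := gauss_limit_shift f0P y1.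
have [c [cB cP]] := gauss_limit_coef fP.
have qV01 : 0 <= qV <= 1 by rewrite !ltW ?qV_gt0 ?qV_lt1.
exists c, 1, B; split => // [a|z Dz /(ball_rowE _ _ ltr01) yz];
  first by rewrite expr1n mulr1.
have wq i : absv (rfun (u z - u y) i) <= qV.
  by rewrite /rfun !mxE absvB_sym; apply/absv_lt1/yz.
have fz k : absv (f z - meval (rfun (u z - u y)) (truncate k c)) <= B * qV ^+ k.
  have := @gauss_limit_expansion _ _ _ _ _ _ fP c k _ qV cP qV01 wq.
  rewrite ff0//; congr (absv (f0 _ - _) <= _).
  by apply/funext => i; rewrite /rfun !mxE subrK.
apply/cvg_ballP => e e0.
have [|j jP] := @qVX_small R F (e / (B + 1)).
  by rewrite divr_gt0// ltr_wpDl//; case: f0P.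
exists j => // k /= jk.
rewrite (_ : (\sum_(a : bmultinom n k) _) = meval (rfun (u z - u y)) (truncate k c)).
  apply: (le_lt_trans (fz k)); have [B0 _ _ _] := f0P.
  have := jP k jk; rewrite ltr_pdivlMr ?ltr_wpDl// mulrC; apply: le_lt_trans.
  by rewrite ler_wpM2r ?exprn_ge0 ?(ltW (@qV_gt0 R F))// lerDl.
rewrite meval_truncate; apply: eq_bigr => a _.
by congr (_ * _); apply: eq_bigr => i _; rewrite /rfun !mxE.
Qed.

End PowerSeries.

Section Germs.
Context {R : realType} {F : nonArchLocalFieldType R}.

Lemma absv_sum_lt B (I : Type) (s : seq I) (P : pred I) (f : I -> F) :
  0 < B -> (forall i, P i -> absv (f i) < B) ->
  absv (\sum_(i <- s | P i) f i) < B.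
Proof.
move=> B0 fB; apply: (big_ind (fun x => absv x < B)) => //; first by rewrite absv0.
by move=> x y xB yB; rewrite (le_lt_trans (absvD _ _))// gt_max xB.
Qed.

Lemma power_series_bounded (Y : Type) n (D : set Y) (u : Y -> 'rV[F]_n) (f : Y -> F) y :
  power_series_at D u f y -> exists rho B : R, 0 < rho /\
    forall z, D z -> ball (u y) rho (u z) -> absv (f z) <= B.
Proof.
move=> [c [rho [B [rho0 cB fc]]]]; exists rho, B; split => // z Dz yz.
have B0 : 0 <= B by have := cB mnm0; rewrite mdeg0 expr0 mulr1;
  apply: le_trans (absv_ge0 _).
rewrite leNgt; apply/negP => Bf; have f0 := le_lt_trans B0 Bf.
have [j _ /(_ j (leqnn j))] := (cvg_ballP _ _).1 (fc z Dz yz) _ f0.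
rewrite /ball /= /dist; set S := (\sum_(a : _) _) => fS.
have SB : absv S <= B.
  apply: absv_sum_le => // a _; apply: le_trans (cB (bmnm a)).
  rewrite absvM ler_wpM2l ?absv_ge0// absv_prod mdegE -prodrXr.
  apply: ler_prod => i _; rewrite absv_ge0/= absvX lerXn2r ?nnegrE ?absv_ge0 ?ltW//.
  by rewrite absvB_sym; have /(ball_rowE _ _ rho0) := yz; apply.
have := absvDl (x := f z) (y := S - f z); rewrite absvB_sym addrCA subrr addr0 =>
  /(_ fS) SE.
by move: SB; rewrite SE leNgt Bf.
Qed.

Context (Y : topologicalType) (n : nat) (atlas : set (chart F Y n)).

Lemma analytic_const (c : F) y : analytic_at atlas (fun=> c) y.
Proof.
move=> psi _ _; apply: (@power_series_poly _ _ _ _ _ _ _ (mpolyC n c)) => z _.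
by rewrite mevalC.
Qed.

Lemma germ_ideal_gen r (phi : 'I_r -> Y -> F) y i :
  germ_ideal atlas (analytic_ideal atlas phi) y (phi i).
Proof.
exists 1, (fun _ _ => 1), (fun=> phi i); split => [_|_|].
- by apply: nearW => z; apply: analytic_const.
- exists (fun j _ => if j == i then 1 else 0); split => [j z|z].
    exact: analytic_const.
  by rewrite (bigD1 i)//= eqxx mul1r big1 ?addr0// => j /negPf ->; rewrite mul0r.
- by apply: nearW => z; rewrite big_ord1 mul1r.
Qed.

Context (psi : chart F Y n) (y : Y).
Hypotheses (psi_atlas : atlas psi) (psi_y : cdom psi y) (psi_open : open (cdom psi)).
Hypothesis psi_cont : forall e : R, 0 < e -> \forall z \near y, ball (cmap psi y) e
  (cmap psi z).

Lemma analytic_bounded a : analytic_at atlas a y ->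
  exists B : R, 0 <= B /\ \forall z \near y, absv (a z) <= B.
Proof.
move=> a_an; have [rho [B [rho0 aB]]] := power_series_bounded (a_an psi psi_atlas psi_y).
have near_dom : \forall z \near y, cdom psi z by apply: open_nbhs_nbhs.
exists `|B|; split => //; near=> z.
apply: le_trans (ler_norm _); apply: aB; near: z => //; exact: psi_cont.
Unshelve. all: by end_near. Qed.

(** Near y, p is a combination of the f_j with bounded coefficients. The bound is stated where p is
    non-zero, so that it makes sense for an empty family of generators. *)
Lemma germ_ideal_le r (f : 'I_r -> Y -> F) p : germ_ideal atlas (range f) y p ->
  exists A : R, 0 < A /\
    \forall z \near y, p z != 0 -> exists j, absv (p z) <= A * absv (f j z).
Proof.
move=> [k [a [h [a_an hf pE]]]].
have /choice[B BP] i := analytic_bounded (nbhs_singleton (a_an i)).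
have /choice[sigma sigmaP] : forall i, exists j, h i = f j.
  by move=> i; have [j _ <-] := hf i; exists j.
pose A := 1 + \sum_i B i.
have B0 i : 0 <= B i by case: (BP i).
have A0 : 0 < A by rewrite ltr_pwDl// sumr_ge0.
have aB : \forall z \near y, forall i, absv (a i z) <= B i.
  by apply: filter_forall => i; case: (BP i).
exists A; split => //; near=> z => p0.
have pz : p z = \sum_i a i z * h i z by near: z.
have [//|/forallNP none] := pselect (exists j, absv (p z) <= A * absv (f j z)).
have ap0 : 0 < absv (p z) by rewrite absv_gt0.
suff : absv (p z) < absv (p z) by rewrite ltxx.
rewrite {1}pz; apply: absv_sum_lt => // i _; rewrite absvM.
have := none (sigma i); rewrite -sigmaP => /negP; rewrite -ltNge; apply: le_lt_trans.
rewrite ler_wpM2r ?absv_ge0// (@le_trans _ _ (B i))//; first by move: i; near: z.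
by rewrite ler_wpDl// (bigD1 i)//= lerDl sumr_ge0.
Unshelve. all: by end_near. Qed.

Lemma bigmin_neg_power_le r (f : 'I_r -> F) (p : F) (A s : R) : 0 < A -> 0 < s ->
  (p != 0 -> exists j, absv p <= A * absv (f j)) ->
  (\big[Order.min/+oo]_(j < r) neg_power (absv (f j)) s <= (A `^ s)%:E * neg_power
    (absv p) s)%E.
Proof.
move=> A0 s0 pf; have As0 : 0 < A `^ s by rewrite powR_gt0.
have [p0|p0] := eqVneq p 0.
  by rewrite /neg_power p0 absv0 eqxx s0/= gt0_muley ?lte_fin// leey.
have [j pj] := pf p0; have ap : 0 < absv p by rewrite absv_gt0.
apply: (@le_trans _ _ (neg_power (absv (f j)) s)); first exact: bigmin_le.
have fj : 0 < absv (f j).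
  by rewrite lt_def absv_ge0 andbT; apply: contraTneq pj => ->; rewrite mulr0 -ltNge.
rewrite /neg_power !gt_eqF//= -EFinM lee_fin !powRN ler_pdivlMr ?powR_gt0//.
rewrite mulrC ler_pdivrMr ?powR_gt0// -powRM ?(ltW A0) ?(ltW fj)//.
by apply: ge0_ler_powR; rewrite ?nnegrE ?mulr_ge0 ?(ltW s0) ?(ltW A0) ?absv_ge0.
Qed.

End Germs.

(** For compact sets to be closed, hence Borel. *)
Lemma hausdorff_row (R : realType) (F : nonArchLocalFieldType R) n :
  hausdorff_space 'rV[F]_n.
Proof.
move=> p q pq; apply/rowP => i; apply: contrapT => /eqP; rewrite -subr_eq0 -absv_gt0 => e0.
have [z [/(ball_rowE _ _ e0) pz /(ball_rowE _ _ e0) qz]] :=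
  pq _ _ (nbhsx_ballx p _ e0) (nbhsx_ballx q _ e0).
suff : absv (p 0 i - q 0 i) < absv (p 0 i - q 0 i) by rewrite ltxx.
rewrite -{1}[p 0 i](subrK (z 0 i)) -addrA.
by rewrite (le_lt_trans (absvD _ _))// gt_max pz [absv (z 0 i - _)]absvB_sym qz.
Qed.

Lemma hausdorff_injective (Y Z : topologicalType) (f : Y -> Z) :
  hausdorff_space Z -> continuous f -> injective f -> hausdorff_space Y.
Proof.
move=> hZ fc finj p q pq; apply/finj/hZ => A B /fc pA /fc qB.
by have [z [Az Bz]] := pq _ _ pA qB; exists (f z).
Qed.

(** * The chart at the point and the final integral *)

Section LocalChart.
Context {R : realType} {F : nonArchLocalFieldType R} (n m : nat).
Local Notation qV := ((@resq R F)%:R^-1 : R).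
Context (g : 'I_m -> mpoly (n + m) F) (x0 : 'I_(n + m) -> F).
Context (T : 'M[F]_(n + m)) (Phi hh : 'I_m -> mpoly (n + m) F).
Hypothesis T_unit : T \in unitmx.
Hypothesis PhiP : forall i, gauss qV (Phi i) /\ ordge 2 (Phi i).
Let L := psub (affine_sub x0 T).
Hypothesis hhE : forall i, L (hh i) = mpolyX F (mnm1 (rshift n i)) - Phi i.
Hypothesis hhV : forall i, vanishing_ideal (zero_locus (range g)) (hh i).
Hypothesis gL : forall w, unit_ball w ->
  (forall i, w (rshift n i) = meval w (Phi i)) -> forall j, meval w (L (g j)) = 0.
Context (zeta : 'I_m -> ('I_n -> F) -> F).
Hypothesis zetaP : forall i, gauss_limit qV ((picard Phi)^~ i) (zeta i).

Let qV0 : 0 <= qV. Proof. exact/ltW/qV_gt0. Qed.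
Let Phi_gauss i : gauss qV (Phi i). Proof. by case: (PhiP i). Qed.

Lemma haar_sublevel (haar : {measure set (borel (0 : 'rV[F]_n)) -> \bar R})
    (d D : nat) (phi : mpoly (n + m) F) :
  normalized_haar haar -> (0 < d)%N -> (0 < D)%N ->
  (forall i, (mmeasure mdeg (g i) <= D.+1)%N) -> (mmeasure mdeg phi <= d.+1)%N ->
  ~ germ_vanishing x0 T zeta phi ->
  exists (k : nat) (b C : R),
    [/\ (0 < k <= d * D ^ m)%N, 0 < b <= 1, 0 < C & forall l,
      let E := [set y : 'rV[F]_n | (forall i, absv (y 0 i) <= b) /\
        absv (meval (graph zeta (rfun y)) (L phi)) <= C * qV ^+ (k * l)] in
      closed E /\ (haar E <= (k%:R * qV ^+ l)%:E)%E].
Proof.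
move=> haarP d0 D0 gD phid phi0.
have [k [Q [B [B0 Q0 QP]]]] := leading_form PhiP zetaP phi0.
have [v v1 Qv] := meval_neq0 Q0.
have [vord vsep] := QP v v1.
have kD := order_bound PhiP hhE hhV gL zetaP d0 D0 gD phid v1 Qv B0 vord.
set x := meval v Q in Qv vord vsep kD.
have x0' : 0 < absv x by rewrite absv_gt0.
have [beta beta0] : exists2 t : F, t != 0 & absv t < Num.min 1 (absv x / (B + 1)).
  by apply: exists_small; rewrite lt_min ltr01 divr_gt0// ltr_wpDl.
rewrite lt_min ltr_pdivlMr ?ltr_wpDl// => /andP[beta1 betax].
have b0 : 0 < absv beta by rewrite absv_gt0.
have Bbeta : B * absv beta < absv x.
  by apply: le_lt_trans betax; rewrite mulrC ler_wpM2l ?absv_ge0// lerDl.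
(* Half of the threshold given by divided differences, whose conclusion is not strict. *)
pose C := absv x * absv beta ^+ k / 2.
have C0 : 0 < C by rewrite !mulr_gt0// exprn_gt0.
(* The order k is 0 when phi does not vanish at the point. The maximum with 1 is positive and still
   at most d D^m. *)
exists (maxn k 1), (absv beta), C; split => //.
- by rewrite leq_maxr geq_max kD muln_gt0 d0 expn_gt0 D0.
- by rewrite b0 ltW.
move=> l E.
have [BL BL0 LB] := gauss_exists (L phi).
have Ecl : closed E.
  apply: (@closed_lipschitz_sublevel R F n (fun v =>
    meval (graph zeta v) (L phi)) BL) => // e w w' e0 w1 w'1 ww'.
  have bw (u : 'I_n -> F) : (forall i, absv (u i) <= absv beta) -> unit_ball u.
    by move=> ub i; rewrite (le_trans (ub i))// ltW.
  have fP := meval_graph_limit Phi_gauss zetaP BL0 LB.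
  exact: (gauss_limit_lip fP e0 (bw _ w1) (bw _ w'1) ww').
split => //.
apply: (@le_trans _ _ (k%:R * qV ^+ l)%:E); last first.
  by rewrite lee_fin ler_wpM2r ?exprn_ge0// ler_nat leq_maxl.
apply: (haar_le_of_multiplicity haarP v1 beta0 (ltW beta1) Ecl); first by move=> y [].
move=> w ts w1 tsk ts1 tssep tsE.
have eta0 : 0 < C * qV ^+ (maxn k 1 * l) by rewrite mulr_gt0// exprn_gt0// qV_gt0.
have tsf t : t \in ts ->
    absv (meval (graph zeta (fun i =>
      beta * (w i + t * v i))) (L phi)) <= C * qV ^+ (maxn k 1 * l).
  move=> /tsE[_]; congr (absv (meval (graph zeta _) _) <= _).
  by apply/funext => i; rewrite /rfun mxE.
have := vsep beta w ts (qV ^+ l) _ beta1 Bbeta w1 (exprn_gt0 _ (@qV_gt0 R F)) eta0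
  beta0 tsk ts1 tssep tsf.
apply/negP; rewrite -ltNge /C -exprM.
have xk : 0 < absv x * absv beta ^+ k by rewrite mulr_gt0// exprn_gt0.
apply: (@lt_le_trans _ _ (absv x * absv beta ^+ k * qV ^+ (maxn k 1 * l))).
  by rewrite ltr_pM2r ?exprn_gt0 ?qV_gt0//; lra.
by rewrite ler_pM2l// ler_wiXn2l ?(ltW (@qV_lt1 R F))// mulnC leq_mul2r leq_maxl orbT.
Qed.

Definition coord (x : 'rV[F]_(n + m)) (i : 'I_(n + m)) : F :=
  meval (rfun x) (affine_inv x0 T i).

Definition local_chart : chart F (rational_points g) n :=
  Chart [set z | unit_ball (coord (set_val z))]
    (fun z => \row_i coord (set_val z) (lshift m i)).

Lemma meval_coord x p : meval (coord x) (L p) = meval (rfun x) p.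
Proof. by rewrite -meval_psub affine_subK. Qed.

Lemma coord_affine w : coord (\row_i meval w (affine_sub x0 T i)) = w.
Proof.
apply/funext => i; rewrite /coord.
rewrite (_ : rfun _ = fun j => meval w (affine_sub x0 T j)); last first.
  by apply/funext => j; rewrite /rfun mxE.
by rewrite -meval_psub -(psubXU (affine_inv x0 T)) affine_invK// mevalXU.
Qed.

(** The hh_i vanish at the prime ideal of a point of X, so its coordinates satisfy z = Phi;
    uniqueness of the solution places them on the graph. *)
Lemma coord_graph z : cdom local_chart z ->
  coord (set_val z) = graph zeta (rfun (cmap local_chart z)).
Proof.
move=> z1; set w := coord _ in z1 *.
have zeq i : w (rshift n i) = meval w (Phi i).
  have [P PE] := evaluation_prime (rfun (set_val z)).
  have XP : zero_locus (range g) P.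
    by move=> _ [j _ <-]; apply/PE; exact: (set_valP z).
  have /PE := hhV i XP; rewrite -meval_coord -/w hhE mevalB mevalXU.
  by move/eqP; rewrite subr_eq0 => /eqP.
have wE : w = joinv (fun i => w (lshift m i)) (fun i => w (rshift n i)).
  apply/funext => i; rewrite -[i]splitK; case: (fintype.split i) => j /=.
    by rewrite joinv_lshift.
  by rewrite joinv_rshift.
have yE : rfun (cmap local_chart z) = fun i => w (lshift m i).
  by apply/funext => i; rewrite /rfun mxE.
rewrite yE {1}wE /graph; congr joinv.
apply: (zeta_unique Phi_gauss zetaP) => [i|i|i]; [exact: z1|exact: z1|].
by rewrite -wE; apply: zeq.
Qed.

Lemma chart_eval z p : cdom local_chart z ->
  meval (rfun (set_val z)) p = meval (graph zeta (rfun (cmap local_chart z))) (L p).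
Proof. by move=> z1; rewrite -coord_graph// meval_coord. Qed.

Lemma chart_image : cmap local_chart @` cdom local_chart =
  [set y | forall i, absv (y 0 i) <= 1].
Proof.
apply/seteqP; split => [_ [z z1 <-] i|y y1]; first by rewrite mxE; apply: z1.
pose x : 'rV[F]_(n + m) := \row_i meval (graph zeta (rfun y)) (affine_sub x0 T i).
have cx : coord x = graph zeta (rfun y) by apply: coord_affine.
have Xx : rational_points g x.
  by move=> j; rewrite /eval_at -meval_coord cx; apply: graph_zero.
exists (SigSub (mem_set Xx)) => /=.
  by rewrite /= cx; apply: graph_unit_ball.
by apply/rowP => i; rewrite mxE cx /graph joinv_lshift.
Qed.

Lemma chart_inj : set_inj (cdom local_chart) (cmap local_chart).
Proof.
move=> z z'; rewrite !inE => z1 z'1 zz'; apply: val_inj; apply/rowP => i.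
have e : forall x : 'rV[F]_(n + m), x 0 i = meval (rfun x) (mpolyX F (mnm1 i)).
  by move=> x; rewrite mevalXU.
by rewrite (e (set_val z)) (e (set_val z')) !chart_eval// zz'.
Qed.

Lemma coord_lipschitz : exists2 C : R, 0 < C &
  forall (x y : 'rV[F]_(n + m)) (e : R), 0 <= e ->
    (forall i, absv (x 0 i - y 0 i) <= e) -> forall i, absv (coord x i - coord y i)
      <= C * e.
Proof.
pose S := \sum_j \sum_i absv (invmx T j i).
have S0 : 0 <= S by do 2 (apply: sumr_ge0 => ? _); apply: absv_ge0.
exists (1 + S) => [|x y e e0 xy i]; first by rewrite ltr_pwDl.
rewrite /coord !meval_affine_sub opprD addrACA subrr add0r -sumrB.
apply: absv_sum_le => [|j _]; first by rewrite mulr_ge0// addr_ge0.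
rewrite -mulrBl absvM mulrC ler_pM ?absv_ge0//; last exact: xy.
rewrite ler_wpDl// /S (bigD1 j)//= (bigD1 i)//= -addrA lerDl.
by rewrite addr_ge0//; do ?(apply: sumr_ge0 => ? _); rewrite ?sumr_ge0// => *;
  apply: absv_ge0.
Qed.

Lemma open_unit_ball N : open [set w : 'rV[F]_N | forall i, absv (w 0 i) <= 1].
Proof.
rewrite openE => w w1; apply/nbhs_ballP; exists 1 => //= z /(ball_rowE _ _ ltr01) wz i.
rewrite -[z 0 i](subrK (w 0 i)); apply: absvD_le => //.
by rewrite absvB_sym ltW.
Qed.

Lemma set_val_continuous (Z : set 'rV[F]_(n + m)) : continuous (@set_val _ Z).
Proof. exact: initial_continuous. Qed.

Lemma chart_continuous : continuous (cmap local_chart).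
Proof.
have [C C0 coordC] := coord_lipschitz.
have cont : continuous (fun x : 'rV[F]_(n + m) => (\row_i coord x (lshift m i) : 'rV[F]_n)).
  apply: (@lipschitz_continuous R F _ _ _ C) => // x y e e0 xy i.
  by rewrite !mxE; apply: coordC.
move=> z; apply: (@continuous_comp _ _ _ (@set_val _ (rational_points g)) _ z _ (cont _)).
exact: set_val_continuous.
Qed.

Lemma chart_open : open (cdom local_chart).
Proof.
have [C C0 coordC] := coord_lipschitz.
have cont : continuous (fun x : 'rV[F]_(n + m) => (\row_i coord x i : 'rV[F]_(n + m))).
  apply: (@lipschitz_continuous R F _ _ _ C) => // x y e e0 xy i.
  by rewrite !mxE; apply: coordC.
rewrite (_ : cdom local_chart = (fun z : rational_points g =>
  (\row_i coord (set_val z) i : 'rV[F]_(n + m)))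
    @^-1` [set w | forall i, absv (w 0 i) <= 1]); last first.
  by apply/seteqP; split => z /= z1 i; have := z1 i; rewrite mxE.
apply: open_comp; last exact: open_unit_ball.
move=> z _; apply: (@continuous_comp _ _ _ (@set_val _ (rational_points g)) _ z _ (cont _)).
exact: set_val_continuous.
Qed.

Lemma chart_atlas : submanifold_atlas local_chart.
Proof.
split.
- exact: chart_open.
- exact: chart_inj.
- by rewrite chart_image; apply: open_unit_ball.
- move=> z z1 j.
  apply: (@power_series_poly _ _ _ _ _ _ _
    (psub (fun i => mpolyX F (mnm1 i) + mpolyC _ (set_val z 0 i)) (affine_inv x0 T
      (lshift m j)))).
  move=> z' _; rewrite mxE meval_psub; apply: meval_eq => i.
  by rewrite mevalD mevalXU mevalC /rfun !mxE subrK.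
- move=> z z1 i; have [B B0 XB] := gauss_exists (L (mpolyX F (mnm1 i))).
  apply: (power_series_gauss (meval_graph_limit Phi_gauss zetaP B0 XB)).
    by move=> j; rewrite /rfun mxE; apply: z1.
  by move=> z' z'1; rewrite -chart_eval// mevalXU.
Qed.

Lemma chart_center (z0 : rational_points g) : (forall i, x0 i = set_val z0 0 i) ->
  forall i, coord (set_val z0) i = 0.
Proof.
move=> zE i; rewrite /coord meval_affine_sub addrC; apply/eqP; rewrite subr_eq0.
by apply/eqP/eq_bigr => j _; rewrite zE.
Qed.

(** A locally constant density is bounded on the compact image of K, so mu is at most a multiple of
    the Haar measure in the chart. *)
Lemma smooth_measure_le (haar : {measure set (borel (0 : 'rV[F]_n)) -> \bar R})
    (z0 : rational_points g) (mu : {measure set (borel z0) -> \bar R})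
    (K : set (rational_points g)) :
  smooth_measure haar (@submanifold_atlas R F (n + m) n (rational_points g)) mu ->
  compact K -> K `<=` cdom local_chart ->
  exists2 M, 0 < M & forall E : set 'rV[F]_n, closed E ->
    let S := cdom local_chart `&` cmap local_chart @^-1` (cmap local_chart @` K `&` E) in
    measurable (S : set (borel z0)) /\ (mu S <= M%:E * haar E)%E.
Proof.
move=> /(_ _ chart_atlas)[dens [dens0 densl densmu]] Kc Kdom.
have cKc : compact (cmap local_chart @` K).
  by apply: continuous_compact => //; apply: continuous_subspaceT; apply: chart_continuous.
have [M M0 densM] := @locally_constant_bounded _ _ _ dens cKc (fun y yK =>
  densl y (image_subset _ Kdom y yK)).
exists M => // E Ecl S.
have cKcl : closed (cmap local_chart @` K).
  by apply: compact_closed => //; apply: hausdorff_row.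
have KEcl : closed (cmap local_chart @` K `&` E) by apply: closedI.
have mcl (B : set 'rV[F]_n) : closed B -> measurable (B : set (borel (0 : 'rV[F]_n))).
  exact: (@borel_closed _ (0 : 'rV[F]_n)).
split.
  apply: (@measurableI _ (borel z0)); first by apply: (@borel_open _ z0); apply: chart_open.
  by apply: (@borel_closed _ z0); apply: closed_comp => [z _|];
    [exact: chart_continuous|exact: KEcl].
rewrite densmu; last exact: mcl.
pose D : set 'rV[F]_n :=
  [set y : 'rV[F]_n | forall i, absv (y 0 i) <= 1] `&` (cmap local_chart @` K `&` E).
rewrite chart_image -/D.
have mD : measurable (D : set (borel (0 : 'rV[F]_n))).
  by apply: mcl; apply: closedI => //; apply: closed_unit_ball.
apply: (@le_trans _ _ (\int[haar]_(x in D) M%:E)%E).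
  rewrite [leLHS]integral_mkcond [leRHS]integral_mkcond.
  apply: le_integral_ge0 => x; rewrite !patchE; case: ifP => // xD.
    by rewrite lee_fin.
  by rewrite lee_fin densM//; move: xD; rewrite inE => -[_ []].
rewrite integral_cst// lee_pmul2l//; apply: le_measure; rewrite ?inE//; first exact: mcl.
by move=> x [_ []].
Qed.

(** The generators bound |phi|, so the integrand is at most a multiple of |phi|^(-s). The sublevel
    sets of phi in K have mu-measure at most M k q^(-l), and k s < 1 because k <= d D^m. *)
Lemma integrable_neighborhood (haar : {measure set (borel (0 : 'rV[F]_n)) -> \bar R})
    (d D r : nat) (phi : mpoly (n + m) F) (z0 : rational_points g)
    (V : set (rational_points g)) (f : 'I_r -> rational_points g -> F) (s : R) :
  let atlas := @submanifold_atlas R F (n + m) n (rational_points g) in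
  normalized_haar haar -> (0 < d)%N -> (0 < D)%N ->
  (forall i, (mmeasure mdeg (g i) <= D.+1)%N) -> (mmeasure mdeg phi <= d.+1)%N ->
  ~ germ_vanishing x0 T zeta phi -> (forall i, x0 i = set_val z0 0 i) ->
  open V -> V z0 ->
  germ_ideal atlas (range f) z0 (fun z => eval_at (set_val z) phi) ->
  0 < s -> s < (d * D ^ m)%:R^-1 ->
  exists U : set (rational_points g), [/\ open U, U z0, U `<=` V &
    forall mu : {measure set (borel z0) -> \bar R},
      smooth_measure haar atlas mu -> compactly_supported_in U mu ->
      (\int[mu]_(x in U)
         \big[Order.min/+oo]_(i < r) neg_power (absv (f i x)) s < +oo)%E].
Proof.
move=> atlas haarP d0 D0 gD phid phi0 x0E Vo Vz0 fphi s0 sdD.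
have [k [b [C [/andP[k0 kdD] /andP[b0 b1] C0 sub]]]] :=
  haar_sublevel haarP d0 D0 gD phid phi0.
have dD0 : 0 < (d * D ^ m)%:R :> R by rewrite ltr0n muln_gt0 d0 expn_gt0 D0.
have ks : k%:R * s < 1.
  apply: (@le_lt_trans _ _ ((d * D ^ m)%:R * s));
    first by rewrite ler_wpM2r ?(ltW s0)// ler_nat.
  by rewrite mulrC -ltr_pdivlMr// mul1r.
have z0_coord := chart_center x0E.
have z0_dom : cdom local_chart z0.
  by move=> i; rewrite z0_coord absv0.
have chart_near e : 0 < e ->
    \forall z \near z0, ball (cmap local_chart z0) e (cmap local_chart z).
  move=> e0; apply: (chart_continuous (x := z0)).
  exact: nbhsx_ballx.
have [A [A0 phif]] := germ_ideal_le (psi :=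
  local_chart) chart_atlas z0_dom chart_open chart_near fphi.
(* Its interior is the neighborhood U: it does not depend on mu, which affects only the constant
   M. *)
pose N := [set z : rational_points g | [/\ V z, cdom local_chart z,
  forall i, absv (cmap local_chart z 0 i) <= b &
  eval_at (set_val z) phi != 0 -> exists j, absv (eval_at (set_val z) phi) <= A *
    absv (f j z)]].
have nN : nbhs z0 N.
  have nV : \forall z \near z0, V z by apply: open_nbhs_nbhs.
  have ndom : \forall z \near z0, cdom local_chart z.
    by apply: open_nbhs_nbhs; split => //; apply: chart_open.
  near=> z; split.
  - by near: z.
  - by near: z.
  - move=> i; have /(ball_rowE _ _ b0)/(_ i) : ball (cmap local_chart z0) b (cmap
      local_chart z).
      by near: z; apply: chart_near.
    by rewrite mxE z0_coord sub0r absvN => /ltW.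
  - by near: z.
exists (interior N); split => //; first exact: open_interior.
  by move=> z /interior_subset[].
move=> mu mu_smooth [K [Kc KU muK]].
have KN z : K z -> N z by move=> /KU/interior_subset.
have Kdom : K `<=` cdom local_chart by move=> z /KN[].
have [M M0 muM] := smooth_measure_le mu_smooth Kc Kdom.
have Kcl : closed K.
  apply: compact_closed Kc.
  apply: (hausdorff_injective (@hausdorff_row R F (n + m)) (@set_val_continuous
    (rational_points g))).
  exact: val_inj.
have mK : measurable (K : set (borel z0)) by apply: (@borel_closed _ z0).
have mKC : measurable (~` K : set (borel z0)) by apply: measurableC.
have muKC : mu (~` K) = 0%E by apply/negligibleP.
have KS z E : K z -> E (cmap local_chart z) ->
    (cdom local_chart `&` cmap local_chart @^-1` (cmap local_chart @` K `&` E)) z.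
  by move=> Kz Ez; split; [exact: Kdom|split => //; exists z].
rewrite integral_mkcond.
apply: (@neg_power_integral_lty _ _ _ mu K (fun z => absv (eval_at (set_val z) phi)) _
  C qV s (A `^ s) (M * k%:R) k) => //.
- have [mS] := muM _ (@closed_unit_ball R F n).
  rewrite haarP.2 mule1 => muS.
  apply: (@le_trans _ _ M%:E); last by rewrite lee_fin ler_peMr ?ler1n// ltW.
  apply: le_trans muS; apply: le_measure; rewrite ?inE// => z Kz.
  by apply: KS => // i; rewrite mxE; apply: Kdom.
- exact: qV_gt0.
- exact: qV_lt1.
- exact: ltW.
- by rewrite powR_gt0.
- move=> z Kz; rewrite patchE mem_set; last exact: KU.
  by have [_ _ _ zf] := KN z Kz; apply: bigmin_neg_power_le.
- move=> z; rewrite patchE; case: ifP => // _.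
  apply: le_bigmin => [|j _]; first exact: leey.
  by rewrite /neg_power; case: ifP; rewrite ?leey// lee_fin powR_ge0.
move=> l; have [Ecl haarE] := sub l; have [mS muS] := muM _ Ecl.
eexists; split; [exact: mS| |].
- move=> z Kz phiz; apply: KS => //; split; first by case: (KN z Kz).
  by rewrite -chart_eval; last exact: Kdom.
- by apply: (le_trans muS); rewrite -mulrA EFinM lee_pmul2l.
Unshelve. all: by end_near. Qed.

End LocalChart.

Theorem theorem1p4 (R : realType) (F : nonArchLocalFieldType R)
  (n m r d D : nat) (d_ge1 : (1 <= d)%N) (D_ge1 : (1 <= D)%N)
  (haar : {measure set (borel (0 : 'rV[F]_n)) -> \bar R})
  (haarP : normalized_haar haar)
  (g : 'I_m -> mpoly (n + m) F)
  (g_deg : forall j, (msize (g j) <= D.+1)%N)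
  (phi : 'I_r -> mpoly (n + m) F)
  (phi_deg : forall i, (msize (phi i) <= d.+1)%N)
  (X_smooth : @smooth_of_dim F n m (zero_locus (range g)))
  (phi_neq0 : forall X', irreducible_component (zero_locus (range g)) X' ->
     ~ forall i, vanishing_ideal X' (phi i))
  (x0 : rational_points g) :
  let atlas := @submanifold_atlas R F (n + m) n (rational_points g) in
  let phiF i := (fun x : rational_points g => eval_at (set_val x) (phi i)) in
  let J := analytic_ideal atlas phiF in
  (((d * D ^ m)%:R^-1)%:E <= lct haar atlas J x0)%E.
Proof.
pose atlas := @submanifold_atlas R F (n + m) n (rational_points g).
pose phiF i := (fun x : rational_points g => eval_at (set_val x) (phi i)).
change (((d * D ^ m)%:R^-1)%:E <= lct haar atlas (analytic_ideal atlas phiF) x0)%E.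
pose x := rfun (set_val x0).
have gx j : meval x (g j) = 0 by exact: (set_valP x0).
have [T [Phi [hh [T_unit PhiP hhE hhV gL]]]] := local_model X_smooth gx.
have [zeta zetaP] := picard_limit (fun i => proj1 (PhiP i)).
have [X' [X'_comp X'P]] := germ_component T_unit PhiP hhE hhV gL zetaP.
have [i phi_i] : exists i, ~ germ_vanishing x T zeta (phi i).
  apply: contrapT => /forallNP none; apply: (phi_neq0 X' X'_comp) => i; apply: X'P;
    apply: contrapT; exact: none.
apply/ereal_infP => _ [r' [V [f [[Vo Vx0 _ Jf] ->]]]].
have phi_germ : germ_ideal atlas (range f) x0 (phiF i).
  by rewrite -Jf; apply: germ_ideal_gen.
have dD0 : 0 < (d * D ^ m)%:R^-1 :> R by rewrite invr_gt0 ltr0n muln_gt0 d_ge1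
  expn_gt0 D_ge1.
set N := (d * D ^ m)%:R^-1 in dD0 *.
(* N - e may fail to be positive; the maximum with N / 2 gives an exponent strictly between 0 and
   N. *)
apply/lee_subgt0Pr => e e0; apply: (@le_trans _ _ (Num.max (N - e) (N / 2))%:E).
  by rewrite -EFinB lee_fin le_max lexx.
apply: ereal_sup_ubound; exists (Num.max (N - e) (N / 2)) => //.
have s0 : 0 < Num.max (N - e) (N / 2) by rewrite lt_max divr_gt0// orbT.
split; first exact: ltW.
apply: (integrable_neighborhood T_unit PhiP hhE hhV gL zetaP haarP d_ge1 D_ge1 g_deg
  (phi_deg i) phi_i _ Vo Vx0 phi_germ s0) => //.
by rewrite gt_max -/N gtrBl e0 gtr_pMr// invf_lt1// ltr1n.
Qed.
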